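(* Let $n\ge0$ and $s\in\mathbb R$. If $s\ge0$, then $\mathcal A_s$ is $\widetilde{\mathrm{Aut}}(\mathcal U_{n+1})$-$\widetilde U_s$-invariant with its norm. Conversely, let $H$ be a non-trivial Hilbert space continuously embedded in $\mathrm{Hol}(\mathcal U_{n+1})$ such that $U_s$ induces a bounded (resp. isometric) representation of $G_T$ in $H$. Then $s\ge0$ and $H=\mathcal A_s$ with equivalent (resp. proportional) norms.
   Context: $\mathcal U_{n+1}=\{(\zeta,z)\in\mathbb C^n\times\mathbb C:\operatorname{Im}z>|\zeta|^2\}$ (the upper half-plane when $n=0$); $\langle\cdot|\cdot\rangle$ is the standard hermitian scalar product on $\mathbb C^n$ (linear in the first variable). $\mathrm{Hol}(\mathcal U_{n+1})$ is the Fréchet space of holomorphic functions with the topology of locally uniform convergence. $G_T$ is the group of the affine biholomorphisms of $\mathcal U_{n+1}$ of the form $(\zeta',z')\mapsto(R\zeta'+\zeta,\ R^2z'+x+i|\zeta|^2+2i\langle R\zeta'|\zeta\rangle)$ with $R>0$, $\zeta\in\mathbb C^n$, $x\in\mathbb R$ (semidirect product of the Heisenberg group and the dilations). For $\varphi\in G_T$, $U_s(\varphi)f=(f\circ\varphi^{-1})\,|J\varphi^{-1}(0,i)|^{s/(n+2)}$, where $J$ is the complex Jacobian determinant. $\widetilde{\mathrm{Aut}}(\mathcal U_{n+1})$ is the universal covering group of the group of biholomorphisms of $\mathcal U_{n+1}$, acting on $\mathcal U_{n+1}$ through that group; for $\varphi\in\widetilde{\mathrm{Aut}}(\mathcal U_{n+1})$,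 $\widetilde U_s(\varphi)f=(f\circ\varphi^{-1})\,(J\varphi^{-1})^{s/(n+2)}$, where $(\varphi,(\zeta,z))\mapsto(J\varphi^{-1})^{s/(n+2)}(\zeta,z)$ is the branch of the power which is continuous on the simply connected manifold $\widetilde{\mathrm{Aut}}(\mathcal U_{n+1})\times\mathcal U_{n+1}$ and equals $1$ at (identity, $(0,i)$). For $s\ge0$, $\mathcal A_s$ is the reproducing kernel Hilbert space of holomorphic functions on $\mathcal U_{n+1}$ with reproducing kernel $((\zeta,z),(\zeta',z'))\mapsto\left(\frac{z-\overline{z'}}{2i}-\langle\zeta|\zeta'\rangle\right)^{-s}$ (principal power; the base has positive real part; this kernel is known to be positive exactly when $s\ge0$). A space is $G$-$U$-invariant with its norm if each $U(g)$, $g\in G$, maps it into itself and preserves its norm. $U_s$ induces a bounded (resp. isometric) representation in $H$ if all $U_s(\varphi)$ map $H$ into $H$ and are uniformly bounded for (resp. preserve) the norm of $H$. *)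

(* Defs.v *)
From HB Require Import structures.
From mathcomp Require Import all_boot all_order all_algebra.
From mathcomp Require Import complex.
From mathcomp Require Import all_classical all_reals all_analysis.

Import numFieldNormedType.Exports.

Set Implicit Arguments.
Unset Strict Implicit.
Unset Printing Implicit Defensive.

Import Order.TTheory GRing.Theory Num.Theory.
Import ComplexField.Normc.

Local Open Scope ring_scope.
Local Open Scope classical_set_scope.
Local Open Scope complex_scope.

#[warning="-redundant-canonical-projection"]
HB.instance Definition _ (R : realType) := NormedModule.copy R[i] R[i]^o.

Section ComplexPowers.
Context {R : realType}.
Implicit Types (z : R[i]) (a : R).

Definition cexp z : R[i] :=
  (expR (complex.Re z))%:C * (cos (complex.Im z) +i* sin (complex.Im z)).

(* The principal argument, with values in ]-pi, pi] (for z != 0). *)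
Definition carg z : R :=
  let t := acos (complex.Re z / normc z) in
  if 0 <= complex.Im z then t else - t.

Definition clog z : R[i] := ln (normc z) +i* carg z.

Definition cpow z a : R[i] := cexp (a%:C * clog z).

End ComplexPowers.

Section Domain.
Variables (R : realType) (n : nat).
Local Notation C := R[i].
Implicit Types (u v : 'rV[C]_n) (w : 'rV[C]_n.+1).

(* C^n x C is represented by 'rV_n.+1, the last coordinate being z. *)
Definition zeta w : 'rV[C]_n := \row_i w ord0 (lift ord_max i).
Definition zcoord w : C := w ord0 ord_max.
Definition pt u (z : C) : 'rV[C]_n.+1 :=
  \row_j (if unlift ord_max j is Some i then u ord0 i else z).

Definition herm u v : C := \sum_(i < n) u ord0 i * (v ord0 i)^*.
Definition sqnorm u : R := \sum_(i < n) normc (u ord0 i) ^+ 2.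

Definition siegel : set 'rV[C]_n.+1 :=
  [set w | sqnorm (zeta w) < complex.Im (zcoord w)].

Lemma siegel_base : siegel (pt 0 'i%C).
Proof.
rewrite /siegel /= /zcoord mxE unlift_none /= /sqnorm big1 ?ltr01// => i _.
by rewrite !mxE liftK mxE normc0 expr0n.
Qed.

Definition base : siegel := SigSub (mem_set siegel_base).

Lemma siegel0 : ~ siegel 0.
Proof.
rewrite /siegel /= /zcoord mxE /=; apply/negP; rewrite -leNgt.
by apply: sumr_ge0 => i _; rewrite sqr_ge0.
Qed.

Lemma continuous_normc : continuous (@normc R).
Proof.
have t (u v : C) : normc u <= normc (u - v) + normc v.
  by have := le_normcD (u - v) v; rewrite subrK.
move=> x; apply/(@cvgrPdist_lt _ R _ (nbhs (x : C))) => e e0.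
have e0' : 0 < e%:C by rewrite ltcR.
apply/nbhs_ballP; exists e%:C => //= y.
rewrite -ball_normE /ball_ /= -[`|x - y|]/((normc (x - y))%:C) ltcR.
apply: le_lt_trans; rewrite ler_norml lerBlDr t andbT lerNl opprB lerBlDr.
by rewrite -(normcN (x - y)) opprB t.
Qed.

Lemma continuous_cIm : continuous (@complex.Im R).
Proof.
move=> x; apply/(@cvgrPdist_lt _ R _ (nbhs (x : C))) => e e0.
have e0' : 0 < e%:C by rewrite ltcR.
apply/nbhs_ballP; exists e%:C => //= y.
rewrite -ball_normE /ball_ /= -[`|x - y|]/((normc (x - y))%:C) ltcR.
apply: le_lt_trans; case: (x) (y) => [a b] [c d] /=.
by rewrite -sqrtr_sqr ler_sqrt ?addr_ge0 ?sqr_ge0// lerDr sqr_ge0.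
Qed.

Lemma open_siegel : open siegel.
Proof.
pose g w : R := complex.Im (zcoord w) - sqnorm (zeta w).
have cg : continuous g.
  move=> w.
  have h : zcoord v @[v --> w] --> zcoord w by exact: coord_continuous.
  have h1 := cvg_comp _ _ h (@continuous_cIm (zcoord w)).
  have h2 i : normc (zeta y ord0 i) @[y --> w] --> normc (zeta w ord0 i).
    have k : zeta y ord0 i @[y --> w] --> zeta w ord0 i.
      rewrite (_ : (fun y => _) = fun y : 'rV[C]_n.+1 => y ord0 (lift ord_max i)).
        by rewrite mxE; exact: coord_continuous.
      by apply/funext => y; rewrite mxE.
    exact: (cvg_comp _ _ k (@continuous_normc (zeta w ord0 i))).
  have h3 : sqnorm (zeta y) @[y --> w] --> sqnorm (zeta w).
    apply: (@cvg_big R _ +%R 0 _ _ _ (nbhs w)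
      _ (fun i y => normc (zeta y ord0 i) ^+ 2)) => [|i _].
      exact: add_continuous.
    exact: (cvgM (h2 i) (h2 i)).
  exact: (cvgB h1 h3).
rewrite (_ : siegel = g @^-1` [set x | 0 < x]).
  by apply: open_comp => [w _|]; [exact: cg|exact: open_gt].
by apply/seteqP; split => w; rewrite /siegel /g /= subr_gt0.
Qed.

(* Holomorphic functions on the domain are honest functions on the subtype
   [siegel]; complex Frechet differentiability is tested on the extension by 0,
   and does not depend on this extension since [siegel] is open. *)
Definition ext {W : normedModType C} (f : siegel -> W) : 'rV[C]_n.+1 -> W :=
  'valL_ 0 f.

Definition holomorphic {W : normedModType C} (f : siegel -> W) :=
  forall w : siegel, differentiable (ext f) (\val w).

Definition incl (f : siegel -> siegel) (w : siegel) : 'rV[C]_n.+1 := \val (f w).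

(* [jacobian] acts on row vectors, which does not affect the determinant. *)
Definition cjac (f : siegel -> siegel) (w : siegel) : C :=
  \det (jacobian (ext (incl f)) (\val w)).

Lemma extE {W : normedModType C} (f : siegel -> W) (w : siegel) :
  ext f (\val w) = f w.
Proof. by rewrite /ext -[in RHS](valLK (0 : W) f). Qed.

Lemma ext_out {W : normedModType C} (f : siegel -> W) w :
  ~ siegel w -> ext f w = 0.
Proof.
by move=> nw; rewrite /ext /valL_ /= oinv_set_val insubN//; apply/negP => /set_mem.
Qed.

Lemma near_eq_differentiable {W : normedModType C} (f g : 'rV[C]_n.+1 -> W) x :
  {near x, f =1 g} -> differentiable g x -> differentiable f x.
Proof.
move=> fg dg.
have fgx : f x = g x by exact: (nbhs_singleton fg).
have [cdg dgE] := (diff_locallyP _ _).1 dg.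
have dfE : f \o shift x = cst (f x) + 'd g x +o_ 0 id.
  apply/eqaddoP => _/posnumP[e].
  have /eqaddoP/(_ _ (gt0 e)) := dgE.
  have fg0 : \forall h \near 0, f (h + x) = g (h + x).
    by move: fg; rewrite (near_shift 0) /= subr0.
  by apply: filterS2 fg0 => h /= fgh; rewrite !fctE /= /shift fgh fgx.
by apply/diff_locallyP; rewrite (diff_unique cdg dfE).
Qed.

Lemma holomorphic_id : holomorphic (incl id).
Proof.
move=> w; apply: (@near_eq_differentiable _ _ id) => //.
near=> v.
have sv : siegel v.
  near: v; apply: open_nbhs_nbhs; split; first exact: open_siegel.
  by apply: set_mem; exact: valP.
by rewrite -[v in LHS]/(\val (SigSub (mem_set sv) : siegel)) extE.
Unshelve. all: by end_near. Qed.

Lemma holomorphic_comp (f g : siegel -> siegel) :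
  holomorphic (incl f) -> holomorphic (incl g) -> holomorphic (incl (f \o g)).
Proof.
move=> hf hg w.
rewrite (_ : ext _ = ext (incl f) \o ext (incl g)).
  apply: differentiable_comp; first exact: hg.
  by rewrite extE; exact: hf.
apply/funext => v /=; have [sv|nv] := pselect (siegel v).
  by rewrite -[v]/(\val (SigSub (mem_set sv) : siegel)) !extE.
by rewrite !(ext_out _ nv) ext_out//; exact: siegel0.
Qed.

End Domain.

Arguments siegel : clear implicits.
Arguments base : clear implicits.

Section Biholomorphisms.
Variables (R : realType) (n : nat).
Local Notation D := (siegel R n).

Record biholo := Biholo {
  biholo_fun :> D -> D;
  biholo_inv : D -> D;
  biholo_funK : cancel biholo_fun biholo_inv;
  biholo_invK : cancel biholo_inv biholo_fun;
  biholo_hol : holomorphic (incl biholo_fun);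
  biholo_inv_hol : holomorphic (incl biholo_inv) }.

Lemma biholoP (f g : biholo) : f =1 g -> f = g.
Proof.
case: f g => [f f' fK f'K hf hf'] [g g' gK g'K hg hg'] /= /funext fg.
rewrite {}fg in fK f'K hf *.
have fg' : f' = g' by apply/funext => w; rewrite -{1}(g'K w) fK.
rewrite {}fg' in fK f'K hf' *.
by congr Biholo; exact: Prop_irrelevance.
Qed.

HB.instance Definition _ := gen_eqMixin biholo.
HB.instance Definition _ := gen_choiceMixin biholo.

Definition biholo1 : biholo :=
  @Biholo id id (fun=> erefl) (fun=> erefl) (@holomorphic_id R n)
    (@holomorphic_id R n).

Definition biholoM (f g : biholo) : biholo :=
  Biholo (can_comp (biholo_funK f) (biholo_funK g))
    (can_comp (biholo_invK g) (biholo_invK f))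
    (holomorphic_comp (biholo_hol f) (biholo_hol g))
    (holomorphic_comp (biholo_inv_hol g) (biholo_inv_hol f)).

Definition biholoV (f : biholo) : biholo :=
  Biholo (biholo_invK f) (biholo_funK f) (biholo_inv_hol f) (biholo_hol f).

Lemma biholoA : associative biholoM. Proof. by move=> f g h; exact: biholoP. Qed.
Lemma biholo1M : left_id biholo1 biholoM. Proof. by move=> f; exact: biholoP. Qed.
Lemma biholoM1 : right_id biholo1 biholoM. Proof. by move=> f; exact: biholoP. Qed.
Lemma biholoVM : left_inverse biholo1 biholoV biholoM.
Proof. by move=> f; apply: biholoP => w /=; exact: biholo_funK. Qed.
Lemma biholoMV : right_inverse biholo1 biholoV biholoM.
Proof. by move=> f; apply: biholoP => w /=; exact: biholo_invK. Qed.

HB.instance Definition _ :=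
  isGroup.Build biholo biholoA biholo1M biholoM1 biholoVM biholoMV.

HB.instance Definition _ := Topological.copy biholo
  (initial_topology (biholo_fun : biholo -> {compact-open, D -> D})).

(* (zeta', z') |-> (r zeta' + u, r^2 z' + x + i|u|^2 + 2i <r zeta' | u>) *)
Definition GT : set biholo := [set f | exists (r : R) (u : 'rV[R[i]]_n) (x : R),
  0 < r /\ forall w : D,
    \val (f w) = pt (r%:C *: zeta (\val w) + u)
      (r%:C ^+ 2 * zcoord (\val w) + x%:C + 'i%C * (sqnorm u)%:C
       + 2 * 'i%C * herm (r%:C *: zeta (\val w)) u)].

End Biholomorphisms.

Arguments GT : clear implicits.

HB.mixin Record isTopologicalGroup G of Group G & Topological G := {
  mulg_continuous : continuous (fun xy : G * G => (xy.1 * xy.2)%g);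
  invg_continuous : continuous (fun x : G => (x^-1)%g) }.

#[short(type="topologicalGroupType")]
HB.structure Definition TopologicalGroup :=
  {G of Group G & Topological G & isTopologicalGroup G}.

Section Coverings.
Variable R : realType.

Definition path_from_to (X : topologicalType) (x y : X) (c : R -> X) :=
  [/\ {within `[0, 1], continuous c}, c 0 = x & c 1 = y].

Definition path_connected (X : topologicalType) :=
  forall x y : X, exists c, path_from_to x y c.

Definition null_homotopic (X : topologicalType) (x : X) (c : R -> X) :=
  exists h : R * R -> X, [/\
    {within `[0, 1] `*` `[0, 1], continuous h},
    forall t, t \in `[0, 1] -> h (0, t) = c t /\ h (1, t) = x &
    forall u, u \in `[0, 1] -> h (u, 0) = x /\ h (u, 1) = x].

Definition simply_connected (X : topologicalType) :=
  path_connected X /\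
  forall (x : X) c, path_from_to x x c -> null_homotopic x c.

Definition evenly_covered (X Y : topologicalType) (p : X -> Y) (N : set Y) :=
  exists (I : Type) (S : I -> set X), [/\
    forall i, open (S i), trivIset [set: I] S, p @^-1` N = \bigcup_i S i &
    forall i, exists g : Y -> X, [/\
      {within N, continuous g},
      forall y, N y -> S i (g y) /\ p (g y) = y &
      forall x, S i x -> g (p x) = x]].

Definition covering_map (X Y : topologicalType) (p : X -> Y) :=
  [/\ continuous p, set_surj [set: X] [set: Y] p &
    forall y, exists N, [/\ open N, N y & evenly_covered p N]].

Definition universal_covering n (G : topologicalGroupType)
    (p : {multiplicative G -> biholo R n}) :=
  covering_map p /\ simply_connected G.

End Coverings.

Section Representations.
Variables (R : realType) (n : nat).
Local Notation C := R[i].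
Local Notation D := (siegel R n).
Local Notation o := (base R n).

Definition U (s : R) (f : biholo R n) (h : D -> C) : D -> C :=
  fun w => h ((f^-1)%g w) * (normc (cjac (f^-1)%g o) `^ (s / n.+2%:R))%:C.

(* [b (g, w)] is the value at [w] of the branch of (J g^-1)^(s / (n + 2)); the
   determinations of J^a are the exp (a * l) with exp l = J. *)
Definition jacobian_power (s : R) (G : topologicalGroupType)
    (p : {multiplicative G -> biholo R n}) (b : G * D -> C) :=
  [/\ continuous b, b (1%g, o) = 1 &
    forall g w, exists l, cexp l = cjac ((p g)^-1)%g w /\
      b (g, w) = cexp ((s / n.+2%:R)%:C * l)].

Definition Utilde (G : topologicalGroupType)
    (p : {multiplicative G -> biholo R n}) (b : G * D -> C) (g : G)
    (h : D -> C) : D -> C :=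
  fun w => h (((p g)^-1)%g w) * b (g, w).

(* A Hilbert space of holomorphic functions: the elements of the abstract
   complete space are identified with functions through [hol_fun], and [hol_dot]
   is linear in its first variable. *)
Record hol_hilbert := HolHilbert {
  hol_space :> completeNormedModType C;
  hol_dot : {dot hol_space for (@Num.conj C)};
  hol_normE : forall h : hol_space, `|h| ^+ 2 = hol_dot h h;
  hol_fun : {linear hol_space -> (D -> C)};
  hol_fun_inj : injective hol_fun;
  hol_fun_hol : forall h, holomorphic (hol_fun h : D -> C) }.

Arguments hol_fun {_}.
Arguments hol_dot {_}.

Definition continuously_embedded (H : hol_hilbert) :=
  continuous (@hol_fun H : H -> {family compact, D -> C}).

Definition nontrivial (H : hol_hilbert) := exists h : H, h != 0.

Definition invariant_with_norm (T : Type) (S : set T)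
    (V : T -> (D -> C) -> (D -> C)) (H : hol_hilbert) :=
  forall g, S g -> forall h : H, exists h' : H,
    hol_fun h' = V g (hol_fun h) /\ `|h'| = `|h|.

Definition bounded_representation (T : Type) (S : set T)
    (V : T -> (D -> C) -> (D -> C)) (H : hol_hilbert) :=
  exists M : R, forall g, S g -> forall h : H, exists h' : H,
    hol_fun h' = V g (hol_fun h) /\ `|h'| <= M%:C * `|h|.

Definition same_space (H A : hol_hilbert) :=
  range (@hol_fun H) = range (@hol_fun A).

Definition equivalent_norms (H A : hol_hilbert) :=
  exists c1 c2 : R, [/\ 0 < c1, 0 < c2 &
    forall (h : H) (a : A), hol_fun h = hol_fun a ->
      c1%:C * `|a| <= `|h| <= c2%:C * `|a|].

Definition proportional_norms (H A : hol_hilbert) :=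
  exists c : R, 0 < c /\
    forall (h : H) (a : A), hol_fun h = hol_fun a -> `|h| = c%:C * `|a|.

Definition reproducing (K : D -> D -> C) (A : hol_hilbert) :=
  forall w : D, exists k : A,
    hol_fun k = K ^~ w /\ forall a : A, hol_fun a w = hol_dot a k.

Definition kernelA (s : R) (w w' : D) : C :=
  cpow ((zcoord (\val w) - (zcoord (\val w'))^*) / (2 * 'i%C)
        - herm (zeta (\val w)) (zeta (\val w'))) (- s).

(* Such an [A] is unique up to an isometry compatible with [hol_fun]. *)
Definition is_As (s : R) (A : hol_hilbert) := reproducing (kernelA s) A.

End Representations.

Arguments hol_fun {R n _}.
Arguments hol_dot {R n _}.

(* Main.v *)
Require Import Defs.
From HB Require Import structures.
From mathcomp Require Import all_boot all_order all_algebra.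
From mathcomp Require Import complex.
From mathcomp Require Import all_classical all_reals all_analysis.
From mathcomp Require Import ring lra.

Import numFieldNormedType.Exports.
Import Order.TTheory GRing.Theory Num.Theory.
Import ComplexField.Normc.

Set Implicit Arguments.
Unset Strict Implicit.
Unset Printing Implicit Defensive.

Local Open Scope ring_scope.
Local Open Scope classical_set_scope.

(* Write [kap] for the polarised defining function of the domain, so that the
   kernel of A_s is the power [- s] of [kap].  Every biholomorphism f satisfies
     kap (f w, f w')^(n+2) = kap (w, w')^(n+2) Jf(w) conj(Jf(w')).
   This is clear for the affine maps, which act transitively; if f fixes the
   base point, then the Schwarz lemma in the ball (Cayley transform c) gives
   |c f| = |c|, hence <c f | c f'> = <c | c'> because a kernel which is
   holomorphic in w and antiholomorphic in w' is determined by its diagonal,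
   and differentiating gives the claim.  Consequently the quotient
     b(g, w) conj(b(g, w')) K(g^-1 w, g^-1 w') / K(w, w')
   takes its values in a countable set; it is continuous along paths in the
   covering group and equal to 1 at the identity, so it is 1.  Hence the
   operators map kernel functions to multiples of kernel functions and
   preserve their inner products, so they are isometric on A_s.

   Conversely, G_T is solvable, so that averaging with invariant means replaces
   the norm of H by an equivalent invariant one.  When the norm is invariant,
   transitivity determines the reproducing kernel of H on the diagonal, and
   therefore everywhere: it is a positive multiple of [kap] to the power [- s].
   The Cauchy-Schwarz inequality at two points then forces s >= 0. *)

(** The one-variable theory rests on Goursat's theorem, without power series: pulled back by the
    exponential, circles become vertical segments, which gives the mean value property and, with
    disc automorphisms, the maximum principle. Dividing by a zero leaves a point where only
    continuity is known, so these statements tolerate a finite exceptional set. Iterated division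
    then yields the identity theorem, since each zero close to the centre costs a fixed factor
    smaller than 1. The exponent [n + 2] appears because the Jacobian determinant only sees that
    power of the scalar automorphy factor. Extracting the power [s / (n + 2)] leaves an ambiguity in
    a countable set, which is all that a connectedness argument requires: no logarithm of the
    Jacobian is chosen globally. The orbits of the representation in [H] carry no regularity in the
    group element, so the means are taken over all bounded functions on a discrete abelian group. As
    they are built for abelian groups only, solvability is used one abelian layer at a time. *)

Local Notation "x %:C" := (real_complex _ x) : ring_scope.

(** * Complex numbers and complex differentiability *)

Section ComplexBasics.
Context {R : realType}.
Local Notation C := R[i].
Implicit Types (z w : C) (e d : R).

Lemma ceq z w : complex.Re z = complex.Re w -> complex.Im z = complex.Im w -> z = w.
Proof. by case: z w => [a b] [c d] /= -> ->. Qed.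

Lemma normcE' z : `|z| = (normc z)%:C. Proof. by []. Qed.

Lemma normc_ge0 z : 0 <= normc z.
Proof. by case: z => a b /=; rewrite sqrtr_ge0. Qed.

Lemma normc_eq0 z : (normc z == 0) = (z == 0).
Proof. by apply/eqP/eqP => [/eq0_normc|->]; rewrite ?normc0. Qed.

Lemma normc_gt0 z : (0 < normc z) = (z != 0).
Proof. by rewrite lt_def normc_ge0 andbT normc_eq0. Qed.

Lemma sqr_normcE z : normc z ^+ 2 = complex.Re z ^+ 2 + complex.Im z ^+ 2.
Proof. by case: z => a b /=; rewrite sqr_sqrtr// addr_ge0 ?sqr_ge0. Qed.

Lemma normc_real (x : R) : normc x%:C = `|x|.
Proof. by rewrite /= expr0n addr0 sqrtr_sqr. Qed.

Lemma conjcE (a b : R) : (Complex a b)^* = Complex a (- b) :> C.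
Proof. by []. Qed.

Lemma normc_conj z : normc z^* = normc z.
Proof. by case: z => a b /=; rewrite sqrrN. Qed.

Lemma normc_i : normc ('i%C : C) = 1.
Proof. by rewrite /= expr0n expr1n add0r sqrtr1. Qed.

Lemma normcX z k : normc (z ^+ k) = normc z ^+ k.
Proof. by elim: k => [|k IH]; rewrite ?expr0 ?normc1// !exprS normcM IH. Qed.

Lemma ler_normcB z w : normc (z - w) <= normc z + normc w.
Proof. by rewrite -[normc w]normcN le_normcD. Qed.

Lemma lerB_normc z w : normc z - normc w <= normc (z - w).
Proof. by rewrite lerBlDr -[X in normc X <= _](subrK w) le_normcD. Qed.

Lemma normcBC z w : normc (z - w) = normc (w - z).
Proof. by rewrite -normcN opprB. Qed.

Lemma Re_le_normc z : `|complex.Re z| <= normc z.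
Proof.
by case: z => a b /=; rewrite -sqrtr_sqr ler_sqrt ?addr_ge0 ?sqr_ge0// lerDl sqr_ge0.
Qed.

Lemma Im_le_normc z : `|complex.Im z| <= normc z.
Proof.
by case: z => a b /=; rewrite -sqrtr_sqr ler_sqrt ?addr_ge0 ?sqr_ge0// lerDr sqr_ge0.
Qed.

Lemma normc_le_ReIm z : normc z <= `|complex.Re z| + `|complex.Im z|.
Proof.
rewrite -(@ler_pXn2r _ 2)// ?nnegrE ?addr_ge0 ?normc_ge0//.
rewrite sqr_normcE sqrrD !real_normK ?num_real//.
by rewrite -addrA lerD2l lerDr mulrn_wge0// mulr_ge0.
Qed.

Lemma mul_conjc z : z * z^* = (normc z ^+ 2)%:C.
Proof. case: z => a b; rewrite sqr_normcE /=; rewrite conjcE /=; apply/eqP; rewrite eq_complex /=.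
by apply/andP; split; apply/eqP; ring.
Qed.

Lemma conjcD z w : (z + w)^* = z^* + w^*. Proof. exact: rmorphD. Qed.
Lemma conjcB z w : (z - w)^* = z^* - w^*. Proof. exact: rmorphB. Qed.
Lemma conjcM z w : (z * w)^* = z^* * w^*. Proof. exact: rmorphM. Qed.
Lemma conjcV z : (z^-1)^* = (z^*)^-1. Proof. exact: fmorphV. Qed.
Lemma conjcN z : (- z)^* = - z^*. Proof. exact: rmorphN. Qed.

Lemma cnbhsP z (A : set C) :
  nbhs z A <-> exists2 d : R, 0 < d & forall w, normc (w - z) < d -> A w.
Proof.
split=> [/nbhs_ballP[e /= e0 h]|[d d0 h]].
  have e0' : e = (complex.Re e)%:C.
    by rewrite RRe_real// realE (ltW e0).
  exists (complex.Re e) => [|w wd].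
    by move: e0; rewrite e0' ltcR.
  apply: h; rewrite -ball_normE /ball_ /= e0' normcE' ltcR.
  by rewrite normcBC.
apply/nbhs_ballP; exists d%:C => /=; first by rewrite ltcR.
move=> w; rewrite -ball_normE /ball_ /= normcE' ltcR => wd.
by apply: h; rewrite normcBC.
Qed.

Lemma ccontP (f : C -> C) z : {for z, continuous f} <->
  forall e, 0 < e -> exists2 d : R, 0 < d &
    forall w, normc (w - z) < d -> normc (f w - f z) < e.
Proof.
split=> [cf e e0|h A /cnbhsP[e e0 eA]].
  have /cf/cnbhsP[d d0 dh] : nbhs (f z) [set w | normc (w - f z) < e].
    by apply/cnbhsP; exists e.
  by exists d.
have [d d0 dh] := h _ e0.
by apply/cnbhsP; exists d => // w /dh /eA.
Qed.

(** Working form of complex differentiability: multiplying the difference quotient by [w - z]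
    removes the punctured neighbourhood, and the weak inequality then covers [w = z]. *)
Lemma cdiffP (f : C -> C) z : differentiable f z <->
  exists l : C, forall e, 0 < e -> exists2 d : R, 0 < d &
    forall w, normc (w - z) < d -> normc (f w - f z - l * (w - z)) <= e * normc (w - z).
Proof.
split=> [/derivable1_diffP/cvg_ex[/= l lP]|[l lP]].
  exists l => e e0.
  have /lP/cnbhsP[d d0 dh] : nbhs l [set w | normc (w - l) < e].
    by apply/cnbhsP; exists e.
  exists d => // w wd.
  have [->|wz] := eqVneq w z; first by rewrite !subrr mulr0 subr0 normc0 mulr0.
  have := dh (w - z); rewrite subr0 => /(_ wd); rewrite subr_eq0 => /(_ wz) /=.
  rewrite [_%:A]mulr1 subrK [_ *: _]mulrC => h.
  have wz0 : w - z != 0 by rewrite subr_eq0.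
  rewrite -[f w - f z](divfK wz0) -mulrBl normcM.
  by rewrite ler_wpM2r ?normc_ge0// ltW.
apply/derivable1_diffP/cvg_ex; exists l => /= A /cnbhsP[e e0 eA].
have e20 : 0 < e / 2 by rewrite divr_gt0.
have [d d0 dh] := lP _ e20.
apply/cnbhsP; exists d => // h; rewrite subr0 => hd h0 /=.
apply: eA; have := dh (h + z); rewrite addrK => /(_ hd) H.
rewrite [_%:A]mulr1 [_ *: _]mulrC.
have n0 : 0 < normc h by rewrite normc_gt0.
rewrite -(ltr_pM2r n0) -normcM mulrBl divfK//.
apply: le_lt_trans H _; rewrite ltr_pM2r// ltr_pdivrMr// mulr2n mulrDr mulr1.
by rewrite ltrDl.
Qed.

Lemma cdiff_cont (f : C -> C) z : differentiable f z -> {for z, continuous f}.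
Proof. exact: differentiable_continuous. Qed.

Lemma near_cdiff (f g : C -> C) z d : 0 < d ->
  (forall w, normc (w - z) < d -> f w = g w) -> differentiable g z -> differentiable f z.
Proof.
move=> d0 fg /cdiffP[l lP]; apply/cdiffP; exists l => e /lP[d' d'0 dh].
exists (Num.min d d'); first by rewrite lt_min d0.
move=> w; rewrite lt_min => /andP[wd wd'].
by rewrite !fg ?dh// subrr normc0.
Qed.

(** The derivative is the conjugate of that of [f]. This turns a function antiholomorphic in one
    variable into a holomorphic one. *)
Lemma cdiff_conj (f : C -> C) z : differentiable f z^* ->
  differentiable (fun t => (f t^*)^*) z.
Proof.
move=> /cdiffP[l lP]; apply/cdiffP; exists l^* => e /lP[d d0 dh].
exists d => // w wd.
have := dh w^*; rewrite -conjcB normc_conj => /(_ wd).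
rewrite -[normc (_ - _ * (_ - _)^*)]normc_conj.
by rewrite !conjcB conjcM !conjcB !conjCK.
Qed.

Lemma conj_real (x : R) : (x%:C : C)^* = x%:C.
Proof. by apply: ceq => //=; rewrite oppr0. Qed.

Lemma conj_i : ('i%C : C)^* = - 'i%C.
Proof. by apply: ceq; rewrite //= oppr0. Qed.

Lemma rcD (x y : R) : (x + y)%:C = x%:C + y%:C :> C. Proof. exact: rmorphD. Qed.
Lemma rcB (x y : R) : (x - y)%:C = x%:C - y%:C :> C. Proof. exact: rmorphB. Qed.
Lemma rcM (x y : R) : (x * y)%:C = x%:C * y%:C :> C. Proof. exact: rmorphM. Qed.
Lemma rcX (x : R) k : (x ^+ k)%:C = x%:C ^+ k :> C. Proof. exact: rmorphXn. Qed.
Lemma rcV (x : R) : (x^-1)%:C = (x%:C)^-1 :> C. Proof. exact: fmorphV. Qed.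
Lemma rcN (x : R) : (- x)%:C = - x%:C :> C. Proof. exact: rmorphN. Qed.
Lemma rc_nat k : (k%:R)%:C = k%:R :> C. Proof. exact: rmorph_nat. Qed.
Lemma conj_nat k : (k%:R : C)^* = k%:R. Proof. exact: rmorph_nat. Qed.

Lemma cdiff_cst (k : C) z : differentiable (fun _ : C => k) z.
Proof. exact: differentiable_cst. Qed.

Lemma cdiff_id z : differentiable (fun w : C => w) z.
Proof.
apply/cdiffP; exists 1 => e e0; exists 1 => // w _.
by rewrite mul1r subrr normc0 mulr_ge0 ?normc_ge0 ?ltW.
Qed.

Lemma cdiffD (f g : C -> C) z : differentiable f z -> differentiable g z ->
  differentiable (fun w => f w + g w) z.
Proof. exact: differentiableD. Qed.

Lemma cdiffB (f g : C -> C) z : differentiable f z -> differentiable g z ->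
  differentiable (fun w => f w - g w) z.
Proof. exact: differentiableB. Qed.

Lemma cdiffM (f g : C -> C) z : differentiable f z -> differentiable g z ->
  differentiable (fun w => f w * g w) z.
Proof. exact: differentiableM. Qed.

Lemma cdiffV (f : C -> C) z : differentiable f z -> f z != 0 ->
  differentiable (fun w => (f w)^-1) z.
Proof. by move=> df f0; apply: differentiableV. Qed.

Lemma cdiff_comp (f g : C -> C) z : differentiable f z -> differentiable g (f z) ->
  differentiable (fun w => g (f w)) z.
Proof. exact: differentiable_comp. Qed.

Lemma cdiff_affine (k l z : C) : differentiable (fun w : C => k + l * w) z.
Proof.
by apply: cdiffD; [exact: cdiff_cst|apply: cdiffM; [exact: cdiff_cst|exact: cdiff_id]].
Qed.

End ComplexBasics.

(** * The complex exponential *)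

Section CVG.
Context {R : realType}.
Local Notation C := R[i].

Lemma continuous_cRe : continuous (@complex.Re R).
Proof.
move=> x; apply/(@cvgrPdist_lt _ R _ (nbhs (x : C))) => e e0.
apply/cnbhsP; exists e => // w wx; rewrite distrC.
by apply: le_lt_trans wx; have := Re_le_normc (w - x); case: w x => [a b] [c d].
Qed.

Lemma cvg_Complex {T} (F : set_system T) {FF : Filter F} (a b : T -> R) (la lb : R) :
  a @ F --> la -> b @ F --> lb -> (fun t => Complex (a t) (b t)) @ F --> (Complex la lb : C).
Proof.
move=> /cvgrPdist_lt ca /cvgrPdist_lt cb A /cnbhsP[e e0 eA].
have e20 : 0 < e / 2 by rewrite divr_gt0.
have := ca _ e20; have := cb _ e20; apply: filterS2 => t h1 h2.
apply: eA; apply: le_lt_trans (normc_le_ReIm _) _ => /=.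
by rewrite [e]splitr ltrD// distrC.
Qed.

Lemma cvg_Re {T} (F : set_system T) {FF : Filter F} (f : T -> C) (l : C) :
  f @ F --> l -> (fun t => complex.Re (f t)) @ F --> complex.Re l.
Proof. by move=> h; apply: cvg_comp h (@continuous_cRe l). Qed.

Lemma cvg_Im {T} (F : set_system T) {FF : Filter F} (f : T -> C) (l : C) :
  f @ F --> l -> (fun t => complex.Im (f t)) @ F --> complex.Im l.
Proof. by move=> h; apply: cvg_comp h (@continuous_cIm R l). Qed.

Lemma cvg_conj {T} (F : set_system T) {FF : Filter F} (f : T -> C) (l : C) :
  f @ F --> l -> (fun t => (f t)^*) @ F --> l^*.
Proof.
move=> h.
have -> : (fun t => (f t)^*) = (fun t => Complex (complex.Re (f t)) (- complex.Im (f t))).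
  by apply/funext => t; case: (f t).
have -> : l^* = Complex (complex.Re l) (- complex.Im l) by case: (l).
by apply: cvg_Complex; [exact: cvg_Re | apply: cvgN; exact: cvg_Im].
Qed.

End CVG.

Section Cexp.
Context {R : realType}.
Local Notation C := R[i].
Implicit Types z w : C.

Lemma cexpD z w : cexp (z + w) = cexp z * cexp w.
Proof.
case: z w => [a b] [c d]; rewrite /cexp /= expRD cosD sinD.
by apply/eqP; rewrite eq_complex /=; apply/andP; split; apply/eqP; ring.
Qed.

Lemma cexp0 : cexp 0 = 1 :> C.
Proof.
by rewrite /cexp /= expR0 cos0 sin0 mul1r.
Qed.

Lemma normc_cexp z : normc (cexp z) = expR (complex.Re z).
Proof.
rewrite /cexp normcM normc_real ger0_norm ?expR_ge0//.
by rewrite /= cos2Dsin2 sqrtr1 mulr1.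
Qed.

Lemma cexp_neq0 z : cexp z != 0.
Proof. by rewrite -normc_gt0 normc_cexp expR_gt0. Qed.

Lemma cexpN z : cexp (- z) = (cexp z)^-1.
Proof.
by apply: (mulfI (cexp_neq0 z)); rewrite -cexpD subrr cexp0 divff// cexp_neq0.
Qed.

Lemma conj_cexp z : (cexp z)^* = cexp z^*.
Proof.
case: z => a b; rewrite conjcE /cexp /= cosN sinN.
by apply/eqP; rewrite eq_complex /=; apply/andP; split; apply/eqP; ring.
Qed.

Lemma cexp_real (x : R) : cexp x%:C = (expR x)%:C.
Proof. by rewrite /cexp /= cos0 sin0 mulr1. Qed.

Lemma cexp_2pi z : cexp (z + Complex 0 (2 * pi)) = cexp z.
Proof.
rewrite cexpD [X in _ * X](_ : _ = 1) ?mulr1// /cexp /= expR0.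
by rewrite mulr_natl cos2pi sin2pi mul1r.
Qed.

Let der_eps (f : R -> R) (l e : R) : is_derive (0 : R) (1 : R) f l -> 0 < e ->
  exists2 d : R, 0 < d & forall h : R, `|h| < d -> `|f h - f 0 - l * h| <= e * `|h|.
Proof.
move=> [df fl] e0.
have /cvgrPdist_lt/(_ _ e0) : h^-1 *: (f (h *: 1 + 0) - f 0) @[h --> 0^'] --> l.
  by rewrite -fl; exact: df.
move=> /nbhs_ballP[d /= d0 dh]; exists d => // h hd.
have [->|h0] := eqVneq h 0; first by rewrite subrr mulr0 subr0 !normr0 mulr0.
have := dh h; rewrite /ball /= sub0r normrN => /(_ hd h0).
rewrite addr0 /GRing.scale /= mulr1 => H.
have -> : f h - f 0 - l * h = (h^-1 * (f h - f 0) - l) * h.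
  by rewrite mulrBl mulrAC mulVf// mul1r.
by rewrite normrM ler_wpM2r// distrC ltW.
Qed.

Let cexp_derive0 (e : R) : 0 < e -> exists2 d : R, 0 < d &
  forall w, normc (w - 0) < d -> normc (cexp w - cexp 0 - 1 * (w - 0)) <= e * normc (w - 0).
Proof.
move=> e0.
(* The final estimate collects 1 + 2 + 1 + 4 + 1 = 9 multiples of [e1 * N], and 10 leaves room. The
   bound [e1 <= 1] absorbs the terms that are quadratic in [e1]. *)
pose e1 := Num.min (e / 10) 1.
have e10 : 0 < e1 by rewrite lt_min divr_gt0//= ltr01.
have e11 : e1 <= 1 by rewrite ge_min lexx orbT.
have e18 : e1 * 10 <= e by rewrite -ler_pdivlMr// ge_min lexx.
clearbody e1.
have [d1 d10 h1] : exists2 d : R, 0 < d & forall h : R, `|h| < d -> `|expR h - 1 - h| <= e1 * `|h|.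
  have [d d0 dh] := @der_eps expR 1 _ (is_derive_eq (is_derive_expR 0) (@expR0 R)) e10.
  by exists d => // h /dh; rewrite expR0 mul1r.
have [d2 d20 h2] : exists2 d : R, 0 < d & forall h : R, `|h| < d -> `|cos h - 1| <= e1 * `|h|.
  have [|d d0 dh] := @der_eps cos 0 _ _ e10.
    by apply: is_derive_eq (is_derive_cos 0) _; rewrite sin0 oppr0.
  by exists d => // h /dh; rewrite cos0 mul0r subr0.
have [d3 d30 h3] : exists2 d : R, 0 < d & forall h : R, `|h| < d -> `|sin h - h| <= e1 * `|h|.
  have [d d0 dh] := @der_eps sin 1 _ (is_derive_eq (is_derive_sin 0) (@cos0 R)) e10.
  by exists d => // h /dh; rewrite sin0 subr0 mul1r.
exists (Num.min e1 (Num.min d1 (Num.min d2 d3))).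
  by rewrite !lt_min e10 d10 d20.
move=> w; rewrite !subr0 cexp0 mul1r !lt_min => /and4P[we w1 w2 w3].
have Rw := Re_le_normc w; have Iw := Im_le_normc w.
set N := normc w in we w1 w2 w3 Rw Iw *.
have N0 : 0 <= N := normc_ge0 w.
move: (h1 _ (le_lt_trans Rw w1)) (h2 _ (le_lt_trans Iw w2)) (h3 _ (le_lt_trans Iw w3)).
rewrite {h1 h2 h3}; move: Rw Iw; rewrite {w1 w2 w3}.
have cb := @cos_max R (complex.Im w); have sb := @sin_max R (complex.Im w).
clearbody N => Ra Ib h1 h2 h3; apply: le_trans (normc_le_ReIm _) _.
case: w cb sb Ra Ib h1 h2 h3 => a b /= cb sb Ra Ib h1 h2 h3.
rewrite !(mul0r, mulr0, subr0, addr0).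
have k1 : `|expR a - 1 - a| <= e1 * N by apply: le_trans h1 _; rewrite ler_wpM2l// ltW.
have k2 : `|cos b - 1| <= e1 * N by apply: le_trans h2 _; rewrite ler_wpM2l// ltW.
have k3 : `|sin b - b| <= e1 * N by apply: le_trans h3 _; rewrite ler_wpM2l// ltW.
have k4 : `|expR a - 1| <= 2 * N.
  rewrite (_ : expR a - 1 = (expR a - 1 - a) + a); last by ring.
  apply: le_trans (ler_normD _ _) _; rewrite mulr_natl mulr2n lerD//.
  by apply: le_trans k1 _; rewrite ler_piMl.
have k5 : N * N <= e1 * N by rewrite ler_wpM2r// ltW.
have p1 : `|(expR a - 1) * cos b| <= 2 * N.
  by rewrite normrM -[leRHS]mulr1 ler_pM.
have -> : expR a * cos b - 1 - a = (expR a - 1 - a) + (expR a - 1) * (cos b - 1) + (cos b - 1) by ring.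
have -> : expR a * sin b - b = (expR a - 1) * sin b + (sin b - b) by ring.
have q1 : `|(expR a - 1) * (cos b - 1)| <= 2 * (e1 * N).
  rewrite normrM; apply: le_trans (_ : (2 * N) * (e1 * N) <= _); first by rewrite ler_pM.
  rewrite -mulrA ler_wpM2l//; rewrite -[leRHS]mul1r ler_wpM2r ?mulr_ge0// ?(ltW e10)//.
  by apply: le_trans e11; exact: ltW.
have sbN : `|sin b| <= 2 * N.
  rewrite (_ : sin b = (sin b - b) + b); last by ring.
  apply: le_trans (ler_normD _ _) _; rewrite mulr_natl mulr2n lerD//.
  by apply: le_trans k3 _; rewrite ler_piMl.
have q2 : `|(expR a - 1) * sin b| <= 4 * (e1 * N).
  rewrite normrM; apply: le_trans (_ : (2 * N) * (2 * N) <= _); first by rewrite ler_pM.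
  by rewrite mulrACA -natrM ler_wpM2l.
apply: (@le_trans _ _ ((e1 * N + 2 * (e1 * N) + e1 * N) + (4 * (e1 * N) + e1 * N))).
  apply: lerD; last by apply: le_trans (ler_normD _ _) _; exact: lerD.
  by apply: le_trans (ler_normD _ _) _; apply: lerD => //; apply: le_trans (ler_normD _ _) _; exact: lerD.
apply: le_trans (_ : e1 * 10 * N <= _); last by rewrite ler_wpM2r.
rewrite [leLHS](_ : _ = e1 * 9 * N); last by ring.
by rewrite ler_wpM2r// ler_pM2l// ler_nat.
Qed.

Lemma cexp_derive z (e : R) : 0 < e -> exists2 d : R, 0 < d &
  forall w, normc (w - z) < d -> normc (cexp w - cexp z - cexp z * (w - z)) <= e * normc (w - z).
Proof.
move=> e0.
have e1 : 0 < e / normc (cexp z) by rewrite divr_gt0// normc_gt0 cexp_neq0.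
have [d d0 dh] := cexp_derive0 e1; exists d => // w wd.
have := dh (w - z); rewrite !subr0 => /(_ wd); rewrite cexp0 mul1r => H.
have -> : cexp w - cexp z - cexp z * (w - z) = cexp z * (cexp (w - z) - 1 - (w - z)).
  by rewrite !mulrBr mulr1 -cexpD subrKC.
by rewrite normcM mulrC -ler_pdivlMr ?normc_gt0 ?cexp_neq0// mulrAC.
Qed.

Lemma cexp_diff z : differentiable (@cexp R) z.
Proof. by apply/cdiffP; exists (cexp z) => e; exact: cexp_derive. Qed.

End Cexp.

(** * Goursat's theorem on rectangles *)

Section Integral.
Context {R : realType}.
Local Notation C := R[i].
Local Notation mu := (@lebesgue_measure R).
Implicit Types (g : R -> C) (a b : R).

Definition cint g a b : C :=
  Complex (\int[mu]_(t in `[a, b]) complex.Re (g t))%R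
          (\int[mu]_(t in `[a, b]) complex.Im (g t))%R.

Definition ccon g a b := forall t, a <= t <= b -> {for t, continuous g}.

Let rcon_int (h : R -> R) a b : (forall t, a <= t <= b -> {for t, continuous h}) ->
  mu.-integrable `[a, b] (EFin \o h).
Proof.
move=> ch; apply: continuous_compact_integrable; first exact: segment_compact.
by apply: continuous_in_subspaceT => t; rewrite inE /= in_itv /= => /ch.
Qed.

Lemma ccon_int g a b : ccon g a b ->
  mu.-integrable `[a, b] (EFin \o (fun t => complex.Re (g t))) /\
  mu.-integrable `[a, b] (EFin \o (fun t => complex.Im (g t))).
Proof.
move=> cg; split; apply: rcon_int => t /cg ct; first exact: cvg_Re.
exact: cvg_Im.
Qed.

Lemma eq_cint g h a b : (forall t, a <= t <= b -> g t = h t) -> cint g a b = cint h a b.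
Proof.
move=> gh; congr Complex; apply: eq_Rintegral => t; rewrite inE /= in_itv /= => /gh ->//.
Qed.

Lemma cconZ g a b (k : C) : ccon g a b -> ccon (fun t => k * g t) a b.
Proof. by move=> cg t tab; apply: cvgMr; exact: cg. Qed.

Lemma cintD g h a b : ccon g a b -> ccon h a b ->
  cint (fun t => g t + h t) a b = cint g a b + cint h a b.
Proof.
move=> /ccon_int[g1 g2] /ccon_int[h1 h2]; congr Complex.
  rewrite -RintegralD//; apply: eq_Rintegral => t _; by case: (g t) (h t) => [? ?] [? ?].
rewrite -RintegralD//; apply: eq_Rintegral => t _; by case: (g t) (h t) => [? ?] [? ?].
Qed.

Lemma cintZ g a b (k : C) : ccon g a b -> cint (fun t => k * g t) a b = k * cint g a b.
Proof.
move=> cg; have [g1 g2] := ccon_int cg; case: k => u v; congr Complex.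
  rewrite -!RintegralZl// -RintegralB//.
  - by apply: eq_Rintegral => t _; case: (g t) => [? ?].
  - by apply: rcon_int => t /cg ct; apply: cvgMr; exact: cvg_Re.
  - by apply: rcon_int => t /cg ct; apply: cvgMr; exact: cvg_Im.
rewrite -!RintegralZl// -RintegralD//.
- by apply: eq_Rintegral => t _; case: (g t) => [? ?].
- by apply: rcon_int => t /cg ct; apply: cvgMr; exact: cvg_Im.
- by apply: rcon_int => t /cg ct; apply: cvgMr; exact: cvg_Re.
Qed.

Lemma cintB g h a b : ccon g a b -> ccon h a b ->
  cint (fun t => g t - h t) a b = cint g a b - cint h a b.
Proof.
move=> cg ch; rewrite (@eq_cint _ (fun t => g t + (-1) * h t)); last by move=> t _; rewrite mulN1r.
by rewrite (cintD cg (cconZ (k := -1) ch)) (cintZ (-1) ch) mulN1r.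
Qed.

Lemma cint_cst (k : C) a b : a <= b -> cint (fun=> k) a b = k * (b - a)%:C.
Proof.
move=> ab; rewrite /cint !Rintegral_cst//= lebesgue_measure_itv/=.
have -> : fine (if (a%:E < b%:E)%E then b%:E - a%:E else 0)%E = b - a.
  by rewrite lte_fin; move: ab; rewrite le_eqVlt => /orP[/eqP->|->]//; rewrite ltxx subrr.
by case: k => u v; apply/eqP; rewrite eq_complex /=; apply/andP; split; apply/eqP; ring.
Qed.

Lemma cint_split g a m b : a <= m <= b -> ccon g a b ->
  cint g a b = cint g a m + cint g m b.
Proof.
move=> /andP[am mb] cg; have [g1 g2] := ccon_int cg.
have E (h : R -> R) : mu.-integrable `[a, b] (EFin \o h) ->
    (\int[mu]_(t in `[a, b]) h t)%R = (\int[mu]_(t in `[a, m]) h t)%R + (\int[mu]_(t in `[m, b]) h t)%R.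
  move=> hi; have := @Rintegral_itvB _ h (BLeft a) (BRight b) m hi.
  rewrite !bnd_simp => /(_ am mb) e.
  rewrite -[X in _ + X]Rintegral_itv_obnd_cbnd; last first.
    by apply: integrableS hi => //; apply: subset_itv; rewrite !bnd_simp.
  by rewrite -e addrC subrK.
by congr Complex; exact: E.
Qed.

(** Multiplying the integrand by the conjugate of the integral makes the result real, so that it can
    be computed from real parts, where monotonicity of the real integral applies. *)
Lemma cint_bound g a b (M : R) : a <= b -> ccon g a b ->
  (forall t, a <= t <= b -> normc (g t) <= M) -> normc (cint g a b) <= M * (b - a).
Proof.
move=> ab cg gM; set w := cint g a b.
have M0 : 0 <= M by apply: (le_trans (normc_ge0 (g a))); apply: gM; rewrite lexx.
have [w0|w0] := eqVneq w 0.
  by rewrite w0 normc0 mulr_ge0// subr_ge0.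
have wn : 0 < normc w by rewrite normc_gt0.
rewrite -(ler_pM2l wn) -expr2.
have -> : normc w ^+ 2 = complex.Re (w^* * w) by rewrite mulrC mul_conjc.
rewrite {2}/w -cintZ//.
have := ccon_int (cconZ (k := w^*) cg) => -[i1 _].
rewrite /cint [complex.Re _]/=.
apply: (@le_trans _ _ (\int[mu]_(t in `[a, b]) (normc w * M))%R).
  apply: le_Rintegral => //.
    by apply: rcon_int => t _; exact: cvg_cst.
  move=> t; rewrite /= in_itv /= => /gM gt.
  apply: le_trans (ler_norm _) _; apply: le_trans (Re_le_normc _) _.
  by rewrite normcM normc_conj ler_pM2l.
have := @cint_cst (normc w * M)%:C a b ab => /(congr1 (@complex.Re R)) /= ->.
by rewrite mulr0 subr0 mulrA.
Qed.

End Integral.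

(** * Contour integrals over rectangles *)

Section Goursat.
Context {R : realType}.
Local Notation C := R[i].
Implicit Types (f : C -> C) (x y p q : R).

(** Contour integral along the boundary, counterclockwise, of the rectangle with lower left corner
    [(x, y)] and upper right corner [(p, q)]. *)
Definition rectI f x y p q : C :=
  'i%C * (cint (fun t => f (Complex p t)) y q - cint (fun t => f (Complex x t)) y q)
  - (cint (fun t => f (Complex t q)) x p - cint (fun t => f (Complex t y)) x p).

Definition rcont f x y p q := forall s t, x <= s <= p -> y <= t <= q ->
  {for (Complex s t), continuous f}.

Lemma rcont_sub f x y p q x' y' p' q' :
  x <= x' -> y <= y' -> p' <= p -> q' <= q -> rcont f x y p q -> rcont f x' y' p' q'.
Proof.
move=> xx yy pp qq h s t /andP[a1 a2] /andP[b1 b2]; apply: h.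
  by rewrite (le_trans xx a1) (le_trans a2 pp).
by rewrite (le_trans yy b1) (le_trans b2 qq).
Qed.

Lemma rcont_v f x y p q s : x <= s <= p -> rcont f x y p q ->
  ccon (fun t => f (Complex s t)) y q.
Proof.
move=> sx h t ty.
apply: (@continuous_comp _ _ _ (fun t => Complex s t : C) f); last exact: h.
by apply: cvg_Complex; [exact: cvg_cst | exact: cvg_id].
Qed.

Lemma rcont_h f x y p q t : y <= t <= q -> rcont f x y p q ->
  ccon (fun s => f (Complex s t)) x p.
Proof.
move=> sx h s ty.
apply: (@continuous_comp _ _ _ (fun s => Complex s t : C) f); last exact: h.
by apply: cvg_Complex; [exact: cvg_id | exact: cvg_cst].
Qed.

Lemma rectI_splitv f x y p q m : x <= m <= p -> y <= q -> rcont f x y p q ->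
  rectI f x y p q = rectI f x y m q + rectI f m y p q.
Proof.
move=> mx yq cf; rewrite /rectI.
rewrite (cint_split mx (rcont_h _ cf)) ?lexx ?yq// (cint_split mx (rcont_h _ cf)) ?lexx ?yq//.
by ring.
Qed.

Lemma rectI_splith f x y p q m : y <= m <= q -> x <= p -> rcont f x y p q ->
  rectI f x y p q = rectI f x y p m + rectI f x m p q.
Proof.
move=> mx yq cf; rewrite /rectI.
rewrite (cint_split mx (rcont_v _ cf)) ?lexx ?yq// (cint_split mx (rcont_v _ cf)) ?lexx ?yq//.
by ring.
Qed.

Lemma continuous_affine (k l z : C) : {for z, continuous (fun w => k + l * w)}.
Proof.
apply: cdiff_cont; apply/cdiffP; exists l => e e0; exists 1 => // w _.
by rewrite [X in normc X](_ : _ = 0) ?normc0 ?mulr_ge0 ?normc_ge0 ?ltW//; ring.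
Qed.

Let affB (k l A B : C) : k + l * A - (k + l * B) = l * (A - B).
Proof. by ring. Qed.

Lemma rectI_affine (k l : C) x y p q : x <= p -> y <= q ->
  rectI (fun w => k + l * w) x y p q = 0.
Proof.
move=> xp yq.
have cc : rcont (fun w : C => k + l * w) x y p q.
  by move=> s t _ _; exact: continuous_affine.
rewrite /rectI -!cintB; last first.
- by apply: rcont_v cc; rewrite lexx.
- by apply: rcont_v cc; rewrite lexx xp.
- by apply: rcont_h cc; rewrite lexx.
- by apply: rcont_h cc; rewrite lexx yq.
rewrite (@eq_cint _ _ (fun=> l * (p - x)%:C)); last first.
  move=> t _; rewrite affB; congr (_ * _).
  by apply: ceq; rewrite /= ?subrr.
rewrite (@eq_cint _ (fun t => k + l * Complex t q - _) (fun=> l * ('i%C * (q - y)%:C))); last first.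
  move=> t _; rewrite affB; congr (_ * _).
  by apply: ceq => /=; ring.
by rewrite !cint_cst//; ring.
Qed.

Lemma rectI_bound f x y p q M : x <= p -> y <= q -> rcont f x y p q ->
  (forall s t, x <= s <= p -> y <= t <= q -> normc (f (Complex s t)) <= M) ->
  normc (rectI f x y p q) <= M * ((p - x) + (q - y)) *+ 2.
Proof.
move=> xp yq cf fM.
have xx : x <= x <= p by rewrite lexx.
have pp : x <= p <= p by rewrite lexx andbT.
have yy : y <= y <= q by rewrite lexx.
have qq : y <= q <= q by rewrite lexx andbT.
apply: le_trans (ler_normcB _ _) _; rewrite normcM normc_i mul1r.
have := @cint_bound R _ y q M yq (rcont_v pp cf) (fun t ht => fM _ _ pp ht).
have := @cint_bound R _ y q M yq (rcont_v xx cf) (fun t ht => fM _ _ xx ht).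
have := @cint_bound R _ x p M xp (rcont_h qq cf) (fun t ht => fM _ _ ht qq).
have := @cint_bound R _ x p M xp (rcont_h yy cf) (fun t ht => fM _ _ ht yy).
have := ler_normcB (cint (fun t => f (Complex p t)) y q) (cint (fun t => f (Complex x t)) y q).
have := ler_normcB (cint (fun t => f (Complex t q)) x p) (cint (fun t => f (Complex t y)) x p).
rewrite mulrDr mulr2n; lra.
Qed.

Lemma rectIB f g x y p q : x <= p -> y <= q -> rcont f x y p q -> rcont g x y p q ->
  rectI (fun w => f w - g w) x y p q = rectI f x y p q - rectI g x y p q.
Proof.
move=> xp yq cf cg.
have xx : x <= x <= p by rewrite lexx.
have pp : x <= p <= p by rewrite lexx andbT.
have yy : y <= y <= q by rewrite lexx.
have qq : y <= q <= q by rewrite lexx andbT.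
rewrite /rectI (cintB (rcont_v pp cf) (rcont_v pp cg)) (cintB (rcont_v xx cf) (rcont_v xx cg)).
by rewrite (cintB (rcont_h qq cf) (rcont_h qq cg)) (cintB (rcont_h yy cf) (rcont_h yy cg)); ring.
Qed.

(** [bad n x y] speaks of the rectangle with lower left corner [(x, y)] and sides [a / 2 ^+ n] and
    [b / 2 ^+ n]. Choosing successors gives nested rectangles; the suprema of the left and of the
    lower ends are the coordinates of a common point. *)
Lemma bisection (bad : nat -> R -> R -> Prop) (x0 y0 a b : R) :
  0 <= a -> 0 <= b -> bad 0%N x0 y0 ->
  (forall n x y, bad n x y -> exists x' y',
    [/\ bad n.+1 x' y', x <= x', y <= y', x' + a / 2 ^+ n.+1 <= x + a / 2 ^+ n &
        y' + b / 2 ^+ n.+1 <= y + b / 2 ^+ n]) ->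
  exists s t, forall n, exists x y,
    [/\ bad n x y, x <= s <= x + a / 2 ^+ n & y <= t <= y + b / 2 ^+ n].
Proof.
move=> a0 b0 bad0 step.
pose T := (nat * (R * R))%type.
have /choice[F FP] : forall u : T, exists v : R * R, bad u.1 u.2.1 u.2.2 ->
    [/\ bad u.1.+1 v.1 v.2, u.2.1 <= v.1, u.2.2 <= v.2,
      v.1 + a / 2 ^+ u.1.+1 <= u.2.1 + a / 2 ^+ u.1 &
      v.2 + b / 2 ^+ u.1.+1 <= u.2.2 + b / 2 ^+ u.1].
  move=> [n [x y]] /=.
  have [/step[x' [y' h]]|nb] := pselect (bad n x y); first by exists (x', y').
  by exists (x, y).
pose z := fix z n := if n is m.+1 then F (m, z m) else (x0, y0).
have zbad n : bad n (z n).1 (z n).2.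
  by elim: n => [|n IH] //=; have [] := FP (n, z n) IH.
have zs n : [/\ (z n).1 <= (z n.+1).1, (z n).2 <= (z n.+1).2,
      (z n.+1).1 + a / 2 ^+ n.+1 <= (z n).1 + a / 2 ^+ n &
      (z n.+1).2 + b / 2 ^+ n.+1 <= (z n).2 + b / 2 ^+ n].
  by have [] := FP (n, z n) (zbad n).
have lim (u : nat -> R) (c : R) : 0 <= c -> (forall n, u n <= u n.+1) ->
    (forall n, u n.+1 + c / 2 ^+ n.+1 <= u n + c / 2 ^+ n) ->
    exists s, forall n, u n <= s <= u n + c / 2 ^+ n.
  move=> c0 u1 u2.
  have um n m : (n <= m)%N -> u n <= u m.
    elim: m => [|m IH]; first by rewrite leqn0 => /eqP->.
    by rewrite leq_eqVlt => /orP[/eqP->//|/IH h]; exact: le_trans (u1 m).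
  have ul n m : (n <= m)%N -> u m + c / 2 ^+ m <= u n + c / 2 ^+ n.
    elim: m => [|m IH]; first by rewrite leqn0 => /eqP->.
    by rewrite leq_eqVlt => /orP[/eqP->//|/IH h]; exact: le_trans (u2 m) h.
  have uu n m : u n <= u m + c / 2 ^+ m.
    have [nm|mn] := leqP n m.
      by apply: le_trans (um _ _ nm) _; rewrite lerDl divr_ge0// exprn_ge0.
    by apply: le_trans (ul _ _ (ltnW mn)); rewrite lerDl divr_ge0// exprn_ge0.
  have hs : has_sup (range u).
    by split; [exists (u 0%N), 0%N | exists (u 0%N + c / 2 ^+ 0) => _ [n _ <-]; exact: uu].
  exists (sup (range u)) => n; apply/andP; split.
    by apply: (ub_le_sup hs.2); exists n.
  by apply: ge_sup; [exact: hs.1 | move=> _ [m _ <-]; exact: uu].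
have [s sP] := lim (fun n => (z n).1) a a0 (fun n => let: And4 h _ _ _ := zs n in h) (fun n => let: And4 _ _ h _ := zs n in h).
have [t tP] := lim (fun n => (z n).2) b b0 (fun n => let: And4 _ h _ _ := zs n in h) (fun n => let: And4 _ _ _ h := zs n in h).
by exists s, t => n; exists (z n).1, (z n).2.
Qed.

(** One of four equal quarters carries at least a quarter of the integral. Near the point common to
    all chosen quarters, differentiability makes the integral small compared with the square of the
    side length, which also decreases by 4 at each stage. *)
Lemma goursat f x y p q : x <= p -> y <= q ->
  (forall s t, x <= s <= p -> y <= t <= q -> differentiable f (Complex s t)) ->
  rectI f x y p q = 0.
Proof.
move=> xp yq df; apply/eqP; apply/negPn/negP => I0.
have cf : rcont f x y p q by move=> s t sx ty; apply: cdiff_cont; exact: df.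
pose a := p - x; pose b := q - y.
have a0 : 0 <= a by rewrite subr_ge0.
have b0 : 0 <= b by rewrite subr_ge0.
pose c := normc (rectI f x y p q).
have c0 : 0 < c by rewrite normc_gt0.
pose bad n u v := [/\ x <= u, y <= v, u + a / 2 ^+ n <= p, v + b / 2 ^+ n <= q &
  c / 4 ^+ n <= normc (rectI f u v (u + a / 2 ^+ n) (v + b / 2 ^+ n))].
have [||s [t st]] := @bisection bad x y a b a0 b0.
- by rewrite /bad !expr0 !divr1 /a /b !subrKC !lexx.
- move=> n u v [xu yv up vq I4].
  set a' := a / 2 ^+ n.+1; set b' := b / 2 ^+ n.+1.
  have a'0 : 0 <= a' by rewrite divr_ge0// exprn_ge0.
  have b'0 : 0 <= b' by rewrite divr_ge0// exprn_ge0.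
  have aE : a / 2 ^+ n = a' + a'.
    by rewrite /a' exprS invfM mulrA mulrAC -splitr.
  have bE : b / 2 ^+ n = b' + b'.
    by rewrite /b' exprS invfM mulrA mulrAC -splitr.
  rewrite aE bE in up vq I4 *.
  have cuv : rcont f u v (u + (a' + a')) (v + (b' + b')) by apply: rcont_sub cf.
  rewrite (@rectI_splitv _ _ _ _ _ (u + a')) in I4 => //; [|lra|lra].
  rewrite (@rectI_splith _ u _ _ _ (v + b')) in I4 => //; [|lra|lra|apply: rcont_sub cuv; lra].
  rewrite (@rectI_splith _ (u + a') _ _ _ (v + b')) in I4 => //; [|lra|lra|apply: rcont_sub cuv; lra].
  have c4 : c / 4 ^+ n = 4 * (c / 4 ^+ n.+1).
    by rewrite exprS invfM; field.
  rewrite c4 in I4.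
  have bad' u' v' p' q' : u <= u' -> v <= v' -> p' = u' + a' -> q' = v' + b' ->
     p' <= u + (a' + a') -> q' <= v + (b' + b') ->
     c / 4 ^+ n.+1 <= normc (rectI f u' v' p' q') -> exists x' y', [/\ bad n.+1 x' y', u <= x', v <= y',
       x' + a' <= u + (a' + a') & y' + b' <= v + (b' + b')].
    move=> uu vv -> -> pp qq h; exists u', v'; split => //.
    by split => //; [exact: le_trans uu | exact: le_trans vv| exact: le_trans up|exact: le_trans vq].
  have [h|h1] := lerP (c / 4 ^+ n.+1) (normc (rectI f u v (u + a') (v + b'))).
    by apply: bad' h => //; lra.
  have [h|h2] := lerP (c / 4 ^+ n.+1) (normc (rectI f u (v + b') (u + a') (v + (b' + b')))).
    by apply: bad' h => //; lra.
  have [h|h3] := lerP (c / 4 ^+ n.+1) (normc (rectI f (u + a') v (u + (a' + a')) (v + b'))).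
    by apply: bad' h => //; lra.
  have [h|h4] := lerP (c / 4 ^+ n.+1) (normc (rectI f (u + a') (v + b') (u + (a' + a')) (v + (b' + b')))).
    by apply: bad' h => //; lra.
  exfalso; move: I4; apply/negP; rewrite -ltNge.
  apply: le_lt_trans (le_normcD _ _) _.
  have := le_normcD (rectI f u v (u + a') (v + b')) (rectI f u (v + b') (u + a') (v + (b' + b'))).
  have := le_normcD (rectI f (u + a') v (u + (a' + a')) (v + b')) (rectI f (u + a') (v + b') (u + (a' + a')) (v + (b' + b'))).
  lra.
have [sx ty] : x <= s <= p /\ y <= t <= q.
  have [u [v [[xu yv up vq _] su tv]]] := st 0%N.
  by split; [move: su|move: tv] => /andP[h1 h2]; apply/andP; split; lra.
have /cdiffP[l lP] := df _ _ sx ty.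
(* At stage [n] the integral will be at most [2 * e * (a + b) ^+ 2 / 4 ^+ n], which must be less
   than [c / 4 ^+ n]. The summand 1 keeps the denominator positive for a degenerate rectangle. *)
pose e := c / (4 * (a + b + 1) ^+ 2).
have ab0 : 0 < a + b + 1 by rewrite ltr_wpDl// addr_ge0.
have e0 : 0 < e by rewrite divr_gt0// mulr_gt0// exprn_gt0.
have [d d0 dh] := lP _ e0.
have [n nd] : exists n, (a + b) / 2 ^+ n < d.
  have := @cvg_geometric R (a + b) 2^-1; rewrite ger0_norm// invf_lt1// ltr1n => /(_ isT).
  move=> /cvgrPdist_lt/(_ _ d0)[N _ /(_ N (leqnn _))]; rewrite sub0r normrN => h; exists N.
  by apply: le_lt_trans (ler_norm _) _; rewrite -exprVn.
have [u [v [[xu yv up vq I4] su tv]]] := st n.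
move: I4; apply/negP; rewrite -ltNge.
set a' := a / 2 ^+ n in nd up vq su tv *; set b' := b / 2 ^+ n in nd up vq su tv *.
have a'0 : 0 <= a' by rewrite divr_ge0// exprn_ge0.
have b'0 : 0 <= b' by rewrite divr_ge0// exprn_ge0.
have ab' : a' + b' < d by rewrite /a' /b' -mulrDl.
pose z := Complex s t.
(* Subtracting the first order Taylor polynomial does not change the integral, and leaves the
   remainder controlled by differentiability at [z]. *)
pose g w := f w - ((f z - l * z) + l * w).
have caff : rcont (fun w : C => (f z - l * z) + l * w) u v (u + a') (v + b').
  by move=> ? ? _ _; exact: continuous_affine.
have cuv : rcont f u v (u + a') (v + b') by apply: rcont_sub cf.
have cg : rcont g u v (u + a') (v + b').
  move=> s' t' h1 h2; apply: (@continuousB _ _ _ f (fun w => f z - l * z + l * w)).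
    exact: cuv.
  exact: caff.
have ua : u <= u + a' by rewrite lerDl.
have vb : v <= v + b' by rewrite lerDl.
have -> : rectI f u v (u + a') (v + b') = rectI g u v (u + a') (v + b').
  by rewrite /g rectIB// rectI_affine// subr0.
have gM s' t' : u <= s' <= u + a' -> v <= t' <= v + b' -> normc (g (Complex s' t')) <= e * (a' + b').
  move=> s'u t'v.
  have zd : normc (Complex s' t' - z) <= a' + b'.
    apply: le_trans (normc_le_ReIm _) _ => /=; apply: lerD; rewrite ler_norml; lra.
  have -> : g (Complex s' t') = f (Complex s' t') - f z - l * (Complex s' t' - z) by rewrite /g; ring.
  by apply: le_trans (dh _ (le_lt_trans zd ab')) _; rewrite ler_wpM2l// ltW.
apply: le_lt_trans (rectI_bound ua vb cg gM) _.
rewrite ![_ + _ - _]addrAC !subrr !add0r.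
have -> : 4 ^+ n = 2 ^+ n * 2 ^+ n :> R by rewrite -exprMn -natrM.
have P0 : 0 < (2 ^+ n : R) by rewrite exprn_gt0.
rewrite /a' /b' -mulrDl /e; move: (2 ^+ n : R) P0 => P P0.
set X := a + b in ab0 *.
have X0 : 0 <= X by rewrite addr_ge0.
have -> : c / (4 * (X + 1) ^+ 2) * (X / P) * (X / P) *+ 2 =
    c / (P * P) * (X ^+ 2 / (2 * (X + 1) ^+ 2)).
  by rewrite mulr2n; field; rewrite !gt_eqF.
rewrite gtr_pMr ?divr_gt0 ?mulr_gt0// ltr_pdivrMr ?mulr_gt0 ?exprn_gt0//.
nra.
Qed.

End Goursat.

(** * The mean value property *)

Section MeanValue.
Context {R : realType}.
Local Notation C := R[i].
Implicit Types (f : C -> C) (x y p q : R).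

(** Compactness of the vertical segment makes the modulus of continuity in the horizontal direction
    uniform in [t]. *)
Lemma strip_small f x y q (e : R) : 0 < e ->
  (forall t, y <= t <= q -> {for (Complex x t), continuous f}) ->
  exists2 d : R, 0 < d & forall s t, `|s - x| < d -> y <= t <= q ->
    normc (f (Complex s t) - f (Complex x t)) < e.
Proof.
move=> e0 cf.
have := @segment_compact R y q => /compact_near_coveringP.
move=> /(_ R (nbhs x) (fun s t => normc (f (Complex s t) - f (Complex x t)) < e)) H.
have : \forall s \near x, `[y, q] `<=` (fun t => normc (f (Complex s t) - f (Complex x t)) < e).
  apply: H => t; rewrite /= in_itv /= => /cf/ccontP ct.
  have e20 : 0 < e / 2 by rewrite divr_gt0.
  have [d d0 dh] := ct _ e20.
  have d20 : 0 < d / 2 by rewrite divr_gt0.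
  exists (ball t (d / 2), ball x (d / 2)); first by split; exact: nbhsx_ballx.
  move=> [t' s] [/= bt bs]; rewrite /ball /= in bt bs.
  have h1 : normc (f (Complex s t') - f (Complex x t)) < e / 2.
    apply: dh; apply: le_lt_trans (normc_le_ReIm _) _ => /=.
    by rewrite [d]splitr ltrD// distrC.
  have h2 : normc (f (Complex x t') - f (Complex x t)) < e / 2.
    apply: dh; apply: le_lt_trans (normc_le_ReIm _) _ => /=.
    by rewrite subrr normr0 add0r; apply: lt_trans (_ : _ < d / 2) _; rewrite 1?distrC// ltr_pdivrMr// mulr_natr mulr2n ltrDl.
  have -> : f (Complex s t') - f (Complex x t') = (f (Complex s t') - f (Complex x t)) - (f (Complex x t') - f (Complex x t)) by ring.
  by rewrite [e]splitr; apply: le_lt_trans (ler_normcB _ _) _; exact: ltrD.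
move=> /nbhs_ballP[d /= d0 dh]; exists d => // s t sd tyq.
by apply: dh => //; rewrite /ball/= distrC.
Qed.

(** The two vertical sides nearly cancel by uniform continuity, and the two horizontal ones are
    short. Thin strips can thus be discarded where only continuity is known. *)
Lemma rectI_thin f x y q (e : R) : y <= q -> 0 < e ->
  (forall t, y <= t <= q -> {for (Complex x t), continuous f}) ->
  exists2 d : R, 0 < d & forall a b, a <= x <= b -> b - a < d -> rcont f a y b q ->
    normc (rectI f a y b q) <= e.
Proof.
move=> yq e0 cf.
pose e1 := e / (4 * (q - y + 1)).
have k0 : 0 < q - y + 1 by rewrite ltr_wpDl// subr_ge0.
have e10 : 0 < e1 by rewrite divr_gt0// mulr_gt0.
have [d1 d10 h1] := strip_small e10 cf.
have [d2 d20 h2] := strip_small ltr01 cf.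
(* Bounds [f] on both horizontal sides: by the choice of [d2], [f] differs there by less than 1 from
   its value at abscissa [x]. *)
pose M := normc (f (Complex x y)) + normc (f (Complex x q)) + 1.
have M0 : 0 < M by rewrite ltr_wpDl// addr_ge0// normc_ge0.
exists (Num.min d1 (Num.min d2 (e / (4 * M)))); first by rewrite !lt_min d10 d20 divr_gt0// mulr_gt0.
move=> a b /andP[ax xb]; rewrite !lt_min => /and3P[b1 b2 b3] cab.
have ab : a <= b := le_trans ax xb.
have aab : a <= a <= b by rewrite lexx.
have bab : a <= b <= b by rewrite lexx andbT.
have yyq : y <= y <= q by rewrite lexx.
have qyq : y <= q <= q by rewrite lexx andbT.
have sx s : a <= s <= b -> `|s - x| <= b - a by move=> /andP[h h']; rewrite ler_norml; lra.
have v1 : normc (cint (fun t => f (Complex b t)) y q - cint (fun t => f (Complex a t)) y q) <= e1 * 2 * (q - y).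
  rewrite -cintB; [|exact: rcont_v cab|exact: rcont_v cab].
  apply: (cint_bound (g := fun t => f (Complex b t) - f (Complex a t)) yq).
    move=> t tyq; apply: (@continuousB _ _ _ (fun t => f (Complex b t)) (fun t => f (Complex a t))).
      exact: (rcont_v bab cab).
    exact: (rcont_v aab cab).
  move=> t tyq.
  have -> : f (Complex b t) - f (Complex a t) = (f (Complex b t) - f (Complex x t)) - (f (Complex a t) - f (Complex x t)) by ring.
  apply: le_trans (ler_normcB _ _) _; rewrite mulr_natr mulr2n.
  by apply: lerD; apply: ltW; apply: h1 => //; apply: le_lt_trans (sx _ _) b1.
have fM t : t = y \/ t = q -> forall s, a <= s <= b -> normc (f (Complex s t)) <= M.
  move=> tt s sab.
  have tyq : y <= t <= q by case: tt => ->.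
  have := h2 s t (le_lt_trans (sx _ sab) b2) tyq.
  have := lerB_normc (f (Complex s t)) (f (Complex x t)).
  have : normc (f (Complex x t)) <= normc (f (Complex x y)) + normc (f (Complex x q)).
    by case: tt => ->; rewrite ?lerDl ?lerDr normc_ge0.
  rewrite /M; lra.
have u1 := cint_bound ab (rcont_h yyq cab) (fM _ (or_introl erefl)).
have u2 := cint_bound ab (rcont_h qyq cab) (fM _ (or_intror erefl)).
apply: le_trans (ler_normcB _ _) _; rewrite normcM normc_i mul1r.
apply: (@le_trans _ _ (e / 2 + e / 2)); last by rewrite -splitr.
apply: lerD.
  apply: le_trans v1 _.
  have -> : e1 * 2 * (q - y) = e / 2 * ((q - y) / (q - y + 1)).
    by rewrite /e1; field; rewrite gt_eqF.
  by rewrite ler_piMr// ?(ltW e0) ?divr_ge0 ?(ltW e0)// ler_pdivrMr// mul1r lerDl.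
apply: le_trans (ler_normcB _ _) _.
apply: (@le_trans _ _ (M * (b - a) + M * (b - a))); first exact: lerD.
have b3' : (b - a) * (4 * M) < e by rewrite -ltr_pdivlMr// mulr_gt0.
lra.
Qed.

Lemma cint_nn (g : R -> C) x : ccon g x x -> cint g x x = 0.
Proof.
move=> cg; have xx : x <= x <= x by rewrite lexx.
by have /eqP := cint_split xx cg; rewrite eq_sym -subr_eq0 addrK => /eqP.
Qed.

Lemma rectI_nn f x y q : y <= q -> rcont f x y x q -> rectI f x y x q = 0.
Proof.
move=> yq cf; rewrite /rectI subrr mulr0 !cint_nn ?subrr//.
  by apply: rcont_h cf; rewrite lexx.
by apply: rcont_h cf; rewrite lexx yq.
Qed.

(** Cut off a strip at each vertical side; the middle rectangle contributes 0 and both strips tend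
    to 0 with their width. *)
Lemma goursat_open f x y p q : x <= p -> y <= q -> rcont f x y p q ->
  (forall s t, x < s < p -> y <= t <= q -> differentiable f (Complex s t)) ->
  rectI f x y p q = 0.
Proof.
move=> xp yq cf df.
have [xp'|px] := ltP x p; last first.
  have E : x = p by apply/eqP; rewrite eq_le xp px.
  by rewrite -E in cf *; exact: rectI_nn.
apply/eqP; rewrite -normc_eq0 eq_le normc_ge0 andbT; apply/ler_addgt0Pr => e e0; rewrite add0r.
have e20 : 0 < e / 2 by rewrite divr_gt0.
have c1 t : y <= t <= q -> {for (Complex x t), continuous f} by move=> h; apply: cf; rewrite ?lexx.
have c2 t : y <= t <= q -> {for (Complex p t), continuous f} by move=> h; apply: cf; rewrite ?lexx ?andbT.
have [d1 d10 h1] := rectI_thin yq e20 c1.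
have [d2 d20 h2] := rectI_thin yq e20 c2.
pose h := Num.min (Num.min (d1 / 2) (d2 / 2)) ((p - x) / 2).
have h0 : 0 < h by rewrite !lt_min !divr_gt0// subr_gt0.
have hd1 : h < d1.
  by rewrite /h !gt_min ltr_pdivrMr// mulr_natr mulr2n ltrDl d10.
have hd2 : h < d2.
  by rewrite /h !gt_min [d2 / _ < d2]ltr_pdivrMr// mulr_natr mulr2n ltrDl d20 !orbT.
have hp : h <= (p - x) / 2 by rewrite /h ge_min lexx orbT.
clearbody h.
rewrite (@rectI_splitv _ _ _ _ _ _ (x + h))//; last by apply/andP; split; lra.
have cf' : rcont f (x + h) y p q by apply: rcont_sub cf => //; lra.
rewrite (@rectI_splitv _ _ (x + h) _ _ _ (p - h))//; last by apply/andP; split; lra.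
rewrite (@goursat _ f (x + h) y (p - h) q)//; last 2 first.
- by lra.
- by move=> s t /andP[? ?] ?; apply: df => //; apply/andP; split; lra.
rewrite add0r; apply: le_trans (le_normcD _ _) _; rewrite [e]splitr; apply: lerD.
  apply: h1; [apply/andP; split; lra | lra | by apply: rcont_sub cf => //; lra].
apply: h2; [apply/andP; split; lra | lra | by apply: rcont_sub cf => //; lra].
Qed.

(** Cutting at each abscissa of [E] moves the exceptional lines to the sides, where continuity
    suffices. Lines rather than points are excluded because in logarithmic coordinates a modulus
    becomes an abscissa. *)
Lemma goursat_lines f (E : seq R) x y p q : x <= p -> y <= q -> rcont f x y p q ->
  (forall s t, x < s < p -> y <= t <= q -> s \notin E -> differentiable f (Complex s t)) ->
  rectI f x y p q = 0.
Proof.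
elim: E x p => [|e E IH] x p xp yq cf df.
  by apply: goursat_open => // s t h1 h2; apply: df.
have [/andP[xe ep]|h] := boolP (x < e < p); last first.
  apply: IH => // s t h1 h2 sE; apply: df => //; rewrite in_cons negb_or sE andbT.
  by apply: contra h => /eqP <-.
rewrite (@rectI_splitv _ _ _ _ _ _ e) ?(ltW xe) ?(ltW ep)//.
rewrite !IH ?addr0 ?(ltW xe) ?(ltW ep)//.
- by apply: rcont_sub cf => //; exact: ltW.
- move=> s t /andP[h1 h2] h3 sE; apply: df => //; first by rewrite (lt_trans xe h1).
  by rewrite in_cons negb_or sE andbT gt_eqF.
- by apply: rcont_sub cf => //; exact: ltW.
- move=> s t /andP[h1 h2] h3 sE; apply: df => //; first by rewrite h1 (lt_trans h2 ep).
  by rewrite in_cons negb_or sE andbT lt_eqF.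
Qed.

Lemma polar_cexp (s t : R) : cexp (Complex s t) = (expR s)%:C * cexp (Complex 0 t).
Proof. by rewrite -cexp_real -cexpD; congr cexp; apply: ceq => /=; rewrite ?addr0 ?add0r. Qed.

Lemma normc_polar (u t : R) : 0 <= u -> normc (u%:C * cexp (Complex 0 t)) = u.
Proof.
by move=> u0; rewrite normcM normc_cexp normc_real [complex.Re _]/= expR0 mulr1 ger0_norm.
Qed.

(** For [f] composed with the exponential, on a rectangle of height [2 * pi], the horizontal sides
    cancel by periodicity and the vertical sides are the means over two circles. So the mean does
    not depend on the radius, and continuity at 0 identifies its limit; 0 itself may belong to
    [E]. *)
Lemma mean_value f (E : seq C) (rho r : R) : 0 < r < rho ->
  (forall z, normc z < rho -> {for z, continuous f}) ->
  (forall z, normc z < rho -> z \notin E -> differentiable f z) ->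
  cint (fun t => f (r%:C * cexp (Complex 0 t))) 0 (2 * pi) = f 0 * (2 * pi)%:C.
Proof.
move=> /andP[r0 rrho] cf df.
have pi0 : 0 <= 2 * pi :> R by rewrite mulr_ge0// pi_ge0.
pose V r := cint (fun t => f (r%:C * cexp (Complex 0 t))) 0 (2 * pi).
have Vc r1 : 0 < r1 <= r -> V r = V r1.
  move=> /andP[r10 r1r].
  pose g u := f (cexp u).
  have lr : ln r1 <= ln r by rewrite ler_ln.
  have nc s t : s <= ln r -> normc (cexp (Complex s t)) < rho.
    by move=> sr; rewrite normc_cexp /=; apply: le_lt_trans rrho; rewrite -[leRHS](lnK r0) ler_expR.
  have cg : rcont g (ln r1) 0 (ln r) (2 * pi).
    move=> s t /andP[_ sr] _; apply: (@continuous_comp _ _ _ (@cexp R) f).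
      by apply: cdiff_cont; exact: cexp_diff.
    by apply: cf; exact: nc.
  have : rectI g (ln r1) 0 (ln r) (2 * pi) = 0.
    (* If 0 belongs to [E], the default value of [ln 0] only adds one more excluded line. *)
    apply: (@goursat_lines _ [seq ln (normc e) | e <- E]) => // s t /andP[_ sr] _ sE.
    apply: cdiff_comp; first exact: cexp_diff.
    apply: df; first by apply: nc; exact: ltW.
    apply: contra sE => h; apply/mapP; exists (cexp (Complex s t)) => //.
    by rewrite normc_cexp expRK.
  rewrite /rectI [X in _ - X](_ : _ = 0) ?subr0; last first.
    apply/eqP; rewrite subr_eq0; apply/eqP; apply: eq_cint => s _; rewrite /g; congr f.
    by rewrite -[in RHS]cexp_2pi; congr cexp; apply: ceq => /=; rewrite ?addr0 ?add0r.
  move=> /eqP; rewrite mulf_eq0 -normc_eq0 normc_i oner_eq0 /= subr_eq0 => /eqP.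
  have Vg u : 0 < u -> V u = cint (fun t => g (Complex (ln u) t)) 0 (2 * pi).
    by move=> u0; apply: eq_cint => t _; rewrite /g polar_cexp lnK.
  by rewrite -!Vg.
have nrc := normc_polar.
apply/eqP; rewrite -subr_eq0 -normc_eq0 eq_le normc_ge0 andbT.
apply/ler_addgt0Pr => e e0; rewrite add0r.
have e1 : 0 < e / (2 * pi + 1) by rewrite divr_gt0// ltr_wpDl.
have := cf 0; rewrite normc0 => /(_ (lt_trans r0 rrho))/ccontP/(_ _ e1)[d d0 dh].
pose r1 := Num.min r (d / 2).
have r10 : 0 < r1 by rewrite lt_min r0 divr_gt0.
have r1r : r1 <= r by rewrite ge_min lexx.
have r1d : r1 < d by rewrite gt_min [_ / _ < _]ltr_pdivrMr// mulr_natr mulr2n ltrDl d0 orbT.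
rewrite -/(V r) (Vc r1) ?r10// /V -[2 * pi in X in _ - X]subr0 -cint_cst// -cintB; last 2 first.
- move=> t _; apply: (@continuous_comp _ _ _ (fun t => r1%:C * cexp (Complex 0 t)) f).
    apply: cvgMr; apply: (@continuous_comp _ _ _ (fun t => Complex 0 t : C) (@cexp R)).
      by apply: cvg_Complex; [exact: cvg_cst | exact: cvg_id].
    by apply: cdiff_cont; exact: cexp_diff.
  by apply: cf; rewrite nrc ?(ltW r10)//; apply: le_lt_trans rrho.
- by move=> t _; exact: cvg_cst.
apply: le_trans (_ : e / (2 * pi + 1) * (2 * pi - 0) <= _); last first.
  by rewrite subr0 mulrAC ler_pdivrMr ?ltr_wpDl// ler_pM2l// lerDl.
apply: cint_bound => //.
  move=> t _; apply: cvgB; last exact: cvg_cst.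
  apply: (@continuous_comp _ _ _ (fun t => r1%:C * cexp (Complex 0 t)) f).
    apply: cvgMr; apply: (@continuous_comp _ _ _ (fun t => Complex 0 t : C) (@cexp R)).
      by apply: cvg_Complex; [exact: cvg_cst | exact: cvg_id].
    by apply: cdiff_cont; exact: cexp_diff.
  by apply: cf; rewrite nrc ?(ltW r10)//; apply: le_lt_trans rrho.
by move=> t _; apply: ltW; apply: dh; rewrite subr0 nrc// ltW.
Qed.

Lemma mean_bound f (E : seq C) (rho r M : R) : 0 < r < rho ->
  (forall z, normc z < rho -> {for z, continuous f}) ->
  (forall z, normc z < rho -> z \notin E -> differentiable f z) ->
  (forall z, normc z = r -> normc (f z) <= M) -> normc (f 0) <= M.
Proof.
move=> /[dup] rr /andP[r0 rrho] cf df fM.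
have pi0 : 0 < 2 * pi :> R by rewrite mulr_gt0// pi_gt0.
have nrc (t : R) : normc (r%:C * cexp (Complex 0 t)) = r.
  by rewrite normc_polar// ltW.
have := mean_value rr cf df => h.
have : normc (f 0 * (2 * pi)%:C) <= M * (2 * pi - 0).
  rewrite -h; apply: cint_bound; first exact: ltW.
    move=> t _; apply: (@continuous_comp _ _ _ (fun t => r%:C * cexp (Complex 0 t)) f).
      apply: cvgMr; apply: (@continuous_comp _ _ _ (fun t => Complex 0 t : C) (@cexp R)).
        by apply: cvg_Complex; [exact: cvg_cst | exact: cvg_id].
      by apply: cdiff_cont; exact: cexp_diff.
    by apply: cf; rewrite nrc.
  by move=> t _; apply: fM.
by rewrite subr0 normcM normc_real gtr0_norm// ler_pM2r.
Qed.

End MeanValue.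

(** * The Schwarz lemma *)

Section MaximumPrinciple.
Context {R : realType}.
Local Notation C := R[i].
Implicit Types (f : C -> C) (E : seq C).

(** This class is stable under division by a zero: the quotient extends continuously, and the zero
    joins the exceptional set, so that no removable singularity theorem is called for. *)
Definition diff_off f E := (forall z, normc z < 1 -> {for z, continuous f}) /\
  (forall z, normc z < 1 -> z \notin E -> differentiable f z).

(** A limsup at the unit circle instead of a bound on the disc: after division by [z - a] the right
    constant is only reached in the limit at the boundary. *)
Definition bdry_le f (M : R) := forall e : R, 0 < e -> exists rho : R,
  [/\ 0 <= rho, rho < 1 & forall z, rho < normc z < 1 -> normc (f z) <= M + e].

Lemma bdry_le_bound f M : (forall z, normc z < 1 -> normc (f z) <= M) -> bdry_le f M.
Proof.
move=> h e e0; exists 0; split => // z /andP[_ z1].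
by apply: le_trans (h _ z1) _; rewrite lerDl ltW.
Qed.

Lemma diff_off_nil f : (forall z, normc z < 1 -> differentiable f z) -> diff_off f [::].
Proof. by move=> h; split => z z1 *; [apply: cdiff_cont|]; exact: h. Qed.

(** * The maximum principle through disc automorphisms *)

Section Moebius.
Variable a : C.
Hypothesis a1 : normc a < 1.

Let m z := (z + a) / (1 + a^* * z).

Let den_neq0 z : normc z < 1 -> 1 + a^* * z != 0.
Proof.
move=> z1; apply/eqP => h.
have : normc (a^* * z) < 1.
  by rewrite normcM normc_conj mulr_ilt1// normc_ge0.
by rewrite (_ : a^* * z = -1) ?normcN ?normc1 ?ltxx//; apply/eqP; rewrite -addr_eq0 addrC h.
Qed.

Let moebius_id z : normc (1 + a^* * z) ^+ 2 - normc (z + a) ^+ 2 =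
  (1 - normc a ^+ 2) * (1 - normc z ^+ 2).
Proof. by rewrite !sqr_normcE; case: a z => [u v] [s t]; rewrite conjcE /=; ring. Qed.

Let normc_m z : normc z < 1 -> 1 - normc (m z) ^+ 2 =
  (1 - normc a ^+ 2) * (1 - normc z ^+ 2) / normc (1 + a^* * z) ^+ 2.
Proof.
move=> z1; have d0 := den_neq0 z1; rewrite -moebius_id /m normcM normcV.
have n0 : normc (1 + a^* * z) != 0 by rewrite normc_eq0.
by rewrite mulrBl divff ?expf_neq0// expr_div_n.
Qed.

Let sq1 (x : R) : 0 <= x -> x < 1 -> 0 < 1 - x ^+ 2.
Proof. by move=> x0 x1; rewrite subr_gt0 expr_lt1. Qed.

Let m_lt1 z : normc z < 1 -> normc (m z) < 1.
Proof.
move=> z1; have : 0 < 1 - normc (m z) ^+ 2.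
  rewrite normc_m//; apply: divr_gt0.
    by apply: mulr_gt0; apply: sq1 => //; exact: normc_ge0.
  by apply: exprn_gt0; rewrite normc_gt0 den_neq0.
by rewrite subr_gt0 expr_lt1// normc_ge0.
Qed.

(** The automorphism [m] sends 0 to [a] and circles close to the unit circle into the zone where [f]
    is already bounded; the mean value property at 0 of [f \o m] gives the value at [a]. The
    exceptional set is pulled back by the inverse automorphism. *)
Lemma disc_max_principle f E M : diff_off f E -> bdry_le f M -> normc (f a) <= M.
Proof.
move=> [cf df] fM; apply/ler_addgt0Pr => e /fM[rho [rho0 rho1 hrho]].
have k0 : 0 < 1 - normc a by rewrite subr_gt0.
(* On the circle of radius [1 - eta], [1 - normc (m z) ^+ 2] is at most
   [2 * eta / (1 - normc a) ^+ 2], and this has to stay below [1 - rho ^+ 2]. *)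
pose eta := Num.min (1 / 2) ((1 - rho ^+ 2) * (1 - normc a) ^+ 2 / 4).
have eta0 : 0 < eta.
  by rewrite lt_min !divr_gt0 ?mulr_gt0 ?sq1 ?exprn_gt0.
have eta1 : eta <= 1 / 2 by rewrite ge_min lexx.
have eta2 : eta <= (1 - rho ^+ 2) * (1 - normc a) ^+ 2 / 4 by rewrite ge_min lexx orbT.
clearbody eta.
pose r := 1 - eta.
have r01 : 0 < r < 1 by rewrite /r; apply/andP; split; lra.
have m0 : m 0 = a by rewrite /m mulr0 addr0 divr1 add0r.
pose E' := [seq (e - a) / (1 - a^* * e) | e <- E].
have mdiff z : normc z < 1 -> differentiable m z.
  move=> z1; apply: cdiffM; last apply: cdiffV.
  - by apply: cdiffD; [exact: cdiff_id | exact: cdiff_cst].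
  - exact: cdiff_affine.
  - exact: den_neq0.
have := @mean_bound R (f \o m) E' 1 r (M + e) r01; rewrite /= m0; apply.
- move=> z z1; apply: (@continuous_comp _ _ _ m f); first by apply: cdiff_cont; exact: mdiff.
  by apply: cf; exact: m_lt1.
- move=> z z1 zE; apply: cdiff_comp; first exact: mdiff.
  apply: df; first exact: m_lt1.
  apply: contra zE => mE; apply/mapP; exists (m z) => //.
  have h1 := den_neq0 z1.
  have aa0 : 1 - a^* * a != 0.
    rewrite mulrC mul_conjc; apply/eqP => /(congr1 (@complex.Re R))/= /eqP.
    by rewrite gt_eqF// sq1// normc_ge0.
  have h2 : 1 - a^* * m z = (1 - a^* * a) / (1 + a^* * z) by rewrite /m; field.
  rewrite h2; have -> : m z - a = z * (1 - a^* * a) / (1 + a^* * z) by rewrite /m; field.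
  by field; rewrite h1 aa0.
move=> z zr; have /andP[r0 r1] := r01.
have z1 : normc z < 1 by rewrite zr.
apply: hrho; rewrite m_lt1// andbT.
have dl : 1 - normc a <= normc (1 + a^* * z).
  have := lerB_normc 1 (- (a^* * z)); rewrite opprK normcN normc1.
  apply: le_trans; rewrite lerD2l lerN2 normcM normc_conj ler_piMr ?normc_ge0// ltW//.
have d0 : 0 < normc (1 + a^* * z) by apply: lt_le_trans dl.
rewrite -(@ltr_pXn2r _ 2)// ?nnegrE ?normc_ge0//.
have := normc_m z1; rewrite zr.
have : (1 - normc a ^+ 2) * (1 - r ^+ 2) / normc (1 + a^* * z) ^+ 2 < 1 - rho ^+ 2; last by lra.
rewrite ltr_pdivrMr ?exprn_gt0//.
have h3 : (1 - normc a) ^+ 2 <= normc (1 + a^* * z) ^+ 2.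
  by rewrite ler_pXn2r// nnegrE ?normc_ge0// ltW.
have rho2 := sq1 rho0 rho1.
have s1 : 1 - r ^+ 2 <= 2 * eta by rewrite /r; have := sqr_ge0 eta; rewrite !expr2; lra.
have na := normc_ge0 a.
have s2 : 1 - normc a ^+ 2 <= 1 by have := sqr_ge0 (normc a); lra.
have s3 : 0 <= 1 - r ^+ 2 by apply: ltW; apply: sq1 => //; exact: ltW.
apply: (@le_lt_trans _ _ (2 * eta)); first by apply: le_trans s1; rewrite ler_piMl.
apply: (@lt_le_trans _ _ ((1 - rho ^+ 2) * (1 - normc a) ^+ 2)); last by rewrite ler_pM2l.
have : 0 < (1 - rho ^+ 2) * (1 - normc a) ^+ 2 by rewrite mulr_gt0// exprn_gt0.
lra.
Qed.

End Moebius.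

Lemma bdry_le_ge0 f M : bdry_le f M -> 0 <= M.
Proof.
move=> h; apply/ler_addgt0Pr => e /h[rho [rho0 rho1 /(_ ((rho + 1) / 2)%:C)]].
rewrite normc_real ger0_norm; last by lra.
have -> : rho < (rho + 1) / 2 < 1 by apply/andP; split; lra.
by move=> /(_ isT); apply: le_trans; exact: normc_ge0.
Qed.

(* The quotient is [f z / (z - a)], with its removable singularity filled in. *)
Lemma divide_zero f E M a : diff_off f E -> bdry_le f M -> normc a < 1 -> a \notin E -> f a = 0 ->
  exists q, [/\ diff_off q (a :: E), bdry_le q (M / (1 - normc a)) & forall z, f z = q z * (z - a)].
Proof.
move=> [cf df] fM a1 aE fa.
have k0 : 0 < 1 - normc a by rewrite subr_gt0.
have /cdiffP[l lP] := df a a1 aE.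
pose q z := if z == a then l else f z / (z - a).
have qE z : z != a -> q z = f z / (z - a) by move=> /negbTE za; rewrite /q za.
have fq z : f z = q z * (z - a).
  have [->|za] := eqVneq z a; first by rewrite subrr mulr0.
  by rewrite qE// divfK// subr_eq0.
have qnear z : z != a -> exists2 d : R, 0 < d & forall w, normc (w - z) < d -> q w = f w * (w - a)^-1.
  move=> za; exists (normc (z - a)); first by rewrite normc_gt0 subr_eq0.
  by move=> w; have [->|wa _] := eqVneq w a; [rewrite normcBC ltxx | exact: qE].
exists q; split; last exact: fq.
- split=> z z1; last first.
    rewrite in_cons negb_or => /andP[za zE].
    have [d d0 dh] := qnear _ za.
    apply: near_cdiff d0 dh _; apply: cdiffM; first exact: df.
    apply: cdiffV; last by rewrite subr_eq0.
    by apply: cdiffB; [exact: cdiff_id|exact: cdiff_cst].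
  have [->|za] := eqVneq z a.
    apply/ccontP => e e0.
    have e20 : 0 < e / 2 by rewrite divr_gt0.
    have [d d0 dh] := lP _ e20; exists d => // w wd.
    have qa : q a = l by rewrite /q eqxx.
    rewrite qa; have [wa|wa] := eqVneq w a; first by rewrite wa qa subrr normc0.
    rewrite qE//.
    have := dh w wd; rewrite fa subr0.
    have wa0 : w - a != 0 by rewrite subr_eq0.
    have n0 : 0 < normc (w - a) by rewrite normc_gt0.
    have -> : f w - l * (w - a) = (f w / (w - a) - l) * (w - a) by field.
    rewrite normcM ler_pM2r// => h; apply: le_lt_trans h _.
    by rewrite ltr_pdivrMr// mulr_natr mulr2n ltrDl.
  have [d d0 dh] := qnear _ za.
  have c1 : {for z, continuous (fun w : C => (w - a)^-1)}.
    apply: cdiff_cont; apply: cdiffV; last by rewrite subr_eq0.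
    by apply: cdiffB; [exact: cdiff_id|exact: cdiff_cst].
  have c2 : {for z, continuous (fun w => f w * (w - a)^-1)}.
    exact: (@continuousM _ _ f (fun w : C => (w - a)^-1) z (cf z z1) c1).
  move/ccontP: c2 => c2; apply/ccontP => e /c2[d' d'0 dh'].
  exists (Num.min d d'); first by rewrite lt_min d0.
  move=> w; rewrite lt_min => /andP[wd wd'].
  by rewrite !dh ?dh'// subrr normc0.
- have M0 := bdry_le_ge0 fM.
  move=> e e0.
  set k := 1 - normc a in k0 *.
  have e20 : 0 < e * k / 2 by rewrite divr_gt0// mulr_gt0.
  have [rho [rho0 rho1 h]] := fM _ e20.
  have D0 : 0 < M / k + e by rewrite ltr_wpDl// divr_ge0// ltW.
  (* For [normc z > 1 - th] the denominator is at least [k - th]; the second bound on [th] makes the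
     resulting loss at most the spare [e * k / 2]. *)
  pose th := Num.min (k / 2) (e * k / 2 / (M / k + e)).
  have th0 : 0 < th by rewrite lt_min !divr_gt0// mulr_gt0.
  have th1 : th <= k / 2 by rewrite ge_min lexx.
  have th2 : th * (M / k + e) <= e * k / 2 by rewrite -ler_pdivlMr// ge_min lexx orbT.
  have na := normc_ge0 a.
  exists (Num.max rho (1 - th)); split.
  + by rewrite le_max rho0.
  + by rewrite gt_max rho1/= ltrBlDr ltrDl.
  move=> z /andP[]; rewrite gt_max => /andP[zr zt] z1.
  have za : k - th <= normc (z - a).
    by apply: le_trans (lerB_normc _ _); rewrite /k; lra.
  have kt : 0 < k - th by lra.
  have za0 : z != a.
    by apply: contraTneq za => ->; rewrite subrr normc0 -ltNge.
  rewrite qE// normcM normcV ler_pdivrMr; last by rewrite normc_gt0 subr_eq0.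
  apply: (@le_trans _ _ (M + e * k / 2)); first by apply: h; rewrite zr.
  apply: (@le_trans _ _ ((M / k + e) * (k - th))); last by rewrite ler_pM2l.
  have -> : (M / k + e) * (k - th) = M + e * k - th * (M / k + e) by field; rewrite gt_eqF.
  by lra.
Qed.

(** Dividing by one zero after the other: each costs a factor [1 / (1 - d)] at the boundary and
    gives back [normc (z - a)], at most [normc z + d]. Zeros already divided out are collected in
    [E], hence the generality in [E] during the induction. *)
Lemma many_zeros_bound f E M (s : seq C) (d : R) :
  diff_off f E -> bdry_le f M -> uniq s -> 0 <= d < 1 ->
  (forall a, a \in s -> [/\ a \notin E, f a = 0 & normc a <= d]) ->
  forall z, normc z < 1 -> normc (f z) <= M * ((normc z + d) / (1 - d)) ^+ size s.
Proof.
move=> doff bdf us /andP[d0 d1] h z z1.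
elim: s f E M doff bdf us h => [|a s IH] f E M doff bdf.
  by move=> _ _; rewrite expr0 mulr1; exact: (disc_max_principle z1 doff bdf).
move=> /= /andP[ns us] h.
have [aE fa ad] := h a (mem_head _ _).
have a1 : normc a < 1 := le_lt_trans ad d1.
have [q [doq bdq fq]] := divide_zero doff bdf a1 aE fa.
have IHq := IH q (a :: E) _ doq bdq us.
have M0 := bdry_le_ge0 bdf.
have k0 : 0 < 1 - normc a by rewrite subr_gt0.
rewrite fq normcM exprS.
apply: le_trans (_ : M / (1 - normc a) * ((normc z + d) / (1 - d)) ^+ size s * (normc z + d) <= _).
  apply: ler_pM; rewrite ?normc_ge0//.
    apply: IHq => b bs.
    have [bE fb bd] : [/\ b \notin E, f b = 0 & normc b <= d] by apply: h; rewrite in_cons bs orbT.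
    have ba : b != a by apply: contraNneq ns => <-.
    rewrite in_cons negb_or ba bE; split => //.
    by apply/eqP; have /eqP := fq b; rewrite fb eq_sym mulf_eq0 subr_eq0 (negbTE ba) orbF.
  by apply: le_trans (ler_normcB _ _) _; rewrite lerD2l.
set X := _ ^+ size s.
have X0 : 0 <= X.
  by apply: exprn_ge0; apply: divr_ge0; rewrite ?subr_ge0 ?(ltW d1)// addr_ge0 ?normc_ge0.
rewrite [leRHS](_ : _ = M / (1 - d) * X * (normc z + d)); last by ring.
rewrite ler_wpM2r ?addr_ge0 ?normc_ge0// ler_wpM2r// ler_wpM2l//.
by rewrite lef_pV2 ?posrE ?subr_gt0// lerD2l lerN2.
Qed.

(** The points [d' / i.+1] are infinitely many zeros in a small disc, and [many_zeros_bound] bounds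
    [f z] by a geometric sequence in their number. *)
Lemma disc_identity f M (d : R) : 0 < d ->
  (forall z, normc z < 1 -> differentiable f z) ->
  (forall z, normc z < 1 -> normc (f z) <= M) ->
  (forall x : R, `|x| < d -> f x%:C = 0) ->
  forall z, normc z < 1 -> f z = 0.
Proof.
move=> d0 df fM fx z z1.
(* With [2 * d' < 1 - normc z] the ratio [(normc z + d') / (1 - d')] is less than 1. *)
pose d' := Num.min (d / 2) ((1 - normc z) / 4).
have d'0 : 0 < d' by rewrite lt_min !divr_gt0// subr_gt0.
have d'd : d' <= d / 2 by rewrite ge_min lexx.
have d'z : d' <= (1 - normc z) / 4 by rewrite ge_min lexx orbT.
clearbody d'; have nz := normc_ge0 z.
have d'1 : 0 <= d' < 1 by apply/andP; split; lra.
pose c := (normc z + d') / (1 - d').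
have c0 : 0 <= c by rewrite divr_ge0//; lra.
have c1 : c < 1 by rewrite ltr_pdivrMr; lra.
pose pt i : C := (d' / i.+1%:R)%:C.
have fk k : normc (f z) <= M * c ^+ k.
  have := @many_zeros_bound f [::] M [seq pt i | i <- iota 0 k] d' (diff_off_nil df) (bdry_le_bound fM) _ d'1 _ z z1.
  rewrite size_map size_iota; apply.
    rewrite map_inj_uniq ?iota_uniq// => i j /complexI /(mulfI (lt0r_neq0 d'0)) /invr_inj /eqP.
    by rewrite eqr_nat => /eqP[].
  move=> _ /mapP[i _ ->].
  have pi : `|d' / i.+1%:R| <= d'.
    by rewrite ger0_norm ?divr_ge0 ?(ltW d'0)// ler_pdivrMr// ler_peMr ?(ltW d'0)// ler1n.
  by split => //; [apply: fx; apply: le_lt_trans pi _; lra | rewrite normc_real].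
apply/eqP; rewrite -normc_eq0 eq_le normc_ge0 andbT.
have : (fun k => M * c ^+ k) @ \oo --> (0 : R).
  by apply: cvg_geometric; rewrite ger0_norm.
move=> /cvgrPdist_le H; apply/ler_addgt0Pr => e /H[N _ /(_ N (leqnn _))].
by rewrite sub0r normrN add0r; apply: le_trans; apply: le_trans (fk N) (ler_norm _).
Qed.

(** Divide [f - f a], bounded by [2 * M], by its zero at [a]; the factor [1 / (1 - normc a)] is at
    most 2. *)
Lemma disc_lipschitz f M a : (forall z, normc z < 1 -> differentiable f z) ->
  (forall z, normc z < 1 -> normc (f z) <= M) -> normc a <= 1 / 2 ->
  forall z, normc z < 1 -> normc (f z - f a) <= 4 * M * normc (z - a).
Proof.
move=> df fM a2 z z1.
have a1 : normc a < 1 by lra.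
pose g z := f z - f a.
have XDg : diff_off g [::].
  by apply: diff_off_nil => w w1; apply: cdiffB; [exact: df | exact: cdiff_cst].
have LBg : bdry_le g (2 * M).
  apply: bdry_le_bound => w w1; apply: le_trans (ler_normcB _ _) _.
  by rewrite mulrC mulr_natr mulr2n lerD// fM.
have ga : g a = 0 by rewrite /g subrr.
have [q [doq bdq gq]] := divide_zero XDg LBg a1 (negbT (in_nil a)) ga.
have M0 : 0 <= M by apply: le_trans (fM a a1); exact: normc_ge0.
rewrite -/(g z) gq normcM ler_wpM2r ?normc_ge0//.
apply: le_trans (disc_max_principle z1 doq bdq) _.
rewrite ler_pdivrMr; last by lra.
nra.
Qed.

Lemma disc_schwarz f M : (forall z, normc z < 1 -> differentiable f z) ->
  (forall z, normc z < 1 -> normc (f z) <= M) -> f 0 = 0 ->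
  forall z, normc z < 1 -> normc (f z) <= M * normc z.
Proof.
move=> df fM f0 z z1.
have n01 : normc (0 : C) < 1 by rewrite normc0.
have [q [doq bdq fq]] := divide_zero (diff_off_nil df) (bdry_le_bound fM) n01 (negbT (in_nil (0 : C))) f0.
rewrite fq subr0 normcM ler_wpM2r ?normc_ge0//.
by have := disc_max_principle z1 doq bdq; rewrite normc0 subr0 divr1.
Qed.

End MaximumPrinciple.

(** * Identity theorems and Osgood's lemma *)

Section Identity.
Context {R : realType}.
Local Notation C := R[i].
Implicit Types (f : C -> C).

Lemma square_bounded f (r : R) : 0 <= r ->
  (forall s t, `|s| <= r -> `|t| <= r -> {for (Complex s t), continuous f}) ->
  exists M : R, forall s t, `|s| <= r -> `|t| <= r -> normc (f (Complex s t)) <= M.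
Proof.
move=> r0 cf.
pose K : set (R * R) := `[- r, r] `*` `[- r, r].
have cK : compact K by apply: compact_setX; exact: segment_compact.
have K0 : K !=set0 by exists (0, 0); split; rewrite /= in_itv /= oppr_le0 r0.
have cg : {within K, continuous (fun u : R * R => normc (f (Complex u.1 u.2)))}.
  apply: continuous_in_subspaceT => -[s t]; rewrite inE => -[/=].
  rewrite !in_itv /= -!ler_norml => sr tr.
  apply: (@continuous_comp _ _ _ (fun u : R * R => f (Complex u.1 u.2)) (@normc R)); last exact: continuous_normc.
  apply: (@continuous_comp _ _ _ (fun u : R * R => Complex u.1 u.2 : C) f); last exact: cf.
  by apply: cvg_Complex; [exact: cvg_fst | exact: cvg_snd].
have [[s0 t0] _ hM] := compact_EVT_max K0 cK cg.
exists (normc (f (Complex s0 t0))) => s t sr tr.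
by apply: (hM (s, t)); rewrite inE; split; rewrite /= in_itv /= -ler_norml.
Qed.

(** The disc is rescaled by a factor of modulus [r / 2] in the direction of [v], so that the zeros
    lie on the real axis. Halving the radius puts the closed unit square inside the domain, since
    [r / 2 * Num.sqrt 2 < r], and compactness of the square supplies the bound that [disc_identity]
    asks for. *)
Lemma ball_identity f (p v : C) (r d : R) : 0 < r -> 0 < d -> v != 0 ->
  (forall z, normc (z - p) < r -> differentiable f z) ->
  (forall x : R, `|x| < d -> f (p + x%:C * v) = 0) ->
  forall z, normc (z - p) < r / 2 -> f z = 0.
Proof.
move=> r0 d0 v0 df fx.
have nv : 0 < normc v by rewrite normc_gt0.
pose k : C := (r / 2 / normc v)%:C * v.
have nk : normc k = r / 2.
  rewrite normcM normc_real ger0_norm; last by rewrite !divr_ge0 ?normc_ge0// ltW.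
  by rewrite divfK// gt_eqF.
have k0 : k != 0 by rewrite -normc_gt0 nk divr_gt0.
pose g z := f (p + k * z).
have rr : r / 2 < r by rewrite ltr_pdivrMr// mulr_natr mulr2n ltrDl.
have in_ball z : normc z <= Num.sqrt 2 -> normc (p + k * z - p) < r.
  move=> h; rewrite addrC addKr normcM nk.
  apply: le_lt_trans (_ : r / 2 * Num.sqrt 2 < _); first by rewrite ler_wpM2l// divr_ge0// ltW.
  rewrite mulrAC ltr_pdivrMr// ltr_pM2l// -[ltRHS]ger0_norm// -sqrtr_sqr ltr_sqrt//.
  by rewrite expr2 ltr_pMl// ltr1n.
have dg z : normc z <= Num.sqrt 2 -> differentiable g z.
  move=> h; apply: cdiff_comp; first exact: cdiff_affine.
  by apply: df; exact: in_ball.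
have sq s t : `|s| <= 1 -> `|t| <= 1 -> normc (Complex s t : C) <= Num.sqrt 2.
  move=> s1 t1 /=; rewrite ler_sqrt// (_ : 2 = 1 + 1)//.
  by apply: lerD; rewrite -real_normK ?num_real// expr_le1.
have [M gM] := @square_bounded g 1 ler01 (fun s t s1 t1 => cdiff_cont (dg _ (sq s t s1 t1))).
have s21 : 1 <= Num.sqrt 2 :> R by rewrite -[leLHS]sqrtr1 ler_sqrt// ler1n.
have gz : forall z, normc z < 1 -> g z = 0.
  apply: (@disc_identity _ g M (d * normc v / (r / 2))).
  - by rewrite divr_gt0 ?mulr_gt0// divr_gt0.
  - by move=> z z1; apply: dg; apply: le_trans s21; exact: ltW.
  - move=> z z1; have := gM (complex.Re z) (complex.Im z).
    rewrite (le_trans (Re_le_normc z) (ltW z1)) (le_trans (Im_le_normc z) (ltW z1)).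
    by case: z z1 => s t _ /=; apply.
  move=> x xd; rewrite /g /k.
  have -> : (r / 2 / normc v)%:C * v * x%:C = (r / 2 / normc v * x)%:C * v.
    by rewrite [in RHS]rmorphM /=; ring.
  apply: fx; rewrite normrM ger0_norm; last by rewrite !divr_ge0 ?normc_ge0// ltW.
  rewrite -ltr_pdivlMl ?divr_gt0//; move: xd; congr (_ < _).
  by field; rewrite !gt_eqF.
move=> z zr.
have := gz ((z - p) / k); rewrite /g mulrCA divff// mulr1 subrKC; apply.
by rewrite normcM normcV nk ltr_pdivrMr ?divr_gt0// mul1r.
Qed.

Definition copen (W : set C) := forall p, W p -> exists2 r : R, 0 < r & forall z, normc (z - p) < r -> W z.
Definition cconvex (W : set C) := forall p q (l : R), W p -> W q -> 0 <= l <= 1 -> W (p + l%:C * (q - p)).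

(** Analytic continuation along the segment from [a] to [b], through discs of one common radius
    whose consecutive centres are less than [r / 2] apart. *)
Lemma convex_identity (W : set C) f (a v : C) (d : R) : copen W -> cconvex W ->
  (forall z, W z -> differentiable f z) -> W a -> v != 0 -> 0 < d ->
  (forall x : R, `|x| < d -> f (a + x%:C * v) = 0) ->
  forall z, W z -> f z = 0.
Proof.
move=> oW cW df Wa v0 d0 fx b Wb.
have [ra ra0 hra] := oW _ Wa.
have [rb rb0 hrb] := oW _ Wb.
pose r := Num.min ra rb.
have r0 : 0 < r by rewrite lt_min ra0.
pose p (l : R) : C := a + l%:C * (b - a).
(* A point close to [p l] is the same convex combination of translates of [a] and [b], so convexity
   spreads the smaller of the two end radii over the whole segment. *)
have pW l : 0 <= l <= 1 -> forall z, normc (z - p l) < r -> W z.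
  move=> l01 z; rewrite lt_min => /andP[z1 z2].
  have -> : z = (a + (z - p l)) + l%:C * ((b + (z - p l)) - (a + (z - p l))) by rewrite /p; ring.
  apply: cW => //.
    by apply: hra; rewrite addrC addKr.
  by apply: hrb; rewrite addrC addKr.
have [N hN] : exists N : nat, normc (b - a) / N.+1%:R < r / 2.
  exists (Num.truncn (normc (b - a) / (r / 2))).
  by rewrite ltr_pdivrMr// mulrC -ltr_pdivrMr ?divr_gt0// truncnS_gt.
have step k : (k <= N.+1)%N -> exists2 e : R, 0 < e & forall z, normc (z - p (k%:R / N.+1%:R)) < e -> f z = 0.
  elim: k => [_|k IH kN].
    rewrite mul0r; exists (ra / 2); first by rewrite divr_gt0.
    rewrite /p mul0r addr0; apply: (@ball_identity f a v ra d) => // z zr.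
    by apply: df; exact: hra.
  have [e e0 he] := IH (ltnW kN).
  set q := p (k%:R / N.+1%:R) in he *; set q' := p (k.+1%:R / N.+1%:R).
  have k01 : 0 <= (k%:R / N.+1%:R : R) <= 1.
    by rewrite divr_ge0//= ler_pdivrMr// mul1r ler_nat ltnW.
  have qq : normc (q' - q) < r / 2.
    have -> : q' - q = ((N.+1%:R)^-1)%:C * (b - a).
      rewrite /q' /q /p opprD addrACA subrr add0r -mulrBl -rmorphB /= -mulrBl.
      by rewrite -natr1 addrC addKr mul1r.
    by rewrite normcM normc_real ger0_norm ?invr_ge0// mulrC.
  exists (r / 2 - normc (q' - q)); first by rewrite subr_gt0.
  move=> z zq.
  apply: (@ball_identity f q 1 r e) => //; rewrite ?oner_eq0//.
  - by move=> w wr; apply: df; apply: pW wr.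
  - by move=> x xe; apply: he; rewrite mulr1 addrC addKr normc_real.
  rewrite (_ : z - q = (z - q') + (q' - q)); last by ring.
  by apply: le_lt_trans (le_normcD _ _) _; rewrite -ltrBrDr.
have [e e0] := step N.+1 (leqnn _); rewrite divff ?pnatr_eq0// /p mul1r subrKC.
by apply; rewrite subrr normc0.
Qed.

Lemma convex_identity_ball (W : set C) f (a : C) (d : R) : copen W -> cconvex W ->
  (forall z, W z -> differentiable f z) -> W a -> 0 < d ->
  (forall z, normc (z - a) < d -> f z = 0) ->
  forall z, W z -> f z = 0.
Proof.
move=> oW cW df Wa d0 fx; apply: (@convex_identity W f a 1 d) => //; rewrite ?oner_eq0//.
by move=> x xd; apply: fx; rewrite mulr1 addrC addKr normc_real.
Qed.

(** * Separately holomorphic functions that vanish on the antidiagonal *)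

Section Diagonal.
Variables (Phi : C -> C -> C) (M : R).
Hypothesis dl : forall t0, normc t0 < 1 -> forall t, normc t < 1 -> differentiable (Phi^~ t0) t.
Hypothesis dr : forall t0, normc t0 < 1 -> forall t, normc t < 1 -> differentiable (Phi t0) t.
Hypothesis PhiM : forall s t, normc s < 1 -> normc t < 1 -> normc (Phi s t) <= M.
Hypothesis Phi0 : forall t, normc t < 1 -> Phi t t^* = 0.

(* Osgood's lemma: the difference quotients of a bounded family of holomorphic
   functions are uniformly Lipschitz, whence joint differentiability. *)
Lemma osgood s0 t0 : normc s0 < 1 / 2 -> normc t0 < 1 / 2 ->
  exists l1 l2 : C, forall e : R, 0 < e -> exists2 d : R, 0 < d & forall s t,
    normc (s - s0) < d -> normc (t - t0) < d ->
    normc (Phi s t - Phi s0 t0 - l1 * (s - s0) - l2 * (t - t0)) <= e * (normc (s - s0) + normc (t - t0)).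
Proof.
move=> s02 t02.
have s01 : normc s0 < 1 by lra.
have t01 : normc t0 < 1 by lra.
have M0 : 0 <= M by apply: le_trans (PhiM s01 t01); exact: normc_ge0.
have /cdiffP[l1 l1P] := dl t01 s01.
have /cdiffP[l2 l2P] := dr s01 t01.
exists l1, l2 => e e0.
have e20 : 0 < e / 2 by rewrite divr_gt0.
have [d1 d10 h1] := l1P _ e20.
have [d2 d20 h2] := l2P _ e20.
have K0 : 0 < 4 * (4 * M) + 1 by rewrite ltr_wpDl// !mulr_ge0.
pose d := Num.min (Num.min d1 d2) (Num.min (1 / 2) (e / 2 / (4 * (4 * M) + 1))).
exists d; first by rewrite !lt_min d10 d20 !divr_gt0.
move=> s t; rewrite !lt_min => /andP[/andP[sd1 _] /andP[sd2 _]] /andP[/andP[_ td2] /andP[td3 td4]].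
have s1 : normc s < 1.
  by have := lerB_normc s s0; lra.
have t1 : normc t < 1.
  by have := lerB_normc t t0; lra.
have H1 := h1 s sd1; have H2 := h2 t td2.
have H3 : normc (Phi s t - Phi s0 t - (Phi s t0 - Phi s0 t0)) <= 4 * (4 * M) * normc (t - t0) * normc (s - s0).
  have [->|ss] := eqVneq s s0; first by rewrite !subrr normc0 mulr0.
  have n0 : 0 < normc (s - s0) by rewrite normc_gt0 subr_eq0.
  pose q u := (Phi s u - Phi s0 u) / (s - s0).
  have dq u : normc u < 1 -> differentiable q u.
    move=> u1; apply: cdiffM; last exact: cdiff_cst.
    by apply: cdiffB; exact: dr.
  have qM u : normc u < 1 -> normc (q u) <= 4 * M.
    move=> u1; rewrite normcM normcV ler_pdivrMr//.
    exact: (disc_lipschitz (dl u1) (fun s' hs => PhiM hs u1) (ltW s02) s1).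
  have := disc_lipschitz dq qM (ltW t02) t1.
  rewrite /q -mulrBl normcM normcV ler_pdivrMr//.
have H4 : 4 * (4 * M) * normc (t - t0) <= e / 2.
  apply: le_trans (_ : (4 * (4 * M) + 1) * normc (t - t0) <= _).
    by rewrite ler_wpM2r ?normc_ge0// lerDl.
  by rewrite mulrC -ler_pdivlMr// ltW.
have -> : Phi s t - Phi s0 t0 - l1 * (s - s0) - l2 * (t - t0) =
  (Phi s t - Phi s0 t - (Phi s t0 - Phi s0 t0)) + (Phi s t0 - Phi s0 t0 - l1 * (s - s0)) +
  (Phi s0 t - Phi s0 t0 - l2 * (t - t0)) by ring.
apply: le_trans (le_normcD _ _) _.
apply: le_trans (lerD (le_normcD _ _) (lexx _)) _.
have H5 : 4 * (4 * M) * normc (t - t0) * normc (s - s0) <= e / 2 * normc (s - s0).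
  by rewrite ler_wpM2r// normc_ge0.
have Ht : e / 2 * normc (t - t0) <= e * normc (t - t0).
  by rewrite ler_wpM2r ?normc_ge0// ler_pdivrMr// mulr_natr mulr2n lerDl ltW.
apply: le_trans (lerD (lerD (le_trans H3 H5) H1) (le_trans H2 Ht)) _.
by rewrite -mulrDl -splitr mulrDr.
Qed.

Lemma osgood_comp (a b a' b' x : C) : normc b = 1 -> normc b' = 1 ->
  normc (a + b * x) < 1 / 2 -> normc (a' + b' * x) < 1 / 2 ->
  differentiable (fun x => Phi (a + b * x) (a' + b' * x)) x.
Proof.
move=> b1 b1' h h'.
have [l1 [l2 H]] := osgood h h'.
apply/cdiffP; exists (l1 * b + l2 * b') => e e0.
have e20 : 0 < e / 2 by rewrite divr_gt0.
have [d d0 dh] := H _ e20; exists d => // y yd.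
have e1 : a + b * y - (a + b * x) = b * (y - x) by ring.
have e2 : a' + b' * y - (a' + b' * x) = b' * (y - x) by ring.
have := dh (a + b * y) (a' + b' * y).
rewrite e1 e2 !normcM b1 b1' !mul1r => /(_ yd yd).
have -> : e / 2 * (normc (y - x) + normc (y - x)) = e * normc (y - x) by field.
by congr (normc _ <= _); ring.
Qed.

(** In the coordinates [s = x + i y], [t = x - i y], real [x] and [y] give [t] conjugate to [s],
    where [Phi] vanishes. The identity theorem is used in [x] for real [y], then in [y] for complex
    [x]. The radius 1/4 for [x] and [y] keeps both arguments below 1/2, as [osgood_comp]
    requires. *)
Lemma diagonal_zero s t : normc s < 1 / 8 -> normc t < 1 / 8 -> Phi s t = 0.
Proof.
have sm (x y : C) : normc x < 1 / 4 -> normc y < 1 / 4 ->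
    normc (x + 'i%C * y) < 1 / 2 /\ normc (x - 'i%C * y) < 1 / 2.
  move=> x4 y4; have := le_normcD x ('i%C * y); have := ler_normcB x ('i%C * y).
  by rewrite normcM normc_i mul1r; split; lra.
have st1 (x y : C) : normc x < 1 / 4 -> normc y < 1 / 4 ->
    normc (x + 'i%C * y) < 1 /\ normc (x - 'i%C * y) < 1.
  by move=> x4 y4; have [] := sm _ _ x4 y4; split; lra.
have disc4 (f : C -> C) (z : C) : (forall z, normc z < 1 / 4 -> differentiable f z) ->
    (forall z, normc z < 1 / 4 -> normc (f z) <= M) ->
    (forall x : R, `|x| < 1 / 4 -> f x%:C = 0) -> normc z < 1 / 4 -> f z = 0.
  move=> df fM fx z4.
  have n4' : normc (4 : C) = 4.
    by rewrite -[4 : C]/(4%:R) -(rmorph_nat (real_complex R)) normc_real ger0_norm.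
  have n4 : normc (4^-1 : C) = 1 / 4 by rewrite normcV n4' div1r.
  have sc (w : C) : normc w < 1 -> normc (0 + 4^-1 * w) < 1 / 4.
    by move=> w1; rewrite add0r normcM n4; lra.
  have := @disc_identity _ (fun w => f (0 + 4^-1 * w)) M 1 ltr01 _ _ _ (4 * z).
  rewrite add0r mulrA mulVf ?pnatr_eq0// mul1r; apply.
  - by move=> w w1; apply: cdiff_comp; [exact: cdiff_affine | apply: df; exact: sc].
  - by move=> w w1; apply: fM; exact: sc.
  - move=> x x1; rewrite add0r.
    have -> : 4^-1 * x%:C = (x / 4)%:C by rewrite mulrC rmorphM /= fmorphV rmorph_nat.
    by apply: fx; rewrite normrM [`|4^-1|]ger0_norm ?invr_ge0//; lra.
  by rewrite normcM n4'; lra.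
have real_case (y : R) (x : C) : `|y| < 1 / 4 -> normc x < 1 / 4 ->
    Phi (x + 'i%C * y%:C) (x - 'i%C * y%:C) = 0.
  move=> y4 x4; have y4' : normc (y%:C : C) < 1 / 4 by rewrite normc_real.
  apply: (disc4 (fun x => Phi (x + 'i%C * y%:C) (x - 'i%C * y%:C))) x4 => [z z4|z z4|u u4].
  - have [h1 h2] := sm _ _ z4 y4'.
    have -> : (fun w => Phi (w + 'i%C * y%:C) (w - 'i%C * y%:C)) =
        (fun w => Phi ('i%C * y%:C + 1 * w) (- ('i%C * y%:C) + 1 * w)).
      by apply/funext => w; rewrite !mul1r addrC [- _ + _]addrC.
    apply: osgood_comp; rewrite ?normc1//.
      by rewrite (_ : _ + _ = z + 'i%C * y%:C)//; ring.
    by rewrite (_ : _ + _ = z - 'i%C * y%:C)//; ring.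
  - by have [] := st1 _ _ z4 y4'; exact: PhiM.
  have u4' : normc (u%:C : C) < 1 / 4 by rewrite normc_real.
  have [h1 h2] := st1 _ _ u4' y4'.
  rewrite -[X in Phi _ X](_ : (u%:C + 'i%C * y%:C)^* = _) ?Phi0//.
  by rewrite conjcD conjcM; apply: ceq => /=; ring.
move=> s8 t8.
pose x := (s + t) / 2; pose y := (s - t) / (2 * 'i%C).
have n2 : normc (2 : C) = 2.
  by rewrite -[2 : C]/(2%:R) -(rmorph_nat (real_complex R)) normc_real ger0_norm.
have i0 : 'i%C != 0 :> C by rewrite -normc_eq0 normc_i oner_eq0.
have x4 : normc x < 1 / 4.
  by rewrite normcM normcV n2; have := le_normcD s t; lra.
have y4 : normc y < 1 / 4.
  by rewrite normcM normcV normcM normc_i n2 mulr1; have := ler_normcB s t; lra.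
have -> : s = x + 'i%C * y by rewrite /x /y; field.
have -> : t = x - 'i%C * y by rewrite /x /y; field.
apply: (disc4 (fun y => Phi (x + 'i%C * y) (x - 'i%C * y))) y4 => [z z4|z z4|u u4].
- have [h1 h2] := sm _ _ x4 z4.
  have -> : (fun y => Phi (x + 'i%C * y) (x - 'i%C * y)) =
      (fun y => Phi (x + 'i%C * y) (x + - 'i%C * y)).
    by apply/funext => w; rewrite mulNr.
  by apply: osgood_comp; rewrite ?normcN ?normc_i ?mulNr.
- by have [] := st1 _ _ x4 z4; exact: PhiM.
exact: real_case.
Qed.

End Diagonal.

End Identity.

(** * Logarithms and powers *)

Section Clog.
Context {R : realType}.
Local Notation C := R[i].
Implicit Types z w : C.

Let ratio z : z != 0 -> -1 <= complex.Re z / normc z <= 1.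
Proof.
move=> z0; have n0 : 0 < normc z by rewrite normc_gt0.
by rewrite -ler_norml normrM normfV (ger0_norm (ltW n0)) ler_pdivrMr// mul1r Re_le_normc.
Qed.

Lemma cos_carg z : z != 0 -> cos (carg z) = complex.Re z / normc z.
Proof.
move=> z0; rewrite /carg; case: ifP => _; rewrite ?cosN acosK// in_itv/=; exact: ratio.
Qed.

Lemma sin_carg z : z != 0 -> sin (carg z) = complex.Im z / normc z.
Proof.
move=> z0; have n0 : 0 < normc z by rewrite normc_gt0.
have E : sin (acos (complex.Re z / normc z)) = `|complex.Im z| / normc z.
  rewrite sin_acos; last exact: ratio.
  rewrite -[RHS]ger0_norm ?divr_ge0 ?normr_ge0 ?ltW// -sqrtr_sqr; congr Num.sqrt.
  rewrite !expr_div_n real_normK ?num_real// -[1 in LHS](@divff _ (normc z ^+ 2)) ?expf_neq0 ?gt_eqF//.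
  by rewrite -mulrBl sqr_normcE addrC addKr.
rewrite /carg; case: (leP 0 (complex.Im z)) => h; first by rewrite E ger0_norm.
by rewrite sinN E ltr0_norm// mulNr opprK.
Qed.

Lemma cexp_clog z : z != 0 -> cexp (clog z) = z.
Proof.
move=> z0; have n0 : 0 < normc z by rewrite normc_gt0.
rewrite /cexp /clog /= lnK// cos_carg// sin_carg//.
apply: ceq => /=; field; exact: lt0r_neq0.
Qed.

Lemma Re_gt0_neq0 z : 0 < complex.Re z -> z != 0.
Proof. by apply: contraTneq => ->; rewrite ltxx. Qed.

(** On the right half-plane the arcsine formula has no case distinction on the sign of the imaginary
    part, so continuity across the real axis becomes visible. *)
Lemma carg_asin z : 0 < complex.Re z -> carg z = asin (complex.Im z / normc z).
Proof.
move=> z0; have zn0 := Re_gt0_neq0 z0; have n0 : 0 < normc z by rewrite normc_gt0.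
rewrite -sin_carg// sinK// in_itv /=.
have c0 : 0 <= acos (complex.Re z / normc z) by apply: acos_ge0; exact: ratio.
have c1 : acos (complex.Re z / normc z) <= pi / 2.
  rewrite leNgt; apply/negP => h.
  have : cos (acos (complex.Re z / normc z)) < cos (pi / 2).
    rewrite ltr_cos ?in_itv/= ?c0 ?acos_lepi ?ratio//.
    by rewrite divr_ge0 ?pi_ge0//= ler_pdivrMr// mulr_natr mulr2n lerDl pi_ge0.
  rewrite cos_pihalf acosK ?in_itv/= ?ratio//.
  by rewrite ltNge divr_ge0 ?ltW.
have p0 : 0 <= pi / 2 :> R by rewrite divr_ge0 ?pi_ge0.
rewrite /carg; case: ifP => _; last by rewrite lerN2 c1 (le_trans _ p0)// oppr_le0.
by rewrite c1 andbT (le_trans _ c0)// oppr_le0.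
Qed.

Lemma continuous_clog z : 0 < complex.Re z -> {for z, continuous (@clog R)}.
Proof.
move=> z0; have n0 : 0 < normc z by rewrite normc_gt0 Re_gt0_neq0.
have r1 : -1 < complex.Im z / normc z < 1.
  rewrite -ltr_norml normrM normfV (ger0_norm (ltW n0)) ltr_pdivrMr// mul1r.
  rewrite -(@ltr_pXn2r _ 2)// ?nnegrE ?normc_ge0//.
  by rewrite sqr_normcE real_normK ?num_real// ltrDr exprn_gt0.
have cN : normc w @[w --> z] --> normc z := @continuous_normc R z.
apply: (@cvg_Complex R _ (nbhs z) _ (fun w => ln (normc w)) (@carg R)).
  exact: (@cvg_comp _ _ _ (@normc R) (@ln R) (nbhs z) _ _ cN (continuous_ln n0)).
have : asin (complex.Im w / normc w) @[w --> z] --> asin (complex.Im z / normc z).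
  apply: (@cvg_comp _ _ _ (fun w : C => complex.Im w / normc w) (@asin R) (nbhs z) _ _ _ (continuous_asin r1)).
  apply: cvgM; first exact: continuous_cIm.
  by apply: cvgV => //; rewrite gt_eqF.
rewrite -carg_asin//; apply: cvg_trans; apply: near_eq_cvg.
apply/cnbhsP; exists (complex.Re z) => // w wz; rewrite carg_asin//.
have := le_lt_trans (Re_le_normc _) wz; rewrite ltr_norml => /andP[+ _].
by case: w z {z0 n0 r1 cN wz} => [a b] [c d] /=; lra.
Qed.

(** Inverse function argument: [clog] is a continuous right inverse of [cexp], whose derivative at
    [clog z] is [z], which is not 0. *)
Lemma cdiff_clog z : 0 < complex.Re z -> differentiable (@clog R) z.
Proof.
move=> z0; have zn0 := Re_gt0_neq0 z0.
have n0 : 0 < normc z by rewrite normc_gt0.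
apply/cdiffP; exists z^-1 => e e0.
(* The first bound yields [normc u <= 2 * normc (w - z) / normc z], where [u] is the increment of
   [clog]; the second then turns the remainder of [cexp] into [e * normc (w - z)] after division by
   [z]. *)
pose e1 := Num.min (normc z / 2) (e * normc z ^+ 2 / 2).
have e10 : 0 < e1 by rewrite lt_min !divr_gt0// mulr_gt0// exprn_gt0.
have e11 : e1 <= normc z / 2 by rewrite ge_min lexx.
have e12 : e1 <= e * normc z ^+ 2 / 2 by rewrite ge_min lexx orbT.
clearbody e1.
have [d d0 dh] := cexp_derive (clog z) e10.
have /ccontP/(_ _ d0)[d' d'0 dh'] := continuous_clog z0.
exists (Num.min d' (normc z)); first by rewrite lt_min d'0.
move=> w; rewrite lt_min => /andP[wd wz].
have w0 : w != 0 by apply: contraTneq wz => ->; rewrite sub0r normcN ltxx.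
have := dh _ (dh' _ wd); rewrite !cexp_clog//.
set u := clog w - clog z => H.
have H1 : normc u * normc z / 2 <= normc (w - z).
  have := lerB_normc (z * u) (z * u - (w - z)).
  have -> : z * u - (z * u - (w - z)) = w - z by ring.
  rewrite normcM (normcBC (z * u)).
  have : e1 * normc u <= normc z / 2 * normc u by rewrite ler_wpM2r ?normc_ge0.
  by lra.
have -> : u - z^-1 * (w - z) = - z^-1 * (w - z - z * u) by field.
rewrite normcM normcN normcV ler_pdivrMl//.
apply: le_trans H _.
apply: le_trans (_ : e * normc z ^+ 2 / 2 * normc u <= _); first by rewrite ler_wpM2r// normc_ge0.
have := ler_wpM2l (mulr_ge0 (ltW e0) (ltW n0)) H1.
by rewrite expr2; lra.
Qed.

Lemma conj_clog z : 0 < complex.Re z -> clog z^* = (clog z)^*.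
Proof.
move=> z0; rewrite /clog conjcE normc_conj; congr Complex.
rewrite !carg_asin ?normc_conj//; last by case: (z) z0.
have -> : complex.Im z^* = - complex.Im z by case: (z).
have zn0 := Re_gt0_neq0 z0; have n0 : 0 < normc z by rewrite normc_gt0.
have h : -1 <= complex.Im z / normc z <= 1.
  by rewrite -ler_norml normrM normfV (ger0_norm (ltW n0)) ler_pdivrMr// mul1r Im_le_normc.
rewrite mulNr; set t := _ / _ in h *.
have hN : -1 <= - t <= 1 by case/andP: h => h1 h2; apply/andP; split; lra.
apply: sin_inj; rewrite ?in_itv /=.
- by rewrite asin_geNpi2//= asin_lepi2.
- by rewrite lerN2 asin_lepi2//= lerNl asin_geNpi2.
- by rewrite sinN !asinK ?in_itv.
Qed.

Lemma clog_real (x : R) : 0 < x -> clog x%:C = (ln x)%:C.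
Proof.
move=> x0; rewrite /clog normc_real gtr0_norm//; apply: ceq => //=.
by rewrite carg_asin//= mul0r -[RHS](@sinK R 0) ?sin0// in_itv/= oppr_le0 divr_ge0 ?pi_ge0.
Qed.

Lemma cpow_real (x a : R) : 0 < x -> cpow x%:C a = (x `^ a)%:C.
Proof.
by move=> x0; rewrite /cpow clog_real// -rmorphM cexp_real /powR gt_eqF.
Qed.

Lemma conj_cpow z (a : R) : 0 < complex.Re z -> cpow z^* a = (cpow z a)^*.
Proof. by move=> z0; rewrite /cpow conj_clog// conj_cexp conjcM conj_real. Qed.

Lemma cpow_neq0 z (a : R) : cpow z a != 0. Proof. exact: cexp_neq0. Qed.

Lemma cdiff_cpow z (a : R) : 0 < complex.Re z -> differentiable (fun z => cpow z a) z.
Proof.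
move=> z0; apply: (@cdiff_comp _ (fun z => a%:C * clog z) (@cexp R)); last exact: cexp_diff.
by apply: cdiffM; [exact: cdiff_cst | exact: cdiff_clog].
Qed.

(** Subtracting the period given by the floor leaves an angle in [[0, 2 * pi[] with cosine 1.
    Injectivity of the cosine on [[0, pi]] makes it 0, after a reflection if the angle exceeds
    [pi]. *)
Lemma cexp_eq1 z : cexp z = 1 -> exists k : int, z = Complex 0 (k%:~R * (2 * pi)).
Proof.
have pi2 : 0 < 2 * pi :> R by rewrite mulr_gt0// pi_gt0.
move=> h; exists (Num.floor (complex.Im z / (2 * pi))).
have Rz : complex.Re z = 0.
  have := normc_cexp z; rewrite h normc1 => /esym e; apply: expR_inj; rewrite e expR0//.
case: z Rz h => a b /= -> h; apply: ceq => //=.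
set k := Num.floor _.
have cz (j : int) (w : C) : cexp (w - Complex 0 (j%:~R * (2 * pi))) = cexp w.
  have natcase (m : nat) (u : C) : cexp (u + Complex 0 (m%:R * (2 * pi))) = cexp u.
    elim: m u => [|m IH] u.
      by congr cexp; apply: ceq => /=; rewrite mul0r; case: u => ? ?/=; rewrite addr0.
    have -> : u + Complex 0 (m.+1%:R * (2 * pi)) = (u + Complex 0 (m%:R * (2 * pi))) + Complex 0 (2 * pi).
      by rewrite -natr1; apply: ceq; case: u => ? ? /=; ring.
    by rewrite cexp_2pi IH.
  case: j => m.
    by rewrite -[LHS](natcase m) subrK.
  have -> : w - Complex 0 ((Negz m)%:~R * (2 * pi)) = w + Complex 0 (m.+1%:R * (2 * pi)).
    by rewrite NegzE mulrNz -pmulrn; apply: ceq; case: w => ? ? /=; ring.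
  exact: natcase.
set y := b - k%:~R * (2 * pi).
have y0 : 0 <= y.
  by rewrite subr_ge0 -ler_pdivlMr// floor_le_tmp.
have y1 : y < 2 * pi.
  rewrite ltrBlDr -[X in _ < X + _]mul1r -mulrDl -ltr_pdivrMr// addrC.
  by have := floorD1_gt (b / (2 * pi)); rewrite -/k intrD.
have cy : cos y = 1.
  have := cz k (Complex 0 b); rewrite h => /(congr1 (@complex.Re R)).
  rewrite /cexp /= !subr0 expR0 mul1r mul0r subr0 => <-//.
suff yz : y = 0 by apply/eqP; rewrite -subr_eq0 -/y yz.
have [ypi|ypi] := lerP y pi.
  by rewrite -[LHS](@cosK R) ?in_itv/= ?y0// cy acos1.
have c2 : cos (2 * pi - y) = 1.
  by rewrite -cosN opprB mulr_natl -[RHS]cy -[in RHS](subrK (pi *+ 2) y) cosD2pi.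
have : 2 * pi - y = 0.
  rewrite -[LHS](@cosK R) ?in_itv/= ?c2 ?acos1//.
  by apply/andP; split; lra.
lra.
Qed.

End Clog.

(** * The polarised defining function *)

Section SiegelAlgebra.
Context {R : realType} {n : nat}.
Local Notation C := R[i].
Implicit Types (u v : 'rV[C]_n) (w x y : 'rV[C]_n.+1).

Lemma zeta_pt u (z : C) : zeta (pt u z) = u.
Proof. by apply/rowP => i; rewrite !mxE liftK. Qed.

Lemma zcoord_pt u (z : C) : zcoord (pt u z) = z.
Proof. by rewrite /zcoord mxE unlift_none. Qed.

Lemma pt_eq x y : zeta x = zeta y -> zcoord x = zcoord y -> x = y.
Proof.
move=> h1 h2; apply/rowP => j; case: (unliftP ord_max j) => [i ->|->//].
by have /rowP/(_ i) := h1; rewrite !mxE.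
Qed.

Lemma zetaD x y : zeta (x + y) = zeta x + zeta y.
Proof. by apply/rowP => i; rewrite !mxE. Qed.
Lemma zetaZ (a : C) x : zeta (a *: x) = a *: zeta x.
Proof. by apply/rowP => i; rewrite !mxE. Qed.
Lemma zetaB x y : zeta (x - y) = zeta x - zeta y.
Proof. by apply/rowP => i; rewrite !mxE. Qed.
Lemma zcoordD x y : zcoord (x + y) = zcoord x + zcoord y.
Proof. by rewrite /zcoord mxE. Qed.
Lemma zcoordZ (a : C) x : zcoord (a *: x) = a * zcoord x.
Proof. by rewrite /zcoord mxE. Qed.
Lemma zcoordB x y : zcoord (x - y) = zcoord x - zcoord y.
Proof. by rewrite /zcoord !mxE. Qed.

Lemma hermDl m (u v w : 'rV[C]_m) : herm (u + v) w = herm u w + herm v w.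
Proof. by rewrite -big_split; apply: eq_bigr => i _; rewrite mxE mulrDl. Qed.
Lemma hermZl m (a : C) (u v : 'rV[C]_m) : herm (a *: u) v = a * herm u v.
Proof. by rewrite mulr_sumr; apply: eq_bigr => i _; rewrite mxE mulrA. Qed.
Lemma hermC m (u v : 'rV[C]_m) : herm v u = (herm u v)^*.
Proof. by rewrite rmorph_sum; apply: eq_bigr => i _; rewrite rmorphM /= conjCK mulrC. Qed.
Lemma hermDr m (u v w : 'rV[C]_m) : herm w (u + v) = herm w u + herm w v.
Proof. by rewrite hermC hermDl rmorphD /= -!hermC. Qed.
Lemma hermZr m (a : C) (u v : 'rV[C]_m) : herm v (a *: u) = a^* * herm v u.
Proof. by rewrite hermC hermZl rmorphM /= -hermC. Qed.
Lemma hermNl m (u v : 'rV[C]_m) : herm (- u) v = - herm u v.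
Proof. by rewrite -scaleN1r hermZl mulN1r. Qed.
Lemma hermNr m (u v : 'rV[C]_m) : herm v (- u) = - herm v u.
Proof. by rewrite hermC hermNl rmorphN /= -hermC. Qed.
Lemma hermBl m (u v w : 'rV[C]_m) : herm (u - v) w = herm u w - herm v w.
Proof. by rewrite hermDl hermNl. Qed.
Lemma hermBr m (u v w : 'rV[C]_m) : herm w (u - v) = herm w u - herm w v.
Proof. by rewrite hermDr hermNr. Qed.
Lemma herm0l m (v : 'rV[C]_m) : herm 0 v = 0.
Proof. by rewrite -(scale0r (0 : 'rV[C]_m)) hermZl mul0r. Qed.
Lemma herm0r m (v : 'rV[C]_m) : herm v 0 = 0.
Proof. by rewrite hermC herm0l rmorph0. Qed.

Lemma hermE m (u : 'rV[C]_m) : herm u u = (sqnorm u)%:C.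
Proof. by rewrite rmorph_sum; apply: eq_bigr => i _; exact: mul_conjc. Qed.

Lemma sqnorm_ge0 m (u : 'rV[C]_m) : 0 <= sqnorm u.
Proof. by apply: sumr_ge0 => i _; rewrite sqr_ge0. Qed.

Lemma sqnorm_eq0 m (u : 'rV[C]_m) : sqnorm u = 0 -> u = 0.
Proof.
move=> /eqP; rewrite psumr_eq0 => [/allP h|i _]; last exact: sqr_ge0.
apply/rowP => i; rewrite mxE; apply/eqP; rewrite -normc_eq0.
by have := h i (mem_index_enum _); rewrite sqrf_eq0.
Qed.

Lemma sqnormZ m (a : C) (u : 'rV[C]_m) : sqnorm (a *: u) = normc a ^+ 2 * sqnorm u.
Proof. by rewrite mulr_sumr; apply: eq_bigr => i _; rewrite mxE normcM exprMn. Qed.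

Lemma Re_herm_le m (u v : 'rV[C]_m) : 2 * complex.Re (herm u v) <= sqnorm u + sqnorm v.
Proof.
have : 0 <= complex.Re (herm (u - v) (u - v)) by rewrite hermE sqnorm_ge0.
rewrite hermBl !hermBr !hermE (hermC u v); case: (herm u v) => a b.
by rewrite conjcE /=; lra.
Qed.

(* The base of the power in [kernelA]. *)
Definition kap x y : C :=
  (zcoord x - (zcoord y)^*) / (2 * 'i%C) - herm (zeta x) (zeta y).

Definition height x : R := complex.Im (zcoord x) - sqnorm (zeta x).

Lemma siegelP x : siegel R n x <-> 0 < height x.
Proof. by rewrite /siegel /height /= subr_gt0. Qed.

Lemma two_i_neq0 : 2 * 'i%C != 0 :> C.
Proof. by rewrite mulf_neq0 ?pnatr_eq0// -normc_eq0 normc_i oner_eq0. Qed.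

Lemma inv_2i (z : C) : z / (2 * 'i%C) = Complex (complex.Im z / 2) (- complex.Re z / 2).
Proof.
apply: (mulIf two_i_neq0); rewrite divfK ?two_i_neq0//.
have -> : 2 * 'i%C = Complex 0 2 :> C.
  by rewrite -(rc_nat 2); apply: ceq => /=; ring.
by case: z => a b; apply: ceq => /=; field.
Qed.

Lemma kapC x y : kap y x = (kap x y)^*.
Proof.
rewrite /kap !inv_2i (hermC (zeta x)) rmorphB; congr (_ - _).
by case: (zcoord x) (zcoord y) => a b [c d]; rewrite !conjcE; apply: ceq => /=; field.
Qed.

Lemma kap_diag x : kap x x = (height x)%:C.
Proof.
rewrite /kap inv_2i hermE /height rmorphB; congr (_ - _).
by case: (zcoord x) => a b; rewrite conjcE; apply: ceq => /=; field.
Qed.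

Lemma Re_kap_gt0 x y : siegel R n x -> siegel R n y -> 0 < complex.Re (kap x y).
Proof.
move=> /siegelP; rewrite /height => hx /siegelP; rewrite /height => hy.
have := Re_herm_le (zeta x) (zeta y).
rewrite /kap inv_2i; case: (herm _ _) (zcoord x) (zcoord y) hx hy => a b [c d] [e f] /=; lra.
Qed.

Lemma kap_neq0 x y : siegel R n x -> siegel R n y -> kap x y != 0.
Proof. by move=> sx /(Re_kap_gt0 sx); apply: contraTneq => ->; rewrite ltxx. Qed.

(** [sqnorm] at a convex combination is the combination of the values minus [l * (1 - l)] times the
    squared distance, so [height] is concave. *)
Lemma siegel_convex x y (l : R) : siegel R n x -> siegel R n y -> 0 <= l <= 1 ->
  siegel R n (x + l%:C *: (y - x)).
Proof.
move=> /siegelP hx /siegelP hy /andP[l0 l1]; apply/siegelP; move: hx hy; rewrite /height => hx hy.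
have E : sqnorm (zeta (x + l%:C *: (y - x))) =
    (1 - l) * sqnorm (zeta x) + l * sqnorm (zeta y) - l * (1 - l) * sqnorm (zeta x - zeta y).
  apply: complexI; rewrite !(rcB, rcD, rcM) -!hermE (rc_nat 1).
  rewrite zetaD zetaZ zetaB !(hermDl, hermBl, hermZl, hermDr, hermBr, hermZr, hermNl, hermNr) !conj_real; ring.
rewrite {}E zcoordD zcoordZ zcoordB.
have s0 := sqnorm_ge0 (zeta x - zeta y).
have : 0 <= l * (1 - l) * sqnorm (zeta x - zeta y) by rewrite !mulr_ge0// subr_ge0.
have : 0 < (1 - l) * (complex.Im (zcoord x) - sqnorm (zeta x)) + l * (complex.Im (zcoord y) - sqnorm (zeta y)).
  have [->|l00] := eqVneq l 0; first by rewrite subr0 mul1r mul0r addr0.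
  rewrite ltr_wpDl ?mulr_ge0 ?subr_ge0 ?(ltW hx)//; first by move: hx; rewrite subr_gt0 => /ltW.
  by rewrite mulr_gt0// lt_def l00.
case: (zcoord x) (zcoord y) => a b [c d] /=; lra.
Qed.

(* The maps of [GT], as maps of the whole space. *)
Definition gmap (r : R) (u : 'rV[C]_n) (t : R) w : 'rV[C]_n.+1 :=
  pt (r%:C *: zeta w + u)
     (r%:C ^+ 2 * zcoord w + t%:C + 'i%C * (sqnorm u)%:C + 2 * 'i%C * herm (r%:C *: zeta w) u).

Lemma kap_gmap r u t x y : kap (gmap r u t x) (gmap r u t y) = r%:C ^+ 2 * kap x y.
Proof.
rewrite /kap /gmap !zcoord_pt !zeta_pt -!hermE.
have i20 := two_i_neq0.
have ci2 : (2 * 'i%C : C)^* = - (2 * 'i%C) by rewrite rmorphM /= conj_nat conj_i mulrN.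
have i1 : 'i%C = (2 * 'i%C) / 2 :> C by rewrite mulrAC divff ?mul1r// pnatr_eq0.
move: (2 * 'i%C) i20 ci2 i1 => i2 i20 ci2 i1.
rewrite !(hermDl, hermZl, hermDr, hermZr) !(conjcD, conjcM) !conj_real conj_i ci2.
rewrite -(hermC u u) -(hermC (zeta y) u).
by rewrite i1; field.
Qed.

End SiegelAlgebra.

(** * Holomorphic functions on the domain *)

Section Holomorphic.
Context {R : realType} {n : nat}.
Local Notation C := R[i].
Local Notation D := (siegel R n).
Implicit Types (x y : 'rV[C]_n.+1).

(* Outside of the domain the value is the base point. *)
Definition toD x : D := insubd (base R n) x.

Lemma toDK x : siegel R n x -> \val (toD x) = x.
Proof. by move=> sx; rewrite /toD insubdK//; exact: mem_set. Qed.

Lemma valD (w : D) : siegel R n (\val w).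
Proof. by apply: set_mem; exact: valP. Qed.

Lemma toD_val (w : D) : toD (\val w) = w.
Proof. exact: valKd. Qed.

Lemma ext_toD {W : normedModType C} (f : D -> W) x : siegel R n x -> ext f x = f (toD x).
Proof. by move=> sx; rewrite -{1}(toDK sx) extE. Qed.

Lemma near_siegel x : siegel R n x -> \forall y \near x, siegel R n y.
Proof. by move=> sx; apply: open_nbhs_nbhs; split => //; exact: open_siegel. Qed.

Lemma hol_of {W : normedModType C} (F : 'rV[C]_n.+1 -> W) (f : D -> W) :
  (forall w, f w = F (\val w)) -> (forall w : D, differentiable F (\val w)) -> holomorphic f.
Proof.
move=> fF dF w; apply: near_eq_differentiable (dF w).
by apply: filterS (near_siegel (valD w)) => y sy; rewrite ext_toD// fF toDK.
Qed.

Lemma eq_hol {W : normedModType C} (f g : D -> W) : f =1 g -> holomorphic f -> holomorphic g.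
Proof. by move=> /funext ->. Qed.

Lemma hol_cst (k : C) : holomorphic (fun _ : D => k).
Proof. by apply: (@hol_of _ (fun=> k)) => // w; exact: differentiable_cst. Qed.

Lemma hol_near2 (op : C -> C -> C) (f g : D -> C) :
  (forall F G : 'rV[C]_n.+1 -> C, forall x, differentiable F x -> differentiable G x ->
    differentiable (fun x => op (F x) (G x)) x) ->
  holomorphic f -> holomorphic g -> holomorphic (fun w => op (f w) (g w)).
Proof.
move=> dop hf hg w; apply: (@near_eq_differentiable R n _ _ (fun x => op (ext f x) (ext g x))).
  by apply: filterS (near_siegel (valD w)) => y sy; rewrite !ext_toD.
exact: dop.
Qed.

Lemma holD (f g : D -> C) : holomorphic f -> holomorphic g -> holomorphic (fun w => f w + g w).
Proof. by apply: (@hol_near2 +%R) => F G x; exact: differentiableD. Qed.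

Lemma holB (f g : D -> C) : holomorphic f -> holomorphic g -> holomorphic (fun w => f w - g w).
Proof. by apply: (@hol_near2 (fun a b => a - b)) => F G x; exact: differentiableB. Qed.

Lemma holM (f g : D -> C) : holomorphic f -> holomorphic g -> holomorphic (fun w => f w * g w).
Proof. by apply: (@hol_near2 *%R) => F G x; exact: differentiableM. Qed.

Lemma hol_outer (f : D -> C) (F : C -> C) : holomorphic f ->
  (forall w, differentiable F (f w)) -> holomorphic (fun w => F (f w)).
Proof.
move=> hf dF w; apply: (@near_eq_differentiable R n _ _ (F \o ext f)).
  by apply: filterS (near_siegel (valD w)) => y sy; rewrite /= !ext_toD.
by apply: differentiable_comp; [exact: hf | rewrite extE; exact: dF].
Qed.

Lemma holV (f : D -> C) : holomorphic f -> (forall w, f w != 0) -> holomorphic (fun w => (f w)^-1).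
Proof.
move=> hf f0; apply: (@hol_outer f (fun z => z^-1)) => // w.
by apply: cdiffV => //; exact: cdiff_id.
Qed.

Lemma hol_sum m (F : 'I_m -> D -> C) : (forall i, holomorphic (F i)) ->
  holomorphic (fun w => \sum_(i < m) F i w).
Proof.
move=> hF; have : forall s : seq 'I_m, holomorphic (fun w => \sum_(i <- s) F i w); last exact.
elim=> [|i s IH]; first by under eq_fun do rewrite big_nil; exact: hol_cst.
by under eq_fun do rewrite big_cons; exact: holD.
Qed.

Lemma hol_comp (f : D -> C) (g : D -> D) : holomorphic f -> holomorphic (Defs.incl g) ->
  holomorphic (fun w => f (g w)).
Proof.
move=> hf hg w; apply: (@near_eq_differentiable R n _ _ (ext f \o ext (Defs.incl g))).
  by apply: filterS (near_siegel (valD w)) => y sy; rewrite /= !(ext_toD _ sy) extE.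
by apply: differentiable_comp; [exact: hg | rewrite extE; exact: hf].
Qed.

Lemma hol_coord j : holomorphic (fun w : D => (\val w) ord0 j).
Proof.
apply: (@hol_of _ (fun x : 'rV[C]_n.+1 => x ord0 j)) => // w.
exact: differentiable_coord.
Qed.

Lemma hol_zcoord : holomorphic (fun w : D => zcoord (\val w)).
Proof. exact: hol_coord. Qed.

Lemma hol_hermz (u : 'rV[C]_n) : holomorphic (fun w : D => herm (zeta (\val w)) u).
Proof.
apply: hol_sum => i; apply: holM; last exact: hol_cst.
by apply: eq_hol (hol_coord (lift ord_max i)) => w; rewrite mxE.
Qed.

Lemma hol_kap y : holomorphic (fun w : D => kap (\val w) y).
Proof.
apply: holB; last exact: hol_hermz.
by apply: holM; [apply: holB; [exact: hol_zcoord|exact: hol_cst] | exact: hol_cst].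
Qed.

Lemma diff_line (a b : 'rV[C]_n.+1) (t : C) : differentiable (fun t : C => a + t *: b) t.
Proof.
apply: differentiableD; first exact: differentiable_cst.
by apply: (@differentiableZl _ _ _ (fun t : C => t) b t); exact: cdiff_id.
Qed.

Lemma copen_line (a b : 'rV[C]_n.+1) : copen [set t | siegel R n (a + t *: b)].
Proof.
move=> t /= st.
have ct : {for t, continuous (fun t : C => a + t *: b)}.
  by apply: differentiable_continuous; exact: diff_line.
by have /cnbhsP := ct _ (near_siegel st).
Qed.

Lemma cconvex_line (a b : 'rV[C]_n.+1) : cconvex [set t | siegel R n (a + t *: b)].
Proof.
move=> p q l /= sp sq l01.
have := siegel_convex sp sq l01; congr (siegel _ _ _).
by rewrite opprD addrACA subrr add0r -scalerBl scalerA -addrA -scalerDl.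
Qed.

Lemma hol_line (f : D -> C) a b t : holomorphic f -> siegel R n (a + t *: b) ->
  differentiable (fun t : C => f (toD (a + t *: b))) t.
Proof.
move=> hf st; have [d d0 dh] := @copen_line a b t st.
apply: (@near_cdiff _ _ (fun t => ext f (a + t *: b)) _ d d0).
  by move=> w /dh sw; rewrite ext_toD.
apply: (@differentiable_comp _ _ _ _ (fun t : C => a + t *: b) (ext f)); first exact: diff_line.
by rewrite -[X in differentiable _ X](toDK st); exact: hf.
Qed.

(* On the complex line through two points, E is a function of s and conj t
   which vanishes for s = t near the first point: conclude by [diagonal_zero]
   and by the identity theorem along the line. *)
Lemma diagonal_determines (E : D -> D -> C) :
  (forall w', holomorphic (fun w => E w w')) ->
  (forall w w', E w' w = (E w w')^*) -> (forall w, E w w = 0) ->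
  (forall a b, siegel R n a -> exists M r : R, 0 < r /\ forall s t : C,
    normc s < r -> normc t < r -> siegel R n (a + s *: b) -> siegel R n (a + t *: b) ->
    normc (E (toD (a + s *: b)) (toD (a + t *: b))) <= M) ->
  forall w w', E w w' = 0.
Proof.
move=> hE EC E0 Eb w w'.
pose a := \val w; pose b := \val w' - \val w.
pose W := [set t | siegel R n (a + t *: b)].
have W0 : W 0 by rewrite /W /= scale0r addr0; exact: valD.
have W1 : W 1 by rewrite /W /= scale1r /a /b subrKC; exact: valD.
pose L t := toD (a + t *: b).
have [M [r1 [r10 hM]]] := Eb a b (valD w).
have [r2 r20 hr2] := @copen_line a b 0 W0.
pose r := Num.min r1 r2.
have r0 : 0 < r by rewrite lt_min r10.
have Wr t : normc t < r -> W t.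
  by rewrite lt_min => /andP[_ h]; apply: hr2; rewrite subr0.
have cr : normc (r%:C : C) = r by rewrite normc_real gtr0_norm.
have sc z : normc z < 1 -> normc (0 + r%:C * z) < r.
  by move=> z1; rewrite add0r normcM cr -[ltRHS]mulr1 ltr_pM2l.
have dL w1 t : W t -> differentiable (fun t => E (L t) w1) t.
  by move=> Wt; apply: (@hol_line (fun w => E w w1)).
(* The conjugation in the second slot makes [Phi] holomorphic in both variables, and the factor [r]
   moves everything to the unit bidisc. *)
pose Phi s t := E (L (0 + r%:C * s)) (L (0 + r%:C * t^*)).
have nc (z : C) : normc z < 1 -> normc (z^* : C) < 1 by rewrite normc_conj.
have P0 s t : normc s < 1 / 8 -> normc t < 1 / 8 -> Phi s t = 0.
  apply: (@diagonal_zero _ Phi M) => [t0 t01 t1 t11|t0 t01 t1 t11|s' t' s1 t'1|t' t1].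
  - apply: (@cdiff_comp _ (fun s => 0 + r%:C * s) (fun s => E (L s) (L (0 + r%:C * t0^*)))); first exact: cdiff_affine.
    by apply: dL; apply: Wr; exact: sc.
  - rewrite /Phi.
    have -> : (fun t => E (L (0 + r%:C * t0)) (L (0 + r%:C * t^*))) =
        (fun t => (E (L (0 + r%:C * t^*)) (L (0 + r%:C * t0)))^*).
      by apply/funext => t2; rewrite -EC.
    apply: (@cdiff_conj _ (fun t => E (L (0 + r%:C * t)) (L (0 + r%:C * t0)))).
    apply: (@cdiff_comp _ (fun s => 0 + r%:C * s) (fun s => E (L s) (L (0 + r%:C * t0)))); first exact: cdiff_affine.
    by apply: dL; apply: Wr; apply: sc; exact: nc.
  - have := sc _ s1; have := sc _ (nc _ t'1); rewrite /r !lt_min => /andP[h1 h2] /andP[h3 h4].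
    by apply: hM => //; [apply: (Wr (0 + _))|apply: (Wr (0 + _))]; rewrite /r lt_min ?h1 ?h3.
  - by rewrite /Phi conjCK E0.
have P1 s t : normc s < r / 8 -> normc t < r / 8 -> E (L s) (L t) = 0.
  move=> s8 t8.
  have := P0 (s / r%:C) ((t / r%:C)^*); rewrite /Phi conjCK !add0r ![r%:C * (_ / _)]mulrC !divfK; last 2 first.
  - by rewrite -normc_gt0 cr.
  - by rewrite -normc_gt0 cr.
  apply; rewrite ?normc_conj normcM normcV cr ltr_pdivrMr// mulrAC mul1r mulrC.
    by move: s8; rewrite mulrC.
  by move: t8; rewrite mulrC.
have r80 : 0 < r / 8 by rewrite divr_gt0.
have P2 t s : normc t < r / 8 -> W s -> E (L s) (L t) = 0.
  move=> t8; apply: (@convex_identity_ball _ W (fun s => E (L s) (L t)) 0 (r / 8)) => //.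
  - exact: copen_line.
  - exact: cconvex_line.
  - by move=> z Wz; exact: dL.
  - by move=> z; rewrite subr0 => z8; exact: P1.
have P3 : E (L 1) (L 0) = 0.
  apply: (@convex_identity_ball _ W (fun s => E (L s) (L 0)) 0 (r / 8)) => //.
  - exact: copen_line.
  - exact: cconvex_line.
  - by move=> z Wz; exact: dL.
  - by move=> z; rewrite subr0 => z8; apply: P1 => //; rewrite normc0.
have L0 : L 0 = w by rewrite /L scale0r addr0 toD_val.
have L1 : L 1 = w' by rewrite /L scale1r /a /b subrKC toD_val.
by rewrite EC -[in RHS](rmorph0 (@Num.conj C)) -L0 -L1 P3.
Qed.

End Holomorphic.

(** * Affine biholomorphisms and Jacobians *)

Section VectorValued.
Context {R : realType} {n : nat}.
Local Notation C := R[i].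
Local Notation D := (siegel R n).

Lemma hol_vec m (F : D -> 'rV[C]_m.+1) : (forall j, holomorphic (fun w => F w ord0 j)) -> holomorphic F.
Proof.
move=> hF w.
apply: (@near_eq_differentiable R n _ _ (\sum_(j < m.+1) (fun x => ext (fun w => F w ord0 j) x *: delta_mx ord0 j))).
  apply: filterS (near_siegel (valD w)) => y sy; rewrite (ext_toD _ sy) fct_sumE.
  by rewrite [LHS]row_sum_delta; apply: eq_bigr => j _; rewrite (ext_toD _ sy).
apply: differentiable_sum => j.
by apply: differentiableZl; exact: hF.
Qed.

Lemma hol_vecE m (F : D -> 'rV[C]_m.+1) j : holomorphic F -> holomorphic (fun w => F w ord0 j).
Proof.
move=> hF w.
apply: (@near_eq_differentiable R n _ _ ((fun x : 'rV[C]_m.+1 => x ord0 j) \o ext F)).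
  by apply: filterS (near_siegel (valD w)) => y sy; rewrite /= !(ext_toD _ sy).
by apply: differentiable_comp; [exact: hF | exact: differentiable_coord].
Qed.

Lemma hol_herm m (F : D -> 'rV[C]_m.+1) c : holomorphic F -> holomorphic (fun w => herm (F w) c).
Proof.
move=> hF; apply: hol_sum => j; apply: holM; last exact: hol_cst.
exact: hol_vecE.
Qed.

Lemma herm_continuous m (c : 'rV[C]_m.+1) : continuous (fun x : 'rV[C]_m.+1 => herm x c).
Proof.
move=> x; apply: differentiable_continuous.
rewrite (_ : (fun x => _) = \sum_(i < m.+1) (fun x : 'rV[C]_m.+1 => (c ord0 i)^* * x ord0 i)).
  by apply: differentiable_sum => i; apply: (@differentiableZ _ _ _ _ (c ord0 i)^*); exact: differentiable_coord.
by apply/funext => y; rewrite fct_sumE; apply: eq_bigr => i _; rewrite mulrC.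
Qed.

Lemma near_line (w : D) v : \forall h \near (0 : C), siegel R n (h *: v + \val w).
Proof.
have w0 : siegel R n (\val w + (0 : C) *: v) by rewrite scale0r addr0; exact: valD.
have [d d0 dh] := copen_line w0.
by apply/cnbhsP; exists d => // h /dh; rewrite addrC.
Qed.

Lemma derive_hermz m (F : D -> 'rV[C]_m.+1) c (w : D) v : holomorphic F ->
  'D_v (ext (fun w => herm (F w) c)) (\val w) = herm ('D_v (ext F) (\val w)) c.
Proof.
move=> hF; apply/cvg_lim => //.
have dF : derivable (ext F) (\val w) v by apply: diff_derivable; exact: hF.
have := cvg_comp _ _ dF (@herm_continuous _ c _); apply: cvg_trans; apply: near_eq_cvg.
have nb := near_line w v.
rewrite /dnbhs; apply: (@filterS _ _ _ _ _ _ nb) => h sh _ /=.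
by rewrite !(ext_toD _ sh) !extE hermZl hermBl.
Qed.

Lemma jacobian_row m (F : D -> 'rV[C]_m.+1) (w : D) i : holomorphic F ->
  row i (jacobian (ext F) (\val w)) = 'D_(delta_mx ord0 i) (ext F) (\val w).
Proof. by move=> hF; rewrite deriveEjacobian ?rowE//; exact: hF. Qed.

(** Jacobian from an exact formula for the increments. The scalar [k h] is 1 for affine maps, and
    accounts for the denominator in the case of the Cayley transform. *)
Lemma jacobian_lim m (F : D -> 'rV[C]_m.+1) (w : D) (L : 'rV[C]_n.+1 -> 'rV[C]_m.+1) :
  holomorphic F ->
  (forall v, exists k : C -> C, {for 0, continuous k} /\ k 0 = 1 /\ forall h : C, h != 0 ->
    siegel R n (h *: v + \val w) -> F (toD (h *: v + \val w)) - F w = (h * k h) *: L v) ->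
  jacobian (ext F) (\val w) = \matrix_(i, j) L (delta_mx ord0 i) ord0 j.
Proof.
move=> hF H; apply/row_matrixP => i; rewrite jacobian_row//.
have -> : row i (\matrix_(i, j) L (delta_mx ord0 i) ord0 j) = L (delta_mx ord0 i).
  by apply/rowP => j; rewrite !mxE.
set v := delta_mx _ _; have [k [ck [k0 kh]]] := H v.
apply/cvg_lim => //.
have : (k h *: L v) @[h --> 0^'] --> L v.
  rewrite -[X in _ --> X]scale1r -k0; apply: cvgZ; last exact: cvg_cst.
  by apply: cvg_within_filter; exact: ck.
apply: cvg_trans; apply: near_eq_cvg.
have nb := near_line w v.
rewrite /dnbhs; apply: (@filterS _ _ _ _ _ _ nb) => h sh h0 /=.
by rewrite !(ext_toD _ sh) extE kh// scalerA mulrA mulVf// mul1r.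
Qed.

(** Jacobians act on row vectors from the right, hence the order of the factors. *)
Lemma jacobian_comp m (F : D -> 'rV[C]_m.+1) (f : D -> D) (w : D) :
  holomorphic F -> holomorphic (Defs.incl f) ->
  jacobian (ext (F \o f)) (\val w) =
  jacobian (ext (Defs.incl f)) (\val w) *m jacobian (ext F) (\val (f w)).
Proof.
move=> hF hf.
have hFf : holomorphic (F \o f).
  apply: hol_vec => j; apply: (@hol_comp R n (fun w => F w ord0 j) f) => //.
  exact: hol_vecE.
apply/row_matrixP => i; rewrite jacobian_row// row_mul jacobian_row//.
have dG : differentiable (ext F \o ext (Defs.incl f)) (\val w).
  by apply: differentiable_comp; [exact: hf|rewrite extE; exact: hF].
rewrite (@near_eq_derive _ _ _ _ (ext F \o ext (Defs.incl f))); last first.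
  by apply: filterS (near_siegel (valD w)) => y sy; rewrite /= !(ext_toD _ sy) /= extE.
rewrite (deriveE _ dG) diff_comp; [|exact: hf|by rewrite extE; exact: hF].
rewrite -[LHS]/('d (ext F) (ext (Defs.incl f) (\val w)) ('d (ext (Defs.incl f)) (\val w) (delta_mx ord0 i))).
rewrite extE -(deriveE _ (hf w)).
have dFw := hF (f w).
by rewrite -[Defs.incl f w]/(\val (f w)) -(deriveE _ dFw) (deriveEjacobian _ dFw).
Qed.

Lemma lift_max_or (j : 'I_n.+1) : j = ord_max \/ exists i, j = lift ord_max i.
Proof. by case: (unliftP ord_max j) => [i ->|->]; [right; exists i | left]. Qed.

Lemma det_arrow (A : 'M[C]_n.+1) (al : C) :
  (forall a b, A (lift ord_max a) (lift ord_max b) = al *+ (a == b)) ->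
  (forall b, A ord_max (lift ord_max b) = 0) ->
  \det A = al ^+ n * A ord_max ord_max.
Proof.
move=> Al A0; rewrite -det_tr det_trig.
  rewrite big_ord_recr /= mxE; congr (_ * _).
  rewrite (eq_bigr (fun=> al)) ?prodr_const ?card_ord// => i _.
  have -> : widen_ord (leqnSn n) i = lift ord_max i by apply: val_inj; rewrite /= /bump leqNgt ltn_ord.
  by rewrite mxE Al eqxx.
apply/is_trig_mxP => i j ij; rewrite mxE.
have [jm|[b jb]] := lift_max_or j; have [im|[a ia]] := lift_max_or i.
- by move: ij; rewrite im jm ltnn.
- by rewrite jm ia A0.
- by move: ij; rewrite im ltnNge -ltnS ltn_ord.
- rewrite jb ia Al; case: eqP => // ab; by move: ij; rewrite ia jb ab ltnn.
Qed.

End VectorValued.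

Section AffineMaps.
Context {R : realType} {n : nat}.
Local Notation C := R[i].
Local Notation D := (siegel R n).
Implicit Types (u : 'rV[C]_n) (w : 'rV[C]_n.+1).

Lemma gmap_siegel r u t w : 0 < r -> siegel R n w -> siegel R n (gmap r u t w).
Proof.
move=> r0 /siegelP h; apply/siegelP; rewrite -ltcR -kap_diag kap_gmap kap_diag -rcX -rcM ltcR.
by rewrite mulr_gt0// exprn_gt0.
Qed.

(** Group law of the dilated Heisenberg group; the imaginary part of [herm u2 u1] is its central
    cocycle. *)
Lemma gmap_comp r1 u1 t1 r2 u2 t2 w : gmap r1 u1 t1 (gmap r2 u2 t2 w) =
  gmap (r1 * r2) (r1%:C *: u2 + u1) (r1 ^+ 2 * t2 + t1 - 2 * r1 * complex.Im (herm u2 u1)) w.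
Proof.
apply: pt_eq; rewrite !(zeta_pt, zcoord_pt).
  by rewrite scalerDr scalerA -rcM addrA.
rewrite -!hermE !(hermDl, hermZl, hermDr, hermZr) !conj_real.
have two_c (x : R) : (2 * x)%:C = 2 * x%:C :> C by rewrite rcM rc_nat.
rewrite rcB rcD -[2 * r1 * _]mulrA two_c !rcM (hermC u2 u1).
have -> : (complex.Im (herm u2 u1))%:C = (herm u2 u1 - (herm u2 u1)^*) / (2 * 'i%C).
  by rewrite inv_2i; case: (herm u2 u1) => a b; rewrite conjcE; apply: ceq => /=; field.
have i20 : 'i%C != 0 :> C by rewrite -normc_eq0 normc_i oner_eq0.
have i2 : 'i%C * 'i%C = -1 :> C by rewrite -expr2 sqr_i.
move: ('i%C) i20 i2 => i i20 i2.
have iV : i^-1 = - i by apply: (mulfI i20); rewrite divff// mulrN i2 opprK.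
by rewrite invfM iV; field.
Qed.

Lemma gmap_id w : gmap 1 0 0 w = w.
Proof.
apply: pt_eq; rewrite !(zeta_pt, zcoord_pt) (rc_nat 1) ?scale1r ?addr0//.
by rewrite -hermE !herm0r mulr0 addr0 mulr0 addr0 expr1n mul1r.
Qed.

Lemma gmapK r u t w : 0 < r -> gmap r^-1 (- r^-1%:C *: u) (- (r^-1 ^+ 2 * t)) (gmap r u t w) = w.
Proof.
move=> r0; rewrite gmap_comp mulVf ?gt_eqF// -scalerDl subrr scale0r -[RHS]gmap_id.
congr gmap; rewrite subrr sub0r hermZr hermE -rcN conj_real -rcM /= mulr0.
by rewrite oppr0.
Qed.

Lemma gmapVK r u t w : 0 < r -> gmap r u t (gmap r^-1 (- r^-1%:C *: u) (- (r^-1 ^+ 2 * t)) w) = w.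
Proof.
move=> r0; rewrite gmap_comp mulfV ?gt_eqF// scalerA -rcN -rcM mulrN mulfV ?gt_eqF//.
rewrite (rcN 1) (rc_nat 1) scaleN1r addNr -[RHS]gmap_id.
congr gmap; rewrite hermZl hermE -rcM /= mulr0 subr0 mulrN mulrA -exprMn mulfV ?gt_eqF//.
by rewrite expr1n mul1r addNr.
Qed.

Definition gfun r u t (w : D) : D := toD (gmap r u t (\val w)).

Lemma val_gfun r u t (w : D) : 0 < r -> \val (gfun r u t w) = gmap r u t (\val w).
Proof. by move=> r0; rewrite toDK//; apply: gmap_siegel => //; exact: valD. Qed.

Lemma gfun_hol r u t : 0 < r -> holomorphic (Defs.incl (gfun r u t)).
Proof.
move=> r0; apply: hol_vec => j.
apply: (@eq_hol R n _ (fun w : D => gmap r u t (\val w) ord0 j)).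
  by move=> w; rewrite /Defs.incl val_gfun.
have [->|[i ->]] := lift_max_or j.
  apply: (@eq_hol R n _ (fun w : D => r%:C ^+ 2 * zcoord (\val w) + t%:C + 'i%C * (sqnorm u)%:C
       + 2 * 'i%C * (r%:C * herm (zeta (\val w)) u))).
    by move=> w; rewrite [RHS]mxE unlift_none hermZl.
  apply: holD.
    apply: holD; last exact: hol_cst.
    apply: holD; last exact: hol_cst.
    by apply: holM; [exact: hol_cst|exact: hol_zcoord].
  apply: holM; first exact: hol_cst.
  by apply: holM; [exact: hol_cst|exact: hol_hermz].
apply: (@eq_hol R n _ (fun w : D => r%:C * (\val w) ord0 (lift ord_max i) + u ord0 i)).
  by move=> w; rewrite [RHS]mxE liftK !mxE.
apply: holD; last exact: hol_cst.
by apply: holM; [exact: hol_cst|exact: hol_coord].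
Qed.

Lemma gfunK r u t : 0 < r ->
  cancel (gfun r u t) (gfun r^-1 (- r^-1%:C *: u) (- (r^-1 ^+ 2 * t))).
Proof. by move=> r0 w; rewrite {1}/gfun val_gfun// gmapK// toD_val. Qed.

Lemma gfunVK r u t : 0 < r ->
  cancel (gfun r^-1 (- r^-1%:C *: u) (- (r^-1 ^+ 2 * t))) (gfun r u t).
Proof. by move=> r0 w; rewrite {1}/gfun val_gfun ?invr_gt0// gmapVK// toD_val. Qed.

Lemma gfunV_hol r u t : 0 < r ->
  holomorphic (Defs.incl (gfun r^-1 (- r^-1%:C *: u) (- (r^-1 ^+ 2 * t)))).
Proof. by move=> r0; apply: gfun_hol; rewrite invr_gt0. Qed.

Definition gt (r : R) (r0 : 0 < r) u t : biholo R n :=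
  Biholo (gfunK u t r0) (gfunVK u t r0) (gfun_hol u t r0) (gfunV_hol u t r0).

Lemma gt_GT r (r0 : 0 < r) u t : GT R n (gt r0 u t).
Proof. by exists r, u, t; split => // w; exact: val_gfun. Qed.

Lemma GT_gt f : GT R n f -> exists r u t (r0 : 0 < r), f = gt r0 u t.
Proof.
move=> [r [u [t [r0 h]]]]; exists r, u, t, r0; apply: biholoP => w.
by apply: val_inj; rewrite h /= val_gfun.
Qed.

Lemma cjac_gfun r u t (w : D) : 0 < r -> cjac (gfun r u t) w = r%:C ^+ n.+2.
Proof.
move=> r0.
pose L v := pt (r%:C *: zeta v) (r%:C ^+ 2 * zcoord v + 2 * 'i%C * herm (r%:C *: zeta v) u) : 'rV[C]_n.+1.
rewrite /cjac (@jacobian_lim R n n (Defs.incl (gfun r u t)) w L); last 2 first.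
- exact: gfun_hol.
- move=> v; exists (fun=> 1); split; first by apply: cdiff_cont; exact: cdiff_cst.
  split => // h h0 sh; rewrite /Defs.incl !val_gfun// toDK//.
  rewrite mulr1 /L /gmap; apply: pt_eq.
    rewrite zetaB zetaZ !zeta_pt opprD addrACA subrr addr0 -scalerBr zetaD zetaZ addrK.
    by rewrite !scalerA mulrC.
  rewrite zcoordB zcoordZ !zcoord_pt zetaD zetaZ zcoordD zcoordZ scalerDr !(hermDl, hermZl).
  by ring.
rewrite (@det_arrow R n _ r%:C).
- rewrite mxE [L _ _ _]zcoord_pt.
  have -> : zeta (delta_mx ord0 ord_max : 'rV[C]_n.+1) = 0.
    by apply/rowP => i; rewrite !mxE /= eq_sym (negbTE (neq_lift _ _)).
  by rewrite scaler0 herm0l mulr0 addr0 /zcoord mxE !eqxx mulr1 -exprD addn2.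
- move=> a b; rewrite !mxE liftK !mxE eqxx /= (inj_eq lift_inj) eq_sym.
  by case: eqP => _; rewrite ?mulr1// mulr0.
- by move=> b; rewrite !mxE liftK !mxE /= eq_sym (negbTE (neq_lift _ _)) mulr0.
Qed.

Lemma cjac_comp (f g : D -> D) (w : D) : holomorphic (Defs.incl f) -> holomorphic (Defs.incl g) ->
  cjac (f \o g) w = cjac g w * cjac f (g w).
Proof. by move=> hf hg; rewrite /cjac (@jacobian_comp R n n (Defs.incl f) g)// det_mulmx. Qed.

Lemma transitive_base (w : D) : exists r u t (r0 : 0 < r), gt r0 u t (base R n) = w.
Proof.
have h : 0 < height (\val w) by apply/siegelP; exact: valD.
have r0 : 0 < Num.sqrt (height (\val w)) by rewrite sqrtr_gt0.
exists (Num.sqrt (height (\val w))), (zeta (\val w)), (complex.Re (zcoord (\val w))), r0.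
apply: val_inj; rewrite /= val_gfun//; apply: pt_eq; rewrite !(zeta_pt, zcoord_pt).
  by rewrite scaler0 add0r.
rewrite scaler0 herm0l mulr0 addr0 -rcX sqr_sqrtr ?ltW// /height.
by case: (zcoord _) => a b; apply: ceq => /=; ring.
Qed.

End AffineMaps.

(** * The Cayley transform and the covariance of the kernel *)

Section Cayley.
Context {R : realType} {n : nat}.
Local Notation C := R[i].
Local Notation D := (siegel R n).
Implicit Types (x y v : 'rV[C]_n.+1) (w : D).

(** Multiplying [a] by a number of modulus 1 makes the scalar product real and positive without
    changing [sqnorm a]. *)
Lemma normc_herm m (a b : 'rV[C]_m) : normc (herm a b) <= (sqnorm a + sqnorm b) / 2.
Proof.
have [h0|h0] := eqVneq (herm a b) 0.
  by rewrite h0 normc0 divr_ge0// addr_ge0 ?sqnorm_ge0.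
set h := herm a b in h0 *; have n0 : 0 < normc h by rewrite normc_gt0.
pose c : C := h^* / (normc h)%:C.
have nc : normc c = 1.
  by rewrite normcM normcV normc_conj normc_real gtr0_norm// divff// gt_eqF.
have := Re_herm_le (c *: a) b; rewrite sqnormZ nc expr1n mul1r hermZl -/h.
have -> : c * h = (normc h)%:C.
  rewrite /c mulrAC [h^* * h]mulrC mul_conjc rcX expr2 mulfK//.
  by rewrite -normc_eq0 normc_real normr_eq0 gt_eqF.
by rewrite [complex.Re _]/=; lra.
Qed.

Lemma herm_pt (u1 u2 : 'rV[C]_n) (z1 z2 : C) : herm (pt u1 z1) (pt u2 z2) = herm u1 u2 + z1 * z2^*.
Proof.
rewrite {1}/herm big_ord_recr /=.
have E (i : 'I_n) : widen_ord (leqnSn n) i = lift ord_max i.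
  by apply: val_inj; rewrite /= /bump leqNgt ltn_ord.
congr (_ + _); last by rewrite !mxE !unlift_none.
by apply: eq_bigr => i _; rewrite E !mxE !liftK.
Qed.

Lemma pt_zeta x : pt (zeta x) (zcoord x) = x.
Proof. by apply: pt_eq; rewrite ?zeta_pt ?zcoord_pt. Qed.

Definition cay x : 'rV[C]_n.+1 := (zcoord x + 'i%C)^-1 *: pt (2 *: zeta x) (zcoord x - 'i%C).

Definition icay v : 'rV[C]_n.+1 := ('i%C / (1 - zcoord v)) *: pt (zeta v) (1 + zcoord v).

Let i0 : 'i%C != 0 :> C. Proof. by rewrite -normc_eq0 normc_i oner_eq0. Qed.

Let i2 : 'i%C * 'i%C = -1 :> C. Proof. by rewrite -expr2 sqr_i. Qed.

Lemma cay_den x : siegel R n x -> zcoord x + 'i%C != 0.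
Proof.
move=> /siegelP; rewrite /height => h; have := sqnorm_ge0 (zeta x) => h'.
apply/eqP => /(congr1 (@complex.Im R)).
by case: (zcoord x) h => a b /=; lra.
Qed.

(** Bridge between ball and domain: an equality of scalar products on the ball becomes a
    transformation rule for [kap], with automorphy factors built from [zcoord + i]. *)
Lemma cay_herm x y : zcoord x + 'i%C != 0 -> zcoord y + 'i%C != 0 ->
  1 - herm (cay x) (cay y) = 4 * kap x y / ((zcoord x + 'i%C) * (zcoord y + 'i%C)^*).
Proof.
move=> dx dy; rewrite /cay hermZl hermZr herm_pt hermZl hermZr /kap.
have dy' : (zcoord y)^* - 'i%C != 0.
  by have : (zcoord y + 'i%C)^* != 0; [rewrite conjC_eq0 | rewrite conjcD conj_i].
rewrite (conj_nat 2) conjcV conjcB conjcD !conj_i opprK.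
have iV : (2 * 'i%C)^-1 = - 'i%C / 2 :> C.
  have iN : 'i%C^-1 = - 'i%C :> C by apply: (mulfI i0); rewrite divff// mulrN i2 opprK.
  by rewrite invfM iN mulrC.
rewrite iV; set z := zcoord x in dx *; set y' := (zcoord y)^* in dy' *.
move: ('i%C) i0 i2 dx dy' => i i00 i20 dx dy'.
have -> : 4 * ((z - y') * (- i / 2) - herm (zeta x) (zeta y)) = (z + i) * (y' - i) - (4 * herm (zeta x) (zeta y) + (z - i) * (y' + i)).
  by field.
by field; rewrite dx dy'.
Qed.

Lemma zcoord_icay v : 1 - zcoord v != 0 -> zcoord (icay v) + 'i%C = 2 * 'i%C / (1 - zcoord v).
Proof. by move=> h; rewrite /icay zcoordZ zcoord_pt; field. Qed.

Lemma icayK v : 1 - zcoord v != 0 -> cay (icay v) = v.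
Proof.
move=> h; rewrite /cay zcoord_icay//; apply: pt_eq.
  rewrite zetaZ zeta_pt /icay zetaZ zeta_pt !scalerA -[RHS]scale1r; congr (_ *: _).
  by field; rewrite h i0.
rewrite zcoordZ zcoord_pt /icay zcoordZ zcoord_pt.
by field; rewrite h i0.
Qed.

Lemma cayK x : zcoord x + 'i%C != 0 -> icay (cay x) = x.
Proof.
move=> h; have E : 1 - zcoord (cay x) = 2 * 'i%C / (zcoord x + 'i%C).
  by rewrite /cay zcoordZ zcoord_pt; field.
have h2 : 1 - (zcoord x + 'i%C)^-1 * (zcoord x - 'i%C) = 2 * 'i%C / (zcoord x + 'i%C) by field.
rewrite /icay E; apply: pt_eq.
  rewrite zetaZ zeta_pt /cay zetaZ zeta_pt !scalerA -[RHS]scale1r; congr (_ *: _).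
  by field; rewrite h i0.
rewrite zcoordZ zcoord_pt /cay zcoordZ zcoord_pt.
by field; rewrite h i0.
Qed.

Lemma sqnorm_cay x : zcoord x + 'i%C != 0 ->
  1 - sqnorm (cay x) = 4 * height x / normc (zcoord x + 'i%C) ^+ 2.
Proof.
move=> dx; apply: complexI; rewrite rcB -hermE (rc_nat 1) cay_herm// kap_diag mul_conjc.
by rewrite [RHS]rcM rcV [(4 * _)%:C]rcM rc_nat.
Qed.

Lemma cay_ball x : siegel R n x -> sqnorm (cay x) < 1.
Proof.
move=> sx; have dx := cay_den sx; rewrite -subr_gt0 sqnorm_cay//.
by rewrite divr_gt0 ?mulr_gt0 ?exprn_gt0 ?normc_gt0//; apply/siegelP.
Qed.

Lemma ball_den v : sqnorm v < 1 -> 1 - zcoord v != 0.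
Proof.
move=> v1; apply/eqP => /eqP; rewrite subr_eq0 => /eqP h.
have : sqnorm v = sqnorm (zeta v) + 1.
  apply: complexI; rewrite -hermE -{1 2}(pt_zeta v) herm_pt -h rmorph1 mulr1 hermE rcD.
  by rewrite (rc_nat 1).
by have := sqnorm_ge0 (zeta v); lra.
Qed.

Lemma icay_siegel v : sqnorm v < 1 -> siegel R n (icay v).
Proof.
move=> v1; have dv := ball_den v1.
have dx : zcoord (icay v) + 'i%C != 0.
  by rewrite zcoord_icay// mulf_neq0 ?two_i_neq0// invr_neq0.
have := sqnorm_cay dx; rewrite icayK// => h.
have : 0 < 4 * height (icay v) / normc (zcoord (icay v) + 'i%C) ^+ 2 by rewrite -h subr_gt0.
by rewrite pmulr_lgt0 ?invr_gt0 ?exprn_gt0 ?normc_gt0// pmulr_rgt0// => /siegelP.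
Qed.

Lemma cay_base : cay (\val (base R n)) = 0.
Proof.
rewrite /cay [\val _]/= zeta_pt zcoord_pt scaler0 subrr; apply: pt_eq.
  by rewrite zetaZ zeta_pt scaler0; apply/rowP => i; rewrite !mxE.
by rewrite zcoordZ zcoord_pt mulr0 /zcoord mxE.
Qed.

Lemma icay0 : icay 0 = \val (base R n).
Proof. by rewrite -cay_base cayK//; apply: cay_den; exact: valD. Qed.

Lemma hol_cay : holomorphic (fun w => cay (\val w)).
Proof.
apply: hol_vec => j.
have hV : holomorphic (fun w : D => (zcoord (\val w) + 'i%C)^-1).
  apply: holV; first by apply: holD; [exact: hol_zcoord | exact: hol_cst].
  by move=> w; apply: cay_den; exact: valD.
have [->|[i ->]] := lift_max_or j.
  apply: (@eq_hol R n _ (fun w : D => (zcoord (\val w) + 'i%C)^-1 * (zcoord (\val w) - 'i%C))).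
    by move=> w; rewrite [RHS]mxE; congr (_ * _); rewrite -[RHS]/(zcoord (pt _ _)) zcoord_pt.
  by apply: holM => //; apply: holB; [exact: hol_zcoord | exact: hol_cst].
apply: (@eq_hol R n _ (fun w : D => (zcoord (\val w) + 'i%C)^-1 * (2 * (\val w) ord0 (lift ord_max i)))).
  by move=> w; rewrite [RHS]mxE; congr (_ * _); rewrite [RHS]mxE liftK !mxE.
by apply: holM => //; apply: holM; [exact: hol_cst | exact: hol_coord].
Qed.

Lemma icay_line v (l : C) : icay (l *: v) =
  ('i%C / (1 - zcoord v * l)) *: pt 0 1 + ('i%C * l / (1 - zcoord v * l)) *: v.
Proof.
rewrite /icay zcoordZ zetaZ [l * _]mulrC; move: (1 - zcoord v * l)^-1 => k.
apply: pt_eq; rewrite ?zetaD ?zcoordD ?zetaZ ?zcoordZ ?zeta_pt ?zcoord_pt.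
  by rewrite scaler0 add0r scalerA mulrAC.
by ring.
Qed.

Lemma diff_icay_line v (l : C) : sqnorm (l *: v) < 1 -> differentiable (fun l : C => icay (l *: v)) l.
Proof.
move=> l1.
have dl : 1 - zcoord v * l != 0 by have := ball_den l1; rewrite zcoordZ mulrC.
have dV : differentiable (fun l : C => (1 - zcoord v * l)^-1) l.
  have dd : differentiable (fun l : C => 1 - zcoord v * l) l.
    apply: cdiffB; first exact: cdiff_cst.
    by apply: cdiffM; [exact: cdiff_cst | exact: cdiff_id].
  exact: (cdiffV dd dl).
rewrite (_ : (fun l => _) = (fun l : C => ('i%C / (1 - zcoord v * l)) *: (pt 0 1 : 'rV[C]_n.+1)) +
    (fun l => ('i%C * l / (1 - zcoord v * l)) *: v)); last first.
  by apply/funext => l'; exact: icay_line.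
apply: differentiableD.
  apply: (@differentiableZl _ _ _ (fun l : C => 'i%C / (1 - zcoord v * l)) (pt 0 1 : 'rV[C]_n.+1) l).
  exact: (cdiffM (cdiff_cst _ _) dV).
apply: (@differentiableZl _ _ _ (fun l : C => 'i%C * l / (1 - zcoord v * l)) v l).
have di : differentiable (fun l : C => 'i%C * l) l by apply: cdiffM; [exact: cdiff_cst | exact: cdiff_id].
exact: (cdiffM di dV).
Qed.

Let half_sum (a b c : R) : a < 1 -> b <= 1 -> c <= (a + b) / 2 -> c <= 1.
Proof. lra. Qed.

(** The unit disc of the complex line spanned by the unit vector [v0] lies in the ball, and
    [disc_schwarz] applies to [G] along it. *)
Lemma ball_schwarz (G : D -> C) v0 (l : C) : holomorphic G -> G (base R n) = 0 ->
  (forall w, normc (G w) <= 1) -> sqnorm v0 = 1 -> normc l < 1 ->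
  normc (G (toD (icay (l *: v0)))) <= normc l.
Proof.
move=> hG G0 G1 v01 l1.
have lb (k : C) : normc k < 1 -> sqnorm (k *: v0) < 1.
  by move=> k1; rewrite sqnormZ v01 mulr1 expr_lt1// normc_ge0.
pose h (k : C) := G (toD (icay (k *: v0))).
have dh k : normc k < 1 -> differentiable h k.
  move=> k1; have sk := icay_siegel (lb _ k1).
  have k10 : 0 < 1 - normc k by rewrite subr_gt0.
  apply: (@near_cdiff _ _ (ext G \o (fun k => icay (k *: v0))) _ (1 - normc k) k10).
    move=> k' k'k; rewrite /h /= ext_toD//; apply: icay_siegel; apply: lb.
    by have := lerB_normc k' k; lra.
  apply: differentiable_comp; first by apply: diff_icay_line; exact: lb.
  by rewrite -[X in differentiable _ X](toDK sk); exact: hG.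
have hb k : normc k < 1 -> normc (h k) <= 1 by move=> _; exact: G1.
have h0 : h 0 = 0 by rewrite /h scale0r icay0 toD_val.
by have := disc_schwarz dh hb h0 l1; rewrite mul1r.
Qed.

(** A vector-valued Schwarz lemma reduces to the scalar one by pairing the image with a fixed unit
    vector, chosen in the direction of the image of the given point. The cases where one of the two
    vectors is 0 are settled beforehand, as they cannot be normalised. *)
Lemma siegel_schwarz (f : D -> D) w : holomorphic (Defs.incl f) -> f (base R n) = base R n ->
  sqnorm (cay (\val (f w))) <= sqnorm (cay (\val w)).
Proof.
move=> hf f0.
have [v Ev] : exists v, v = cay (\val w) by eexists.
have [b Eb] : exists b, b = cay (\val (f w)) by eexists.
rewrite -Ev -Eb.
have v1 : sqnorm v < 1 by rewrite Ev; apply: cay_ball; exact: valD.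
have iv : toD (icay v) = w.
  by rewrite Ev cayK ?toD_val//; apply: cay_den; exact: valD.
have [sv0|sv0] := eqVneq (sqnorm v) 0.
  have wb : w = base R n by rewrite -iv (sqnorm_eq0 sv0) icay0 toD_val.
  have : b = v by rewrite Eb Ev wb f0.
  by move=> ->.
have [sb0|sb0] := eqVneq (sqnorm b) 0; first by rewrite sb0 sqnorm_ge0.
have root (x : 'rV[C]_n.+1) : sqnorm x != 0 -> exists2 N : R, 0 < N & N ^+ 2 = sqnorm x.
  move=> x0; exists (Num.sqrt (sqnorm x)); last by rewrite sqr_sqrtr ?sqnorm_ge0.
  by rewrite sqrtr_gt0 lt_def x0 sqnorm_ge0.
have [N N0 N2] := root _ sv0; have [m m0 m2] := root _ sb0.
have nr (r : R) : 0 < r -> normc (r%:C : C) = r by move=> r0; rewrite normc_real gtr0_norm.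
have rn0 (r : R) : 0 < r -> r%:C != 0 :> C by move=> r0; rewrite -normc_eq0 nr// gt_eqF.
have unit (r : R) x : 0 < r -> r ^+ 2 = sqnorm x -> sqnorm ((r%:C)^-1 *: x) = 1.
  by move=> r0 rx; rewrite sqnormZ normcV nr// -rx -exprMn mulVf ?expr1n// gt_eqF.
pose G w := herm (cay (\val (f w))) ((m%:C)^-1 *: b).
have hG : holomorphic G.
  apply: (@hol_comp R n (fun w => herm (cay (\val w)) ((m%:C)^-1 *: b)) f) => //.
  by apply: hol_herm; exact: hol_cay.
have G1 w1 : normc (G w1) <= 1.
  apply: half_sum (normc_herm _ _); first by apply: cay_ball; exact: valD.
  by rewrite unit.
have G0 : G (base R n) = 0 by rewrite /G f0 cay_base herm0l.
have N1 : normc (N%:C : C) < 1.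
  by rewrite nr// -(@ltr_pXn2r _ 2)// ?nnegrE ?(ltW N0)// N2 expr1n.
have := ball_schwarz hG G0 G1 (unit _ _ N0 N2) N1.
rewrite scalerA divff ?rn0// scale1r iv.
have -> : G w = m%:C.
  rewrite /G -Eb hermZr hermE -m2 conjcV conj_real rcX expr2 mulrA mulVf ?mul1r//.
  exact: rn0.
rewrite !nr// => mN.
by rewrite -m2 -N2 ler_pXn2r// nnegrE ltW.
Qed.

Lemma isotropy_isometry (f : biholo R n) w w' : f (base R n) = base R n ->
  herm (cay (\val (f w))) (cay (\val (f w'))) = herm (cay (\val w)) (cay (\val w')).
Proof.
move=> f0.
have f0' : biholo_inv f (base R n) = base R n by rewrite -{1}f0 biholo_funK.
have hol1 := biholo_hol f; have hol2 := biholo_inv_hol f.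
apply/eqP; rewrite -subr_eq0; apply/eqP; move: w w'.
apply: (@diagonal_determines R n (fun w w' => herm (cay (\val (f w))) (cay (\val (f w'))) - herm (cay (\val w)) (cay (\val w')))).
- move=> w'; apply: holB; last by apply: hol_herm; exact: hol_cay.
  apply: (@hol_comp R n (fun w => herm (cay (\val w)) _) f) => //.
  by apply: hol_herm; exact: hol_cay.
- by move=> w w'; rewrite conjcB -!hermC.
- move=> w; rewrite !hermE; apply/eqP; rewrite subr_eq0; apply/eqP; congr (_%:C).
  apply/eqP; rewrite eq_le siegel_schwarz//=.
  by have := siegel_schwarz (f w) hol2 f0'; rewrite biholo_funK.
move=> a b sa; exists 2, 1; split => // s t _ _ _ _.
apply: le_trans (ler_normcB _ _) _.
have cb (w1 w2 : D) : normc (herm (cay (\val w1)) (cay (\val w2))) <= 1.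
  by apply: half_sum (normc_herm _ _); [|apply: ltW]; apply: cay_ball; exact: valD.
by rewrite -[2]/(1 + 1); apply: lerD; exact: cb.
Qed.

(** The analogue of [cjac] for maps with values outside the domain, such as the Cayley transform. *)
Definition jdet (F : D -> 'rV[C]_n.+1) w : C := \det (jacobian (ext F) (\val w)).

Lemma jdet_comp (F : D -> 'rV[C]_n.+1) (f : D -> D) w : holomorphic F -> holomorphic (Defs.incl f) ->
  jdet (F \o f) w = cjac f w * jdet F (f w).
Proof. by move=> hF hf; rewrite /jdet (@jacobian_comp R n n F f w hF hf) det_mulmx. Qed.

(** Differentiating in [w], then in [w'] through hermitian symmetry, shows that the partial
    derivatives of [F] and of [G] have the same Gram matrix; each side is the determinant of that
    matrix. *)
Lemma gram_det (F G : D -> 'rV[C]_n.+1) : holomorphic F -> holomorphic G ->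
  (forall w w', herm (F w) (F w') = herm (G w) (G w')) ->
  forall w w', jdet F w * (jdet F w')^* = jdet G w * (jdet G w')^*.
Proof.
move=> hF hG FG.
have s3 c c' w v : (forall w1, herm (F w1) c = herm (G w1) c') ->
    herm ('D_v (ext F) (\val w)) c = herm ('D_v (ext G) (\val w)) c'.
  move=> /funext E.
  by rewrite -[LHS](derive_hermz c w v hF) -[RHS](derive_hermz c' w v hG) E.
have s1 w w' v : herm ('D_v (ext F) (\val w)) (F w') = herm ('D_v (ext G) (\val w)) (G w').
  by apply: s3 => w1; exact: FG.
have s2 w w' v v' : herm ('D_v' (ext F) (\val w')) ('D_v (ext F) (\val w)) =
    herm ('D_v' (ext G) (\val w')) ('D_v (ext G) (\val w)).
  by apply: s3 => w1; rewrite [LHS]hermC s1 -hermC.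
have dE (A B : 'M[C]_n.+1) : \det A * (\det B)^* = \det (A *m map_mx (@Num.conj C) B^T).
  by rewrite det_mulmx det_map_mx det_tr.
move=> w w'.
have step (A B A' B' : 'M[C]_n.+1) : A *m map_mx (@Num.conj C) B^T = A' *m map_mx (@Num.conj C) B'^T ->
    \det A * (\det B)^* = \det A' * (\det B')^*.
  by move=> E; rewrite [LHS]dE E -dE.
apply: step.
have mE (A B : 'M[C]_n.+1) i j : (A *m map_mx (@Num.conj C) B^T) i j = herm (row i A) (row j B).
  by rewrite mxE; apply: eq_bigr => k _; rewrite !mxE.
apply/matrixP => i j.
apply: (etrans (mE _ _ _ _)); apply: (esym (etrans (mE _ _ _ _) _)).
apply: (etrans (congr2 (@herm R _) (jacobian_row w i hG) (jacobian_row w' j hG))).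
apply: (esym (etrans (congr2 (@herm R _) (jacobian_row w i hF) (jacobian_row w' j hF)) _)).
exact: s2.
Qed.

Lemma jdet_cay w : jdet (fun w => cay (\val w)) w =
  (2 / (zcoord (\val w) + 'i%C)) ^+ n * (2 * 'i%C / (zcoord (\val w) + 'i%C) ^+ 2).
Proof.
set r := zcoord (\val w) + 'i%C.
have r0 : r != 0 by apply: cay_den; exact: valD.
pose A := pt (2 *: zeta (\val w)) (zcoord (\val w) - 'i%C) : 'rV[C]_n.+1.
(* The differential of [cay] at [w] by the quotient rule. The exact increment carries the additional
   factor [r / (r + zcoord v * h)], which tends to 1. *)
pose L v : 'rV[C]_n.+1 := (r ^+ 2)^-1 *: (r *: pt (2 *: zeta v) (zcoord v) - zcoord v *: A).
rewrite /jdet (@jacobian_lim R n n _ w L); last 2 first.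
- exact: hol_cay.
- move=> v; exists (fun h => r * (r + zcoord v * h)^-1); split.
    apply: cdiff_cont; apply: cdiffM; first exact: cdiff_cst.
    by apply: cdiffV; [exact: cdiff_affine | rewrite mulr0 addr0].
  split; first by rewrite mulr0 addr0 divff.
  move=> h h0 sh; rewrite toDK//.
  have dh := cay_den sh.
  have E : zcoord (h *: v + \val w) + 'i%C = r + zcoord v * h.
    by rewrite zcoordD zcoordZ /r; ring.
  rewrite /cay -/r -/A E in dh *.
  have -> : pt (2 *: zeta (h *: v + \val w)) (zcoord (h *: v + \val w) - 'i%C) = A + h *: pt (2 *: zeta v) (zcoord v).
    apply: pt_eq; rewrite ?(zetaD, zcoordD, zetaZ, zcoordZ, zeta_pt, zcoord_pt).
      by rewrite scalerDr !scalerA mulrC addrC.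
    by ring.
  rewrite /L scalerDr scalerBr scalerBr !scalerA addrAC -scalerBl addrC; congr (_ + _).
    by congr (_ *: _); field; rewrite dh r0.
  by rewrite -scaleNr; congr (_ *: _); field; rewrite dh r0.
have Lm : zeta (delta_mx ord0 ord_max : 'rV[C]_n.+1) = 0.
  by apply/rowP => i; rewrite !mxE /= eq_sym (negbTE (neq_lift _ _)).
have zm : zcoord (delta_mx ord0 ord_max : 'rV[C]_n.+1) = 1 by rewrite /zcoord mxE !eqxx.
have zl a : zcoord (delta_mx ord0 (lift ord_max a) : 'rV[C]_n.+1) = 0.
  by rewrite /zcoord mxE /= (negbTE (neq_lift _ _)).
rewrite -det_tr (@det_arrow R n _ (2 / r)).
- congr (_ * _); rewrite !mxE -/(zcoord _) /L zm -/(zcoord _).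
  rewrite !unlift_none mul1r /r; field.
  by rewrite -/r r0.
- move=> a b; rewrite !mxE zl liftK !mxE eqxx /= mul0r subr0 (inj_eq lift_inj).
  case: eqP => _; last by rewrite !mulr0.
  by field.
- by move=> b; rewrite !mxE zl unlift_none mul0r mulr0 subr0 mulr0.
Qed.

Definition kap_covariant (f : D -> D) := forall w w',
  kap (\val (f w)) (\val (f w')) ^+ n.+2 =
  kap (\val w) (\val w') ^+ n.+2 * (cjac f w * (cjac f w')^*).

#[local] Opaque jdet cjac.

(** By [cay_herm] the isometry multiplies [kap] by a quotient of the factors [zcoord + i]. By
    [gram_det] the Jacobians produce the power [n + 2] of the same quotient, because the Jacobian of
    [cay] is a constant times the power [-(n + 2)] of this factor. *)
Lemma covariant_isotropy (f : biholo R n) : f (base R n) = base R n -> kap_covariant f.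
Proof.
move=> f0 w w'.
have iso := isotropy_isometry _ _ f0.
have hf := biholo_hol f.
pose F w := cay (\val w).
have hF : holomorphic F by exact: hol_cay.
have hFf : holomorphic (F \o f).
  by apply: hol_vec => j; apply: (@hol_comp R n (fun w => F w ord0 j) f) => //; exact: hol_vecE.
have := @gram_det (F \o f) F hFf hF iso w w'.
rewrite !jdet_comp// /F !jdet_cay.
have := iso w w'.
set zf := zcoord (\val (f w)) + 'i%C; set zf' := zcoord (\val (f w')) + 'i%C.
set z := zcoord (\val w) + 'i%C; set z' := zcoord (\val w') + 'i%C.
have dn w1 := cay_den (valD w1).
have z0 : z != 0 by exact: dn.
have z'0 : z'^* != 0 by rewrite conjC_eq0; exact: dn.
have zf0 : zf != 0 by exact: dn.
have zf'0 : zf'^* != 0 by rewrite conjC_eq0; exact: dn.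
move=> /(congr1 (fun t => 1 - t)); rewrite !cay_herm ?dn// -/zf -/zf' -/z -/z' => E1.
rewrite !(rmorphM, rmorphXn, fmorphV) /= conj_nat conj_i => E2.
have n4 : 4 != 0 :> C by rewrite pnatr_eq0.
have E1' : kap (\val (f w)) (\val (f w')) = kap (\val w) (\val w') * ((zf * zf'^*) / (z * z'^*)).
  apply: (mulfI n4); rewrite -[LHS](divfK (mulf_neq0 zf0 zf'0)) E1.
  by field; rewrite z0 z'0.
rewrite E1' exprMn; congr (_ * _).
move: E2; set J := cjac f w; set J' := (cjac f w')^* => E2.
have c0 : 4 ^+ n * 4 != 0 :> C by rewrite mulf_neq0// expf_neq0.
have E3 : J * J' * (4 ^+ n * 4 / (zf * zf'^*) ^+ n.+2) = 4 ^+ n * 4 / (z * z'^*) ^+ n.+2.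
  have e4 (a b : C) : (2 / a) ^+ n * (2 * 'i%C / a ^+ 2) * ((2 / b) ^+ n * (2 * - 'i%C / b ^+ 2)) = 4 ^+ n * 4 / (a * b) ^+ n.+2.
    have -> : (4 : C) = 2 * 2 by rewrite -natrM.
    have -> : (2 / a) ^+ n * (2 * 'i%C / a ^+ 2) * ((2 / b) ^+ n * (2 * - 'i%C / b ^+ 2)) =
      ((2 / a) * (2 / b)) ^+ n * ((2 / a) * (2 / b) / (a * b)) * - ('i%C * 'i%C).
      rewrite [in RHS]exprMn !expr2 !invfM.
      move: ((2 / a) ^+ n) ((2 / b) ^+ n) (a^-1) (b^-1) => p q a' b'; ring.
    have -> : 2 / a * (2 / b) = 2 * 2 / (a * b) by rewrite invfM; ring.
    rewrite i2 opprK mulr1; move: (a * b) => c.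
    rewrite [(2 * 2 / _) ^+ n]exprMn exprVn !exprS !invfM.
    move: ((2 * 2) ^+ n) (c ^+ n)^-1 c^-1 => p q c'; ring.
  rewrite -!e4 -E2; ring.
have zz0 : (z * z'^*) ^+ n.+2 != 0 by rewrite expf_neq0// mulf_neq0.
have zf00 : (zf * zf'^*) ^+ n.+2 != 0 by rewrite expf_neq0// mulf_neq0.
rewrite expr_div_n.
apply: (mulIf zz0); rewrite divfK//.
apply: (mulfI c0).
have := congr1 (fun t => t * ((zf * zf'^*) ^+ n.+2 * (z * z'^*) ^+ n.+2)) E3.
move: ((zf * zf'^*) ^+ n.+2) ((z * z'^*) ^+ n.+2) zf00 zz0 (4 ^+ n * 4) => a b a0 b0 c.
have -> : J * J' * (c / a) * (a * b) = c * (J * J' * b) by field.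
by have -> : c / b * (a * b) = c * a by field.
Qed.

Lemma covariant_gt r (r0 : 0 < r) u t : kap_covariant (@gt R n r r0 u t).
Proof.
move=> w w'; rewrite !cjac_gfun// !val_gfun// kap_gmap exprMn mulrC; congr (_ * _).
by rewrite rmorphXn /= conj_real -exprMn -expr2.
Qed.

Lemma covariant_comp (f g : D -> D) : holomorphic (Defs.incl f) -> holomorphic (Defs.incl g) ->
  kap_covariant f -> kap_covariant g -> kap_covariant (f \o g).
Proof.
have alg (a b c d e : C) : a * (b * c) * (d * e) = a * (b * d * (c * e)).
  by rewrite -mulrA; congr (a * _); rewrite mulrACA.
move=> hf hg cf cg w w'; rewrite (cjac_comp w hf hg) (cjac_comp w' hf hg).
rewrite -[kap _ _]/(kap (\val (f (g w))) (\val (f (g w')))) (cf (g w) (g w')) (cg w w') conjcM.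
exact: alg.
Qed.

Theorem kap_biholo (f : biholo R n) : kap_covariant f.
Proof.
have [r [u [t [r0 h]]]] := transitive_base (f (base R n)).
pose g := gt r0 u t; pose f0 := biholoM (biholoV g) f.
have f00 : f0 (base R n) = base R n by rewrite -[f0 _]/(biholo_inv g (f (base R n))) -h biholo_funK.
have -> : f = biholoM g f0 :> biholo R n by apply: biholoP => w; rewrite -[RHS]/(g (biholo_inv g (f w))) biholo_invK.
apply: covariant_comp.
- exact: biholo_hol.
- exact: (biholo_hol f0).
- exact: covariant_gt.
- exact: (covariant_isotropy f00).
Qed.

End Cayley.

(** * Positive forms and orthogonal projection *)

Section PositiveForm.
Context {R : realType} {V : lmodType R[i]}.
Local Notation C := R[i].
Implicit Types (x y z : V).

Definition pos_form (B : V -> V -> C) :=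
  [/\ forall (a : C) x y z, B (a *: x + y) z = a * B x z + B y z,
      forall x y, B y x = (B x y)^* & forall x, 0 <= complex.Re (B x x)].

Definition fnorm (B : V -> V -> C) x : R := Num.sqrt (complex.Re (B x x)).

Variable B : V -> V -> C.
Hypothesis BP : pos_form B.

Lemma formC x y : B y x = (B x y)^*. Proof. by case: BP. Qed.
Lemma form0l z : B 0 z = 0.
Proof. by case: BP => L _ _; have := L (-1) 0 0 z; rewrite scaler0 addr0 mulN1r addNr. Qed.
Lemma formZl (a : C) x z : B (a *: x) z = a * B x z.
Proof. by case: BP => L _ _; have := L a x 0 z; rewrite addr0 form0l addr0. Qed.
Lemma formDl x y z : B (x + y) z = B x z + B y z.
Proof. by case: BP => L _ _; have := L 1 x y z; rewrite scale1r mul1r. Qed.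
Lemma formNl x z : B (- x) z = - B x z.
Proof. by rewrite -scaleN1r formZl mulN1r. Qed.
Lemma formBl x y z : B (x - y) z = B x z - B y z.
Proof. by rewrite formDl formNl. Qed.
Lemma formZr (a : C) x z : B z (a *: x) = a^* * B z x.
Proof. by rewrite formC formZl rmorphM /= -formC. Qed.
Lemma formDr x y z : B z (x + y) = B z x + B z y.
Proof. by rewrite formC formDl rmorphD /= -!formC. Qed.
Lemma formNr x z : B z (- x) = - B z x.
Proof. by rewrite formC formNl rmorphN /= -formC. Qed.
Lemma formBr x y z : B z (x - y) = B z x - B z y.
Proof. by rewrite formDr formNr. Qed.
Lemma form0r z : B z 0 = 0.
Proof. by rewrite formC form0l rmorph0. Qed.

Lemma fnorm_ge0 x : 0 <= fnorm B x. Proof. exact: sqrtr_ge0. Qed.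

Lemma fnorm_sqr x : fnorm B x ^+ 2 = complex.Re (B x x).
Proof. by rewrite sqr_sqrtr//; case: BP. Qed.

Lemma form_diag x : B x x = (fnorm B x ^+ 2)%:C.
Proof.
rewrite fnorm_sqr; have := formC x x; case: (B x x) => a b; rewrite conjcE => -[h].
by apply: ceq => //=; lra.
Qed.

Lemma fnorm_sqrD x y : fnorm B (x + y) ^+ 2 = fnorm B x ^+ 2 + fnorm B y ^+ 2 + 2 * complex.Re (B x y).
Proof.
rewrite !fnorm_sqr formDl !formDr (formC x y).
by case: (B x x) (B x y) (B y y) => a b [c d] [e f]; rewrite conjcE /=; ring.
Qed.

Lemma fnormZ (a : C) x : fnorm B (a *: x) = normc a * fnorm B x.
Proof.
apply/eqP; rewrite -(@eqrXn2 _ 2)// ?mulr_ge0 ?fnorm_ge0 ?normc_ge0// exprMn !fnorm_sqr.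
by rewrite formZl formZr mulrA mul_conjc form_diag -rcM.
Qed.

Lemma fnormN x : fnorm B (- x) = fnorm B x.
Proof. by rewrite /fnorm formNl formNr opprK. Qed.

Lemma fnormBC x y : fnorm B (x - y) = fnorm B (y - x).
Proof. by rewrite -fnormN opprB. Qed.

Lemma parallelogram x y :
  fnorm B (x - y) ^+ 2 = 2 * fnorm B x ^+ 2 + 2 * fnorm B y ^+ 2 - fnorm B (x + y) ^+ 2.
Proof. by rewrite !fnorm_sqrD fnormN formNr; case: (B x y) => a b /=; ring. Qed.

(** Cauchy-Schwarz for a form that may be degenerate: the square of the seminorm of
    [x - s * B x y *: y] is a nonnegative polynomial in the real number [s]. *)
Lemma form_bound x y : normc (B x y) <= fnorm B x * fnorm B y.
Proof.
rewrite -(@ler_pXn2r _ 2)// ?nnegrE ?mulr_ge0 ?fnorm_ge0 ?normc_ge0// exprMn.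
have [c0|c0] := eqVneq (B x y) 0.
  by rewrite c0 normc0 expr0n /= mulr_ge0 ?sqr_ge0.
have q (s : R) : 0 <= fnorm B x ^+ 2 - 2 * s * normc (B x y) ^+ 2 + s ^+ 2 * normc (B x y) ^+ 2 * fnorm B y ^+ 2.
  have := sqr_ge0 (fnorm B (x + (- s%:C * B x y) *: y)); rewrite fnorm_sqrD fnormZ formZr.
  rewrite conjcM -rcN conj_real -mulrA [_^* * _]mulrC mul_conjc -rcM [complex.Re _]/=.
  rewrite normcM normc_real normrN !exprMn real_normK ?num_real//; congr (0 <= _); ring.
have k0 : 0 < normc (B x y) ^+ 2 by rewrite exprn_gt0// normc_gt0.
move: (normc (B x y) ^+ 2) k0 q => k k0; move: (sqr_ge0 (fnorm B x)) (sqr_ge0 (fnorm B y)).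
move: (fnorm B x ^+ 2) (fnorm B y ^+ 2) => a b a0; rewrite le_eqVlt => /predU1P[<-|b0] q.
  (* When [y] has seminorm 0 the polynomial is affine in [s], and at this point it would be
     [- a - 2], which is negative. *)
  have := q ((a + 1) / k).
  by rewrite mulr0 addr0 -!mulrA [k^-1 * k]mulVf ?gt_eqF//; lra.
have := q b^-1.
have -> : a - 2 * b^-1 * k + b^-1 ^+ 2 * k * b = (a * b - k) / b by field; rewrite gt_eqF.
by rewrite pmulr_lge0 ?invr_gt0// subr_ge0.
Qed.

Lemma ler_fnormD x y : fnorm B (x + y) <= fnorm B x + fnorm B y.
Proof.
rewrite -(@ler_pXn2r _ 2)// ?nnegrE ?addr_ge0 ?fnorm_ge0// fnorm_sqrD.
have := le_trans (Re_le_normc (B x y)) (form_bound x y).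
have := ler_norm (complex.Re (B x y)).
by move: (fnorm B x) (fnorm B y) (complex.Re _) => a b c; rewrite sqrrD -mulr_natl; nra.
Qed.

Lemma ler_fnormB x y z : fnorm B (x - z) <= fnorm B (x - y) + fnorm B (y - z).
Proof. by have := ler_fnormD (x - y) (y - z); rewrite addrA subrK. Qed.

End PositiveForm.

(** * Orthogonal projection and the Riesz representation *)

Section Hilbert.
Context {R : realType} {V : lmodType R[i]}.
Local Notation C := R[i].
Implicit Types (x y z h : V).
Variable B : V -> V -> C.
Hypothesis BP : pos_form B.
Local Notation nrm := (fnorm B).
Hypothesis nrm_eq0 : forall x, nrm x = 0 -> x = 0.
Hypothesis complete : forall u : nat -> V,
  (forall e : R, 0 < e -> exists N : nat, forall m k : nat, (N <= m)%N -> (N <= k)%N -> nrm (u m - u k) < e) ->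
  exists l, forall e : R, 0 < e -> exists N : nat, forall m : nat, (N <= m)%N -> nrm (u m - l) < e.

Definition subspace (M : V -> Prop) := M 0 /\ forall (a : C) x y, M x -> M y -> M (a *: x + y).
Definition nclosed (M : V -> Prop) :=
  forall h, (forall e : R, 0 < e -> exists2 m, M m & nrm (h - m) < e) -> M h.

(** By the parallelogram identity a minimising sequence is Cauchy, and the residual at its limit is
    orthogonal to [M] by minimality. *)
Lemma projection (M : V -> Prop) h : subspace M -> nclosed M ->
  exists2 m, M m & forall x, M x -> B (h - m) x = 0.
Proof.
move=> [M0 ML] Mc.
pose S := [set nrm (h - m) | m in M].
have S0 : has_inf S.
  split; first by exists (nrm (h - 0)); exists 0.
  by exists 0 => _ [m _ <-]; exact: fnorm_ge0.
pose d := inf S.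
have d_le m : M m -> d <= nrm (h - m) by move=> Mm; apply: ge_inf; [case: S0|exists m].
have d0 : 0 <= d by apply: lb_le_inf; [case: S0|move=> _ [m _ <-]; exact: fnorm_ge0].
have near_d (k : nat) : exists m, M m /\ nrm (h - m) < d + k.+1%:R^-1.
  have k0 : (0 : R) < k.+1%:R^-1 by rewrite invr_gt0.
  by have [_ [m Mm <-] lt] := inf_adherent k0 S0; exists m.
have [u uP] := choice near_d.
have mid x y : M x -> M y -> 4 * d ^+ 2 <= nrm ((h - x) + (h - y)) ^+ 2.
  move=> Mx My.
  have Mz : M (2^-1 *: x + 2^-1 *: y).
    by apply: (ML) => //; rewrite -[_ *: y]addr0; exact: ML.
  have -> : h - x + (h - y) = 2 *: (h - (2^-1 *: x + 2^-1 *: y)).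
    have two0 : (2 : C) != 0 by rewrite pnatr_eq0.
    rewrite scalerBr scalerDr !scalerA mulfV// !scale1r opprD.
    by rewrite addrACA scaler_nat mulr2n.
  have n2 : normc (2 : C) = 2 by rewrite -(rc_nat 2) normc_real normr_nat.
  rewrite fnormZ// exprMn n2; have := d_le _ Mz; move: (nrm _) => t dt.
  have -> : (4 : R) = 2 ^+ 2 by rewrite -natrX.
  by rewrite ler_pM2l ?exprn_gt0// ler_pXn2r ?nnegrE// (le_trans d0).
have cau e : 0 < e -> exists N : nat, forall m k : nat, (N <= m)%N -> (N <= k)%N -> nrm (u m - u k) < e.
  move=> e0.
  (* A distance [t < d + c] with also [t < d + 1] satisfies [t ^+ 2 <= d ^+ 2 + c * (2 * d + 1)];
     the parallelogram identity then gives at most [c * (8 * d + 4)], less than [e ^+ 2]. *)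
  pose c := e ^+ 2 / (8 * d + 8).
  have den0 : 0 < 8 * d + 8 by lra.
  have c0 : 0 < c by rewrite divr_gt0 ?exprn_gt0.
  have ec : e ^+ 2 = c * (8 * d + 8) by rewrite /c divfK// gt_eqF.
  clearbody c.
  have c1 : 0 < Num.min c 1 by rewrite lt_min c0 /=.
  have [N _ NP] := near_infty_natSinv_lt (PosNum c1).
  have small k : (N <= k)%N -> nrm (h - u k) < d + c /\ nrm (h - u k) < d + 1.
    move=> Nk; have := NP k Nk; rewrite /= lt_min => /andP[h1 h2].
    by have [_ h3] := uP k; split; apply: lt_trans h3 _; rewrite ltrD2l.
  exists N => m k Nm Nk.
  rewrite -(@ltr_pXn2r _ 2)// ?nnegrE ?fnorm_ge0 ?(ltW e0)//.
  have -> : u m - u k = (h - u k) - (h - u m) by rewrite opprB [RHS]addrC addrA subrK.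
  have [Mm _] := uP m; have [Mk _] := uP k.
  rewrite parallelogram//; have := mid _ _ Mk Mm.
  have [a1 a2] := small _ Nm; have [b1 b2] := small _ Nk.
  rewrite ec; have := fnorm_ge0 B (h - u k); have := fnorm_ge0 B (h - u m).
  have sq (t : R) : 0 <= t -> t < d + c -> t < d + 1 -> t ^+ 2 <= d ^+ 2 + c * (2 * d + 1).
    move=> t0 t1 t2; have [td|/ltW td] := lerP t d.
      rewrite (@le_trans _ _ (d ^+ 2)) ?lerDl ?mulr_ge0 ?(ltW c0) ?addr_ge0 ?mulr_ge0//.
      by rewrite ler_pXn2r// nnegrE.
    have : 0 <= (c - (t - d)) * (2 * d + 1) by rewrite mulr_ge0//; lra.
    have : 0 <= (t - d) * (1 - (t - d)) by rewrite mulr_ge0//; lra.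
    by nra.
  move=> n1 n2; have := sq _ n1 a1 a2; have := sq _ n2 b1 b2.
  have cd : 0 <= c * d by rewrite mulr_ge0// ltW.
  move: (nrm (h - u k + _) ^+ 2) (nrm (h - u k) ^+ 2) (nrm (h - u m) ^+ 2) => A1 A2 A3.
  by move: (d ^+ 2) => D; clear -c0; nra.
have [m mP] := complete cau.
have Mm : M m.
  apply: Mc => e e0; have [N NP] := mP e e0; exists (u N); first by case: (uP N).
  by rewrite fnormBC// NP.
have md : nrm (h - m) <= d.
  apply/ler_addgt0Pr => e e0.
  have e20 : 0 < e / 2 by rewrite divr_gt0.
  have [N NP] := mP _ e20; have [N' _ NP'] := near_infty_natSinv_lt (PosNum e20).
  have h1 := NP (maxn N N') (leq_maxl _ _).
  have h2 := NP' (maxn N N') (leq_maxr _ _).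
  have [_ h3] := uP (maxn N N').
  apply: le_trans (ler_fnormB BP h (u (maxn N N')) m) _; apply: ltW.
  rewrite [e]splitr addrA; apply: ltrD => //; apply: lt_trans h3 _.
  by rewrite ltrD2l; exact: h2.
exists m => // x Mx.
have [x0|x0] := eqVneq (nrm x) 0; first by rewrite (nrm_eq0 x0) form0r.
have q (a : C) : nrm (h - m) ^+ 2 <= nrm ((h - m) + a *: x) ^+ 2.
  rewrite ler_pXn2r ?nnegrE ?fnorm_ge0//; apply: le_trans md _.
  have -> : h - m + a *: x = h - (- a *: x + m) by rewrite opprD scaleNr opprK addrAC addrA.
  by apply: d_le; exact: ML.
have N0 : 0 < nrm x ^+ 2 by rewrite exprn_gt0// lt_def x0 fnorm_ge0.
(* The coefficient that minimises the distance along [x]: it lowers the square by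
   [normc b ^+ 2 / N], which must therefore be 0. *)
have := q (- B (h - m) x / (nrm x ^+ 2)%:C).
set b := B (h - m) x.
have [N EN] : exists N, nrm x ^+ 2 = N by eexists.
rewrite EN in N0 *.
rewrite [X in _ <= X]fnorm_sqrD// fnormZ// formZr// -/b exprMn EN.
have -> : (- b / N%:C)^* * b = (- (normc b ^+ 2 / N))%:C.
  by rewrite rcN rcM rcV -mul_conjc conjcM conjcN conjcV conj_real !mulNr mulrAC [b * _]mulrC.
rewrite [complex.Re _]/=.
rewrite normcM normcN normcV normc_real gtr0_norm// exprMn -addrA lerDl exprVn.
have -> : normc b ^+ 2 * (N ^+ 2)^-1 * N + 2 * - (normc b ^+ 2 / N) = - (normc b ^+ 2 / N).
  by field; rewrite gt_eqF.
rewrite oppr_ge0 pmulr_lle0 ?invr_gt0// => b0.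
by apply/eqP; rewrite -normc_eq0 -sqrf_eq0 eq_le b0 sqr_ge0.
Qed.

Lemma orthogonal_full (M : V -> Prop) : subspace M -> nclosed M ->
  (forall v, (forall m, M m -> B v m = 0) -> v = 0) -> forall h, M h.
Proof.
move=> Ms Mc M0 h; have [m Mm mP] := projection h Ms Mc.
by have /eqP := M0 _ mP; rewrite subr_eq0 => /eqP ->.
Qed.

Lemma riesz (phi : V -> C) (K : R) : (forall (a : C) x y, phi (a *: x + y) = a * phi x + phi y) ->
  (forall h, normc (phi h) <= K * nrm h) -> exists k, forall h, phi h = B h k.
Proof.
move=> phiL phiK.
have phi0 : phi 0 = 0 by have := phiL (-1) 0 0; rewrite scaler0 addr0 mulN1r addNr.
have phiB x y : phi (x - y) = phi x - phi y.
  by rewrite addrC -scaleN1r phiL mulN1r addrC.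
have [phi00|/existsNP[h /eqP h0]] := pselect (forall h, phi h = 0).
  by exists 0 => h; rewrite form0r.
have Ms : subspace (fun x => phi x = 0).
  by split => // a x y hx hy; rewrite phiL hx hy mulr0 addr0.
have Mc : nclosed (fun x => phi x = 0).
  move=> x hx; apply/eqP; rewrite -normc_eq0 eq_le normc_ge0 andbT.
  apply/ler_addgt0Pr => e e0; rewrite add0r.
  have K0 : 0 < `|K| + 1 by rewrite ltr_wpDl.
  have [m m0 mx] := hx (e / (`|K| + 1)) (divr_gt0 e0 K0).
  have := phiK (x - m); rewrite phiB m0 subr0 => h1; apply: le_trans h1 _.
  have := fnorm_ge0 B (x - m) => n0.
  apply: (@le_trans _ _ ((`|K| + 1) * nrm (x - m))).
    by rewrite ler_wpM2r// (le_trans (ler_norm K))// lerDl.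
  by rewrite mulrC -ler_pdivlMr// ltW.
have [m m0 mP] := projection h Ms Mc.
pose v := h - m.
have v0 : phi v != 0 by rewrite /v phiB m0 subr0.
have N0 : B v v != 0.
  rewrite form_diag//; apply: contra v0 => /eqP/(congr1 (@complex.Re R)) /= /eqP.
  by rewrite sqrf_eq0 => /eqP /nrm_eq0 ->; rewrite phi0.
exists ((phi v / B v v)^* *: v) => x.
rewrite formZr// conjCK.
have := mP (x - (phi x / phi v) *: v).
have -> : phi (x - (phi x / phi v) *: v) = 0.
  by rewrite addrC -scaleNr phiL mulNr divfK// addNr.
move=> /(_ erefl); rewrite -/v => /(congr1 (@Num.conj C)); rewrite -formC// rmorph0 formBl// formZl// => /eqP.
rewrite subr_eq0 => /eqP ->.
by field; rewrite v0 N0.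
Qed.

End Hilbert.

(** * Equivalent Hilbert norms *)

Section HolHilbert.
Context {R : realType} {n : nat} (H : hol_hilbert R n).
Local Notation C := R[i].
Local Notation nrm := (fnorm (@hol_dot R n H)).

Lemma hol_dot_form : pos_form (@hol_dot R n H).
Proof.
split=> [a x y z|x y|x].
- by rewrite linearPl.
- by rewrite sesquilinear.hermC expr0 mul1r.
- by have := dnorm_ge0 (@hol_dot R n H) x; rewrite lecE => /andP[].
Qed.

Lemma hol_norm (h : H) : `|h| = (nrm h)%:C.
Proof.
apply/eqP; rewrite -(@eqrXn2 _ 2)//; last by rewrite lecR; exact: fnorm_ge0.
by rewrite hol_normE (form_diag hol_dot_form) rcX.
Qed.

Lemma hol_nrm_eq0 (h : H) : nrm h = 0 -> h = 0.
Proof. by move=> h0; apply/eqP; rewrite -normr_eq0 hol_norm h0. Qed.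

Lemma hol_complete (u : nat -> H) :
  (forall e : R, 0 < e -> exists N : nat, forall m k : nat, (N <= m)%N -> (N <= k)%N -> nrm (u m - u k) < e) ->
  exists l, forall e : R, 0 < e -> exists N : nat, forall m : nat, (N <= m)%N -> nrm (u m - l) < e.
Proof.
move=> cu.
have : cvg (u @ \oo).
  apply: cauchy_cvg; apply/cauchy_ballP => e e0.
  have re0 : 0 < complex.Re e by move: e0; rewrite ltcE => /andP[].
  have eE : e = (complex.Re e)%:C.
    by move: e0; case: (e) => a b; rewrite ltcE /= => /andP[/eqP -> _].
  have [N NP] := cu _ re0.
  exists ([set x | exists2 m, (N <= m)%N & u m = x], [set x | exists2 m, (N <= m)%N & u m = x]).
    by split; exists N => // m Nm; exists m.
  move=> [_ _] [[m Nm <-] [k Nk <-]] /=.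
  by rewrite -ball_normE /ball_ /= eE hol_norm ltcR; exact: NP.
move=> /cvg_ex[l /cvgrPdist_lt ul]; exists l => e e0.
have e0' : 0 < e%:C :> C by rewrite ltcR.
have [N _ NP] := ul _ e0'; exists N => m Nm.
by have := NP m Nm; rewrite /= hol_norm ltcR fnormBC//; exact: hol_dot_form.
Qed.

End HolHilbert.

Section Renorm.
Context {R : realType}.
Local Notation C := R[i].

(** Both comparison constants are kept: a Cauchy filter is carried to the original norm by [elow],
    and its limit is carried back by [eup]. *)
Record eqv_form (V : completeNormedModType C) := EqvForm {
  eform :> V -> V -> C;
  eform_pos : pos_form eform;
  elow : R; eup : R;
  elow_gt0 : 0 < elow;
  elow_le : forall x : V, `|x| <= elow%:C * (fnorm eform x)%:C;
  eup_gt0 : 0 < eup;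
  eup_le : forall x : V, (fnorm eform x)%:C <= eup%:C * `|x| }.

(** A type alias, so that the same vectors can bear a second normed structure. *)
Definition renorm (V : completeNormedModType C) (B : eqv_form V) : Type := V.

Section Instances.
Variables (V : completeNormedModType C) (B : eqv_form V).
Local Notation W := (renorm B).

HB.instance Definition _ := GRing.Lmodule.copy W V.

Let nrm (x : W) : C := (fnorm (eform B) x)%:C.

Let nrmD (x y : W) : nrm (x + y) <= nrm x + nrm y.
Proof. by rewrite /nrm -rcD lecR; apply: ler_fnormD; exact: eform_pos. Qed.

Let nrmZ (l : C) (x : W) : nrm (l *: x) = `|l| * nrm x.
Proof. by rewrite /nrm fnormZ ?rcM//; exact: eform_pos. Qed.

Let nrm_eq0 (x : W) : nrm x = 0 -> x = 0.
Proof.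
rewrite /nrm => h; apply/eqP; rewrite -[_ == _]/((x : V) == 0) -normr_le0.
by have := elow_le B x; rewrite h mulr0.
Qed.

HB.instance Definition _ := Lmodule_isNormed.Build C W nrmD nrmZ nrm_eq0.

Lemma renorm_normE (x : W) : `|x| = (fnorm (eform B) x)%:C.
Proof. by []. Qed.

Let renorm_complete (F : set_system W) : ProperFilter F -> cauchy F -> cvg F.
Proof.
move=> FF /cauchy_ballP cF.
have : cvg (F : set_system V).
  apply: (@cauchy_cvg V F FF); apply/cauchy_ballP => e e0.
  have l0 : 0 < (elow B)%:C :> C by rewrite ltcR elow_gt0.
  have [[P Q] PQ sub] := cF _ (divr_gt0 e0 l0).
  exists (P, Q) => // -[x y] /= /(sub (x, y)) /=.
  rewrite -!ball_normE /ball_ /= renorm_normE ltr_pdivlMr// mulrC.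
  exact: le_lt_trans (elow_le B (x - y)).
move=> /cvg_ex[l /cvgrPdist_lt Fl]; apply/cvg_ex; exists (l : W).
apply/(@cvgrPdist_lt C W) => e e0.
have u0 : 0 < (eup B)%:C :> C by rewrite ltcR eup_gt0.
have := Fl _ (divr_gt0 e0 u0); apply: filterS => x /=.
rewrite renorm_normE ltr_pdivlMr// mulrC; apply: le_lt_trans.
exact: (eup_le B (l - x)).
Qed.

HB.instance Definition _ := Uniform_isComplete.Build W renorm_complete.

Definition rdot (x y : W) : C := eform B x y.

Let rdot_bilinear : bilinear_for (GRing.Scale.Law.clone _ _ *%R _) (GRing.Scale.Law.clone _ _ (@Num.conj C \; *%R) _) rdot.
Proof.
have BP := eform_pos B.
split=> [z a x y|z a x y].
  by case: BP => L _ _; exact: L.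
by rewrite /rdot formDr// formZr.
Qed.

HB.instance Definition _ := bilinear_isBilinear.Build C W W C _ _ rdot rdot_bilinear.

Let rdot_herm (x y : W) : rdot x y = (-1) ^+ false * (rdot y x)^*.
Proof. by rewrite expr0 mul1r; exact: (formC (eform_pos B) y x). Qed.

HB.instance Definition _ := isHermitianSesquilinear.Build C W false (@Num.conj C) rdot rdot_herm.

Let rdot_gt0 (x : W) : x != 0 -> 0 < rdot x x.
Proof.
move=> x0; rewrite /rdot [X in _ < X](form_diag (eform_pos B)) ltcR.
rewrite exprn_gt0// lt_def fnorm_ge0 andbT; apply: contra x0 => /eqP h.
by apply/eqP; apply: nrm_eq0; rewrite /nrm h.
Qed.

HB.instance Definition _ := isDotProduct.Build C W rdot rdot_gt0.

End Instances.

Context {n : nat} (H : hol_hilbert R n) (B : eqv_form H).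

Definition rfun (h : renorm B) : siegel R n -> C := @hol_fun R n H h.

Let rfun_linear : linear rfun.
Proof. by move=> a x y; rewrite /rfun -[RHS](linearP (@hol_fun R n H) a x y). Qed.

HB.instance Definition _ := GRing.isLinear.Build C (renorm B) (siegel R n -> C) *:%R rfun rfun_linear.

Let rnormE (h : renorm B) : `|h| ^+ 2 = rdot h h.
Proof. by rewrite renorm_normE -rcX; exact: (esym (form_diag (eform_pos B) h)). Qed.

Let rfun_inj : injective rfun.
Proof. exact: (@hol_fun_inj R n H). Qed.

Let rfun_hol (h : renorm B) : holomorphic (rfun h).
Proof. exact: (@hol_fun_hol R n H). Qed.

Definition renorm_hilbert : hol_hilbert R n :=
  @HolHilbert R n (renorm B) (rdot (B := B)) rnormE rfun rfun_inj rfun_hol.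

End Renorm.

(** * Invariance of the kernel spaces *)

Lemma pair_continuousr (X Y Z : topologicalType) (b : X * Y -> Z) x :
  continuous b -> continuous (fun y => b (x, y)).
Proof.
move=> cb y; apply: (@cvg_comp _ _ _ (fun y => (x, y)) b _ (nbhs (x, y))); last exact: cb.
exact: (@cvg_pair _ _ _ (nbhs y) (nbhs x) (nbhs y) _ _ _ (fun=> x) id (cvg_cst x) cvg_id).
Qed.

Lemma pair_continuousl (X Y Z : topologicalType) (b : X * Y -> Z) y :
  continuous b -> continuous (fun x => b (x, y)).
Proof.
move=> cb x; apply: (@cvg_comp _ _ _ (fun x => (x, y)) b _ (nbhs (x, y))); last exact: cb.
exact: (@cvg_pair _ _ _ (nbhs x) (nbhs x) (nbhs y) _ _ _ id (fun=> y) cvg_id (cvg_cst y)).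
Qed.

(** * Continuous paths with countably many values *)

Section CountablePaths.
Context {R : realType}.
Local Notation C := R[i].

Lemma path_comp (X : topologicalType) (c : R -> X) (Q : X -> C) :
  {within `[0, 1], continuous c} -> continuous Q -> {within `[0, 1], continuous (fun t => Q (c t))}.
Proof. by move=> cc cQ t; apply: continuous_comp; [exact: cc|exact: cQ]. Qed.

(** If the end values differ, the intermediate value theorem puts a whole interval into [S], but a
    countable set has Lebesgue measure 0. *)
Lemma countable_path_real (h : R -> R) (S : set R) : {within `[0, 1], continuous h} -> countable S ->
  (forall t, t \in `[0, 1]%R -> S (h t)) -> h 0 = h 1.
Proof.
move=> ch cS hS; apply/eqP/negPn/negP => h01.
pose a := Num.min (h 0) (h 1); pose b := Num.max (h 0) (h 1).
have ab : a < b by rewrite /a /b minEle maxEle; case: (ltgtP (h 0) (h 1)) h01.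
have sub : `[a, b]%classic `<=` S.
  move=> v; rewrite /= in_itv /= => vab.
  by have [c c01 <-] := IVT ler01 ch vab; exact: hS.
have cab : countable `[a, b] by apply: sub_countable cS; exact: subset_card_le.
have := countable_lebesgue_measure0 cab.
rewrite lebesgue_measure_itv /= lte_fin ab => /eqP.
by rewrite -EFinB eqe subr_eq0 gt_eqF.
Qed.

Lemma countable_path (g : R -> C) (S : set C) : {within `[0, 1], continuous g} -> countable S ->
  (forall t, t \in `[0, 1]%R -> S (g t)) -> g 0 = g 1.
Proof.
move=> cg cS gS; apply: ceq.
  apply: (@countable_path_real (fun t => complex.Re (g t)) (@complex.Re R @` S)).
  - by move=> t; apply: continuous_comp; [exact: cg|exact: continuous_cRe].
  - by apply: sub_countable cS; exact: card_image_le.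
  - by move=> t t01; exists (g t) => //; exact: gS.
apply: (@countable_path_real (fun t => complex.Im (g t)) (@complex.Im R @` S)).
- by move=> t; apply: continuous_comp; [exact: cg|exact: continuous_cIm].
- by apply: sub_countable cS; exact: card_image_le.
- by move=> t t01; exists (g t) => //; exact: gS.
Qed.

(** The ambiguity of a power with exponent [al]: all determinations of the power of 1. It may be
    dense in the unit circle, so countability, not discreteness, is what is used. *)
Definition exp_periods (al : R) : set C := range (fun k : int => cexp (al%:C * Complex 0 (k%:~R * (2 * pi)))).

Lemma countable_exp_periods al : countable (exp_periods al).
Proof.
by apply: sub_countable (countableP [set: int]); exact: card_image_le.
Qed.

Lemma exp_periodsP al z : cexp z = 1 -> exp_periods al (cexp (al%:C * z)).
Proof. by move=> /cexp_eq1[k ->]; exists k. Qed.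

End CountablePaths.

(** * Covariance of the kernel on the covering group *)

Section Cocycle.
Context {R : realType} {n : nat}.
Local Notation C := R[i].
Local Notation D := (siegel R n).

Lemma cvg_kap (T : Type) (F : set_system T) (FF : Filter F) (x y : T -> 'rV[C]_n.+1) a b :
  x t @[t --> F] --> a -> y t @[t --> F] --> b -> kap (x t) (y t) @[t --> F] --> kap a b.
Proof.
move=> xa yb.
have coord (z : T -> 'rV[C]_n.+1) (c : 'rV[C]_n.+1) j : z t @[t --> F] --> c -> z t ord0 j @[t --> F] --> (c ord0 j : C).
  move=> zc; have cj : {for c, continuous (fun M : 'rV[C]_n.+1 => M ord0 j)} by exact: coord_continuous.
  exact: (cvg_comp _ _ zc cj).
rewrite /kap; apply: cvgB.
  apply: cvgM; last exact: cvg_cst.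
  by apply: cvgB; [exact: coord|apply: cvg_conj; exact: coord].
rewrite /herm; apply: (@cvg_big _ _ +%R 0 _ _ _ F _
  (fun i t => zeta (x t) ord0 i * (zeta (y t) ord0 i)^*)) => [|i _]; first exact: add_continuous.
under eq_fun do rewrite !mxE.
rewrite !mxE; apply: cvgM; first exact: coord.
by apply: cvg_conj; exact: coord.
Qed.

Lemma cvg_kernelA (T : Type) (F : set_system T) (FF : Filter F) s (x y : T -> D) (a b : D) :
  \val (x t) @[t --> F] --> \val a -> \val (y t) @[t --> F] --> \val b ->
  kernelA s (x t) (y t) @[t --> F] --> kernelA s a b.
Proof.
move=> xa yb; have h := cvg_kap FF xa yb.
have k0 := Re_kap_gt0 (valD a) (valD b).
have := cdiff_cont (cdiff_cpow (- s) k0) => ck.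
exact: (cvg_comp _ _ h ck).
Qed.

Lemma kernelAC s (w w' : D) : kernelA s w' w = (kernelA s w w')^*.
Proof.
rewrite /kernelA -/(kap _ _) -/(kap _ _) kapC conj_cpow//.
by apply: Re_kap_gt0; exact: valD.
Qed.

Lemma kernelA_neq0 s (w w' : D) : kernelA s w w' != 0.
Proof. exact: cpow_neq0. Qed.

Lemma cjac_id (w : D) : cjac id w = 1.
Proof.
have -> : id = gfun 1 0 0 :> (D -> D).
  by apply/funext => v; apply: val_inj; rewrite val_gfun// gmap_id.
by rewrite cjac_gfun// (rc_nat 1) expr1n.
Qed.

(** Whatever logarithms [l] and [l'] are taken, the combination [z] of these and of the principal
    logarithms of [kap] is a logarithm of 1 by [kap_biholo]; the left-hand side is the exponential
    of a real multiple of [z]. *)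
Lemma cjac_periods s (f : biholo R n) (w w' : D) (l l' : C) :
  cexp l = cjac f w -> cexp l' = cjac f w' ->
  exp_periods (s / n.+2%:R) (cexp ((s / n.+2%:R)%:C * l) * (cexp ((s / n.+2%:R)%:C * l'))^* *
    kernelA s (f w) (f w') / kernelA s w w').
Proof.
move=> lE l'E.
have k0 := kap_neq0 (valD w) (valD w'); have kf0 := kap_neq0 (valD (f w)) (valD (f w')).
set L := clog (kap (\val w) (\val w')); set Lf := clog (kap (\val (f w)) (\val (f w'))).
have EL : cexp L = kap (\val w) (\val w') by exact: cexp_clog.
have ELf : cexp Lf = kap (\val (f w)) (\val (f w')) by exact: cexp_clog.
have cexpMn z m : cexp (m%:R * z) = cexp z ^+ m :> C.
  elim: m => [|m IH]; first by rewrite mul0r cexp0 expr0.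
  by rewrite -addn1 natrD mulrDl mul1r cexpD IH exprD expr1.
set z := l + l'^* + n.+2%:R * L - n.+2%:R * Lf.
have ez : cexp z = 1.
  rewrite /z cexpD cexpN !cexpD !cexpMn EL ELf -conj_cexp lE l'E.
  rewrite kap_biholo [X in X / _]mulrC.
  have j0 : cjac f w * (cjac f w')^* != 0.
    by rewrite -lE -l'E conj_cexp mulf_neq0// cexp_neq0.
  by rewrite divff// mulf_neq0// expf_neq0.
have -> : cexp ((s / n.+2%:R)%:C * l) * (cexp ((s / n.+2%:R)%:C * l'))^* *
    kernelA s (f w) (f w') / kernelA s w w' = cexp ((s / n.+2%:R)%:C * z).
  rewrite conj_cexp conjcM conj_real /kernelA -/(kap _ _) -/(kap _ _) /cpow -/L -/Lf.
  rewrite -cexpN -!cexpD; congr cexp.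
  have Es : (s%:C : C) = (s / n.+2%:R)%:C * n.+2%:R.
    by rewrite -(rc_nat n.+2) -rcM divfK// pnatr_eq0.
  rewrite !rcN Es /z; move: (s / _)%:C => k; ring.
exact: exp_periodsP.
Qed.

Lemma segment_continuous (x y : D) :
  {within `[0, 1], continuous (fun t : R => toD (\val x + t%:C *: (\val y - \val x)))}.
Proof.
(* Clamping the parameter keeps the path inside the domain for every real [t], so that continuity is
   proved globally and then restricted. *)
pose c t := Num.max 0 (Num.min 1 t) : R.
have cc : continuous c.
  move=> t; apply: continuous_max; first exact: cvg_cst.
  by apply: continuous_min; [exact: cvg_cst | exact: cvg_id].
have c01 t : 0 <= c t <= 1.
  by rewrite /c le_max lexx /= ge_max ler01 ge_min lexx.
have cE t : t \in `[0, 1]%R -> c t = t.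
  by rewrite in_itv /= => /andP[t0 t1]; rewrite /c min_r// max_r.
have h : continuous (fun t : R => toD (\val x + (c t)%:C *: (\val y - \val x))).
  apply: continuous_comp_initial => t /=.
  have E t' : \val (toD (\val x + (c t')%:C *: (\val y - \val x))) = \val x + (c t')%:C *: (\val y - \val x).
    by rewrite toDK//; exact: siegel_convex (valD x) (valD y) (c01 _).
  have -> : set_val \o (fun t0 : R => toD (\val x + (c t0)%:C *: (\val y - \val x))) =
      fun t0 => \val x + (c t0)%:C *: (\val y - \val x) by apply/funext => t'; exact: E.
  apply: cvgD; first exact: cvg_cst.
  apply: cvgZ; last exact: cvg_cst.
  by apply: cvg_Complex; [exact: cc | exact: cvg_cst].
apply: subspace_eq_continuous (continuous_subspaceT h) => t t01.
by rewrite /from_subspace /= cE//; move: t01; rewrite inE.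
Qed.

#[local] Opaque cjac kernelA cexp.

Context (G : topologicalGroupType) (p : {multiplicative G -> biholo R n}) (b : G * D -> C) (s : R).
Hypothesis cp : continuous p.
Hypothesis pcG : @path_connected R G.
Hypothesis bP : jacobian_power s p b.

Lemma morph1 : p 1%g = 1%g.
Proof. by have := @gmulfM _ _ p 1%g 1%g; rewrite mulg1 => h; have := mulVg (p 1%g); rewrite {2}h mulgA mulVg mul1g. Qed.

Lemma morphV g : (p g)^-1%g = p (g^-1)%g.
Proof.
have := @gmulfM _ _ p (g^-1)%g g; rewrite mulVg morph1 => h.
by rewrite -[LHS]mul1g h mulgK.
Qed.

(** Evaluation at [w] is continuous for the compact-open topology, because the singleton of [w] is
    compact; it is composed with inversion in [G]. *)
Lemma action_continuous (w : D) : continuous (fun g => ((p g)^-1)%g w).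
Proof.
have -> : (fun g => ((p g)^-1)%g w) = (fun g => p (g^-1)%g w).
  by apply/funext => g; rewrite morphV.
move=> g.
have h1 := @invg_continuous G g.
have h2 := cvg_comp _ _ h1 (@cp (g^-1)%g).
have h3 := cvg_comp _ _ h2 (@initial_continuous _ _ (@biholo_fun R n : biholo R n -> {compact-open, D -> D}) (p g^-1%g)).
move: h3 => /compact_open_cvgP h3 O /=.
rewrite nbhsE => -[U [oU Uw] UO].
have sU : [set biholo_fun (p g^-1%g) x | x in [set w]] `<=` U by move=> _ [_ -> <-].
have N : \forall x \near g, [set biholo_fun (p x^-1%g) y | y in [set w]] `<=` U.
    exact: (h3 [set w] U (@compact_set1 _ w) oU sU).
  change (\forall x \near g, O (p x^-1%g w)).
  apply: filterS N => g' gU; apply: UO; apply: gU.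
by exists w.
Qed.

(** The normalisation is given at the base point only. At the identity the Jacobian is 1, so along
    the segment from the base point to [w] the branch stays in a countable set. *)
Lemma branch_id (w : D) : b (1%g, w) = 1.
Proof.
have [cb b1 bl] := bP.
rewrite -b1.
pose c (t : R) := toD (\val (base R n) + t%:C *: (\val w - \val (base R n))).
have -> : w = c 1 by rewrite /c (rc_nat 1) scale1r subrKC toD_val.
have -> : base R n = c 0 by rewrite /c scale0r addr0 toD_val.
symmetry.
apply: (@countable_path _ (fun t => b (1%g, c t)) (exp_periods (s / n.+2%:R))).
- have cc : {within `[0, 1], continuous c} by exact: (@segment_continuous (base R n) w).
  have cv : continuous (fun v => b (1%g, v)) by exact: (@pair_continuousr _ _ _ b 1%g cb).
  exact: (path_comp cc cv).
- exact: countable_exp_periods.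
move=> t _; have [l [lE ->]] := bl 1%g (c t).
apply: exp_periodsP; rewrite lE morph1.
have e : biholo_fun (1^-1)%g = id :> (D -> D) by [].
by rewrite e cjac_id.
Qed.

Lemma branch_cocycle g (w w' : D) :
  b (g, w) * (b (g, w'))^* * kernelA s (((p g)^-1)%g w) (((p g)^-1)%g w') = kernelA s w w'.
Proof.
have [cb b1 bl] := bP.
have [c [cc c0 c1]] := pcG 1%g g.
pose Q g := b (g, w) * (b (g, w'))^* * kernelA s (((p g)^-1)%g w) (((p g)^-1)%g w') / kernelA s w w'.
have Q1 : Q g = 1.
  have -> : 1 = Q 1%g.
    by rewrite /Q !branch_id rmorph1 !mul1r morph1 invg1 divff// kernelA_neq0.
  rewrite -c0 -c1; symmetry.
  apply: (@countable_path _ (fun t => Q (c t)) (exp_periods (s / n.+2%:R))).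
  - have cQ g0 : {for g0, continuous Q}; last first.
      by apply: (path_comp cc) => g0; exact: cQ.
    rewrite /Q; apply: cvgM; last exact: cvg_cst.
    have bc v : b (g, v) @[g --> g0] --> b (g0, v) by exact: (@pair_continuousl _ _ _ b v cb g0).
    have ac v : \val (((p g)^-1)%g v) @[g --> g0] --> \val (((p g0)^-1)%g v).
      apply: (@cvg_comp _ _ _ (fun g => ((p g)^-1)%g v) (fun x : D => \val x)); first exact: action_continuous.
      exact: (@initial_continuous D _ (fun x : D => \val x)).
    apply: cvgM; last by apply: cvg_kernelA.
    by apply: cvgM; [exact: bc | apply: cvg_conj; exact: bc].
  - exact: countable_exp_periods.
  move=> t _; have [l [lE lb]] := bl (c t) w; have [l' [lE' lb']] := bl (c t) w'.
  have h := @cjac_periods s ((p (c t))^-1)%g w w' l l' lE lE'.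
  by rewrite -[cexp (_ * l)]lb -[cexp (_ * l')]lb' in h; exact: h.
by move/(congr1 (fun x => x * kernelA s w w')): Q1; rewrite mul1r divfK// kernelA_neq0.
Qed.

Lemma branch_neq0 g w : b (g, w) != 0.
Proof. by have [_ _ bl] := bP; have [l [_ ->]] := bl g w; exact: cexp_neq0. Qed.

End Cocycle.

(** * From covariance of the kernel to isometry of the operator *)

Section KernelIsometry.
Context {R : realType} {n : nat} (A : hol_hilbert R n).
Local Notation C := R[i].
Local Notation D := (siegel R n).
Local Notation dot := (@hol_dot R n A).
Local Notation nrm := (fnorm dot).
Variables (K : D -> D -> C) (f finv : D -> D) (be : D -> C).
Hypothesis Krep : reproducing K A.
Hypothesis fK : forall w, f (finv w) = w.
Hypothesis be0 : forall w, be w != 0.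
Hypothesis cov : forall w w', be w * (be w')^* * K (f w) (f w') = K w w'.
Let BP := hol_dot_form A.

Let V (h : D -> C) : D -> C := fun w => h (f w) * be w.

(** A priori [V] acts on functions and may leave the space, so it is treated through its graph [Gr].
    The vectors with an image that pairs correctly with the whole graph form a closed subspace; it
    contains the kernel functions, and only 0 is orthogonal to these. *)
Lemma kernel_isometry (h : A) : exists h' : A, hol_fun h' = V (hol_fun h) /\ `|h'| = `|h|.
Proof.
have [k kP] := choice Krep.
pose Gr (h h' : A) := hol_fun h' = V (hol_fun h).
have GrL (a : C) x y x' y' : Gr x x' -> Gr y y' -> Gr (a *: x + y) (a *: x' + y').
  rewrite /Gr => ex ey; rewrite !linearP ex ey; apply/funext => w.
  by rewrite /V !fctE /= mulrDl scalerAl.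
have GrB x y x' y' : Gr x x' -> Gr y y' -> Gr (x - y) (x' - y').
  by move=> ex ey; have := GrL (-1) _ _ _ _ ey ex; rewrite !scaleN1r [- y + x]addrC [- y' + x']addrC.
(* Covariance at the pair [(v, finv w)] shows that [V] maps a kernel function to a multiple of
   another one. *)
have Grk w : exists c : C, c * (be (finv w))^* = 1 /\ Gr (k w) (c *: k (finv w)).
  have b0 : (be (finv w))^* != 0 by rewrite conjC_eq0.
  exists ((be (finv w))^*)^-1; rewrite mulVf//; split => //.
  rewrite /Gr linearZ /= !(kP _).1; apply/funext => v; rewrite /V fctE.
  have E := cov v (finv w); rewrite fK in E; rewrite -E /GRing.scale /=; field.
  by rewrite b0.
have Gr_k x x' w c : Gr x x' -> c * (be (finv w))^* = 1 -> dot x' (c *: k (finv w)) = dot x (k w).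
  move=> gx c1; rewrite (formZr BP) -!(kP _).2 gx /V fK mulrCA -[RHS]mulr1; congr (_ * _).
  by rewrite -[be _]conjCK -conjcM c1 rmorph1.
(* Pairing with every element of the graph, rather than preserving norms, makes the condition linear
   in [x]; the choice [y = x] gives back the norm. *)
pose M x := exists x', Gr x x' /\ forall y y', Gr y y' -> dot x' y' = dot x y.
have M0 : M 0.
  exists 0; split; first by rewrite /Gr linear0; apply/funext => w; rewrite /V /= mul0r.
  by move=> y y' _; rewrite !(form0l BP).
have Ms : subspace M.
  split=> // a x y [x' [gx hx]] [y' [gy hy]]; exists (a *: x' + y'); split; first exact: GrL.
  by move=> z z' gz; case: BP => L _ _; rewrite !L (hx _ _ gz) (hy _ _ gz).
have Mk w : M (k w).
  have [c [c1 gk]] := Grk w; exists (c *: k (finv w)); split => // y y' gy.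
  by rewrite (formC BP y') (formC BP y) (Gr_k _ _ _ _ gy c1).
have nrmE x x' : Gr x x' -> dot x' x' = dot x x -> nrm x' = nrm x.
  by move=> _ e; rewrite /fnorm e.
have Mc : nclosed dot M.
  move=> x hx.
  have Mseq (j : nat) : exists m, M m /\ nrm (x - m) < j.+1%:R^-1.
    have j0 : (0 : R) < j.+1%:R^-1 by rewrite invr_gt0.
    by have [m Mm lt] := hx _ j0; exists m.
  have [u uP] := choice Mseq.
  have [u' u'P] := choice (fun j => (uP j).1).
  have iso i j : nrm (u' i - u' j) = nrm (u i - u j).
    have g : Gr (u i - u j) (u' i - u' j).
      by apply: GrB; exact: (u'P _).1.
    apply: nrmE => //; rewrite [RHS](formBl BP) [LHS](formBl BP).
    by rewrite ((u'P i).2 _ _ g) ((u'P j).2 _ _ g).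
  have half (e : R) : 0 < e -> exists N : nat, forall j : nat, (N <= j)%N -> nrm (x - u j) < e.
    move=> e0; have [N _ NP] := near_infty_natSinv_lt (PosNum e0).
    by exists N => j Nj; apply: lt_trans (uP j).2 _; exact: NP.
  have [x' x'P] : exists l, forall e : R, 0 < e -> exists N : nat, forall m : nat, (N <= m)%N -> nrm (u' m - l) < e.
    apply: hol_complete => e e0; have [N NP] := half _ (divr_gt0 e0 (ltr0n _ 2)).
    exists N => i j Ni Nj; rewrite iso [e]splitr; apply: le_lt_trans (ler_fnormB BP _ x _) _.
    by apply: ltrD; [rewrite (fnormBC BP)|]; exact: NP.
  (* both sides of an identity <u' j, y'> = <u j, y> pass to the limit *)
  have lim y y' : (forall j, dot (u' j) y' = dot (u j) y) -> dot x' y' = dot x y.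
    move=> E; apply/eqP; rewrite -subr_eq0 -normc_eq0 eq_le normc_ge0 andbT.
    apply/ler_addgt0Pr => e e0; rewrite add0r.
    pose k0 := nrm y + nrm y' + 1.
    have k00 : 0 < k0 by rewrite ltr_wpDl// addr_ge0// fnorm_ge0.
    have [N1 N1P] := half _ (divr_gt0 e0 k00); have [N2 N2P] := x'P _ (divr_gt0 e0 k00).
    pose N := maxn N1 N2.
    have h1 := N1P N (leq_maxl _ _); have h2 := N2P N (leq_maxr _ _).
    have -> : dot x' y' - dot x y = - dot (u' N - x') y' - dot (x - u N) y.
      by rewrite !(formBl BP) E; ring.
    apply: le_trans (ler_normcB _ _) _; rewrite normcN.
    apply: le_trans (lerD (form_bound BP _ _) (form_bound BP _ _)) _.
    rewrite (@le_trans _ _ (e / k0 * nrm y' + e / k0 * nrm y))//.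
      by apply: lerD; rewrite ler_wpM2r ?fnorm_ge0// ltW.
    rewrite -mulrDr mulrAC ler_pdivrMr// ler_wpM2l ?(ltW e0)// /k0 addrC.
    by rewrite lerDl.
  exists x'; split.
    (* The limit stays in the graph because evaluations are scalar products with kernel functions,
       hence pass to the limit. *)
    apply/funext => w; rewrite (kP w).2 /V (kP (f w)).2.
    have -> : dot x (k (f w)) * be w = dot x ((be w)^* *: k (f w)) by rewrite (formZr BP) conjCK mulrC.
    apply: lim => j; rewrite (formZr BP) conjCK mulrC -!(kP _).2.
    by rewrite (u'P j).1.
  by move=> y y' gy; apply: lim => j; exact: (u'P j).2.
have [h' [gh hh]] : M h.
  apply: (orthogonal_full BP (@hol_nrm_eq0 _ _ A) (@hol_complete _ _ A) Ms Mc) => v vM.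
  apply: (@hol_fun_inj R n A); apply/funext => w; rewrite (kP w).2 linear0.
  exact: vM.
exists h'; split => //; rewrite !hol_norm; congr (_%:C).
by apply: nrmE => //; exact: hh.
Qed.

End KernelIsometry.

Lemma invariant_As (R : realType) (n : nat) (s : R) (A : hol_hilbert R n) :
  is_As s A -> forall (G : topologicalGroupType) (p : {multiplicative G -> biholo R n}),
  universal_covering p -> forall b : G * siegel R n -> R[i], jacobian_power s p b ->
  invariant_with_norm [set: G] (Utilde p b) A.
Proof.
move=> As G p [[cp _ _] [pcG _]] b bP g _ h.
apply: (@kernel_isometry R n A (kernelA s) ((p g)^-1)%g (p g) (fun w => b (g, w))) => //.
- by move=> w; exact: (biholo_funK (p g)).
- by move=> w; exact: (branch_neq0 bP).
- by move=> w w'; exact: (branch_cocycle cp pcG bP).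
Qed.

(** * Invariant means *)

Section InvariantMean.
Context {R : realType} (V : zmodType).
Implicit Types (f g : V -> R) (u v s : V).

Definition avg s (N : nat) f : V -> R := fun v => (\sum_(k < N.+1) f (v + s *+ k)) / N.+1%:R.

(** One Cesaro mean for each element of [S], composed: as [V] is abelian, the result is nearly
    invariant under all elements of [S] at once. *)
Definition avgs (S : seq V) (N : nat) f : V -> R := foldr (fun s g => avg s N g) f S.

Lemma avg_linear s N a f g v : avg s N (fun v => a * f v + g v) v = a * avg s N f v + avg s N g v.
Proof. by rewrite /avg big_split /= -mulr_sumr mulrDl mulrA. Qed.

Lemma avg_bounds s N f c d : (forall v, c <= f v <= d) -> forall v, c <= avg s N f v <= d.
Proof.
move=> h v; have N0 : 0 < N.+1%:R :> R by [].
have cst x : \sum_(k < N.+1) x = x * N.+1%:R :> R by rewrite sumr_const card_ord mulr_natr.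
rewrite ler_pdivlMr// ler_pdivrMr// -!cst; apply/andP; split; apply: ler_sum => k _.
  by have /andP[] := h (v + s *+ k).
by have /andP[] := h (v + s *+ k).
Qed.

Lemma avg_shift s N f u v : avg s N (fun v => f (v + u)) v = avg s N f (v + u).
Proof. by congr (_ / _); apply: eq_bigr => k _; rewrite addrAC. Qed.

Lemma avg_telescope s N f (K : R) v : (forall v, `|f v| <= K) ->
  `|avg s N f v - avg s N f (v + s)| <= 2 * K / N.+1%:R.
Proof.
move=> fK; rewrite /avg -mulrBl normrM normfV [`|N.+1%:R|]ger0_norm// ler_wpM2r ?invr_ge0//.
rewrite -sumrB.
have -> : \sum_(k < N.+1) (f (v + s *+ k) - f (v + s + s *+ k)) = f v - f (v + s *+ N.+1).
  elim: N => [|N IH]; first by rewrite big_ord1 !mulr0n !addr0 mulr1n.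
  rewrite big_ord_recr /= IH -addrA [X in _ + X]addrA addNr add0r.
  by rewrite -addrA -mulrS.
apply: le_trans (ler_normB _ _) _; rewrite mulr_natl mulr2n.
exact: lerD.
Qed.

Lemma avgs_linear S N a f g v : avgs S N (fun v => a * f v + g v) v = a * avgs S N f v + avgs S N g v.
Proof.
elim: S v => [|s S IH] v //=; rewrite -avg_linear; congr (avg s N _ v).
by apply/funext => x; exact: IH.
Qed.

Lemma avgs_bounds S N f c d : (forall v, c <= f v <= d) -> forall v, c <= avgs S N f v <= d.
Proof. by move=> h; elim: S => [|s S IH] v //=; apply: avg_bounds. Qed.

Lemma avgs_shift S N f u v : avgs S N (fun v => f (v + u)) v = avgs S N f (v + u).
Proof.
elim: S v => [|s S IH] v //=; rewrite -avg_shift; congr (avg s N _ v).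
by apply/funext => x; exact: IH.
Qed.

(** For the outermost direction the sum telescopes. For the others the difference is itself an
    average of differences that are already small, since averages commute with translations. *)
Lemma avgs_invariant S N f (K : R) s v : (forall v, `|f v| <= K) -> s \in S ->
  `|avgs S N f v - avgs S N (fun v => f (v + s)) v| <= 2 * K / N.+1%:R.
Proof.
move=> fK; rewrite avgs_shift; elim: S v => [|t S IH] v //=; rewrite inE => /predU1P[<-|sS].
  apply: avg_telescope => x; rewrite ler_norml; apply: avgs_bounds => y.
  by rewrite -ler_norml.
have -> : avg t N (avgs S N f) v - avg t N (avgs S N f) (v + s) =
    avg t N (fun x => -1 * avgs S N f (x + s) + avgs S N f x) v.
  by rewrite avg_linear avg_shift mulN1r addrC.
rewrite ler_norml; apply: avg_bounds => x.
by rewrite -ler_norml mulN1r addrC; exact: IH.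
Qed.

Definition bounded_on f := exists K : R, forall v, `|f v| <= K.

Definition mean_filter : set_system (seq V * nat) :=
  filter_from [set: seq V * nat] (fun S0 : seq V * nat => [set S : seq V * nat | {subset S0.1 <= S.1} /\ (S0.2 <= S.2)%N]).

Lemma mean_filter_proper : ProperFilter mean_filter.
Proof.
apply: filter_from_proper; last by move=> S0 _; exists S0; split.
apply: filter_from_filter; first by exists ([::], 0%N).
move=> S T _ _; exists (S.1 ++ T.1, maxn S.2 T.2) => // W [] /= h1 h2.
split; split.
- by move=> x xS; apply: h1; rewrite mem_cat xS.
- exact: leq_trans (leq_maxl _ _) h2.
- by move=> x xS; apply: h1; rewrite mem_cat xS orbT.
- exact: leq_trans (leq_maxr _ _) h2.
Qed.

(** Limit of the averages along an ultrafilter finer than the one of growing [S] and [N]. It is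
    defined for every bounded function, and the error in [avgs_invariant] disappears in the
    limit. *)
Lemma invariant_mean : exists m : (V -> R) -> R, [/\
  forall a f g, bounded_on f -> bounded_on g -> m (fun v => a * f v + g v) = a * m f + m g,
  forall f c d, (forall v, c <= f v <= d) -> c <= m f <= d &
  forall f u, bounded_on f -> m (fun v => f (v + u)) = m f].
Proof.
have [G [Gu Gsub]] := ultraFilterLemma mean_filter_proper.
have GF : ProperFilter G := @ultra_proper _ _ Gu.
pose A f (S : seq V * nat) := avgs S.1 S.2 f 0.
(* The image of an ultrafilter is an ultrafilter; this one contains the compact segment [[- K, K]],
   hence converges. *)
have cvA f : bounded_on f -> cvg (A f @ G).
  move=> [K fK].
  have AU : UltraFilter (A f @ G).
    split; first exact: fmap_proper_filter.
    move=> H HP sub; apply/seteqP; split => // B HB.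
    have [//|nB] := in_ultra_setVsetC (A f @^-1` B) Gu.
    have HnB : H (~` B) by apply: sub; exact: nB.
    have h0 := @filterI _ H _ B (~` B) HB HnB; rewrite setICr in h0.
    by case: (@filter_not_empty _ H HP (h0 _)).
  have := @segment_compact R (- K) K; rewrite compact_ultra => cK.
  have [|l [_ lP]] := cK _ AU; last by apply/cvg_ex; exists l.
  apply: (@filterS _ G) filterT => S _ /=; rewrite in_itv /=.
  by apply: avgs_bounds => v; rewrite -ler_norml.
pose m f := lim (A f @ G).
have mP f l : A f @ G --> l -> m f = l by move=> h; apply/cvg_lim.
exists m; split.
- move=> a f g bf bg; apply: mP.
  have -> : A (fun v => a * f v + g v) = (fun S => a * A f S + A g S).
    by apply/funext => S; rewrite /A avgs_linear.
  by apply: cvgD; [apply: cvgMr|]; exact: cvA.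
- move=> f c d h.
  have bf : bounded_on f.
    exists (`|c| + `|d|) => v; have /andP[h1 h2] := h v.
    rewrite ler_norml; apply/andP; split.
      by apply: le_trans h1; have := ler_norm (- c); rewrite normrN; have := normr_ge0 d; lra.
    by apply: le_trans h2 _; have := ler_norm d; have := normr_ge0 c; lra.
  have hA S : c <= A f S <= d by exact: avgs_bounds.
  apply/andP; split.
    by apply: limr_ge; [exact: cvA|apply: nearW => S; have /andP[] := hA S].
  by apply: limr_le; [exact: cvA|apply: nearW => S; have /andP[] := hA S].
- move=> f u [K fK]; apply: mP.
  have K0 : 0 <= K := le_trans (normr_ge0 _) (fK 0).
  have bf : bounded_on f by exists K.
  apply/cvgrPdist_lt => e e0.
  have e20 : 0 < e / 2 by rewrite divr_gt0.
  have /cvgrPdist_lt/(_ _ e20) h1 := cvA f bf.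
  have d0 : 0 < e / 2 / (2 * K + 1) by rewrite divr_gt0// ltr_wpDl// mulr_ge0.
  have [N _ NP] := near_infty_natSinv_lt (PosNum d0).
  have h2 : G [set S : seq V * nat | u \in S.1 /\ (N <= S.2)%N].
    apply: Gsub; exists ([:: u], N) => // S [] /= h ->; split => //.
    by apply: h; rewrite inE.
  apply: filterS2 h1 h2 => S /= h [uS NS].
  have := avgs_invariant S.2 0 fK uS; rewrite -/(A f S) -[avgs _ _ _ _]/(A (fun v => f (v + u)) S) => h3.
  have -> : lim (A f @ G) - A (fun v => f (v + u)) S = (lim (A f @ G) - A f S) + (A f S - A (fun v => f (v + u)) S).
    by rewrite addrA subrK.
  apply: le_lt_trans (ler_normD _ _) _; rewrite [e]splitr; apply: ltr_leD => //.
  apply: le_trans h3 _.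
  have := NP _ NS => /= /ltW h4.
  apply: (@le_trans _ _ (2 * K * (e / 2 / (2 * K + 1)))); first by rewrite ler_wpM2l// mulr_ge0.
  have den0 : 0 < 2 * K + 1 by rewrite ltr_wpDl// mulr_ge0.
  rewrite mulrA ler_pdivrMr// mulrC ler_wpM2l ?(ltW e20)// lerDl//.
Qed.

End InvariantMean.

(** * Averaging a form over an abelian family of operators *)

Section AverageForm.
Context {R : realType} (V : zmodType) (E : lmodType R[i]).
Local Notation C := R[i].
Variable nr : E -> R.
Hypothesis nr0 : forall x, 0 <= nr x.

Definition equiv_form (B : E -> E -> C) := [/\ pos_form B,
  exists2 l : R, 0 < l & forall x, nr x <= l * fnorm B x &
  exists2 l : R, 0 < l & forall x, fnorm B x <= l * nr x].

(** [Phi] is any uniformly bounded family with the stated lower bound, not a representation: the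
    average becomes invariant under each [T] whose effect on [B] is a shift of the parameter. This
    covers families that are additive only modulo operators already preserving [B], and the shift
    [v0 = 0] lets older invariances survive. *)
Lemma average_form (B : E -> E -> C) (Phi : V -> E -> E) (K : R) : equiv_form B ->
  (forall v (a : C) x y, Phi v (a *: x + y) = a *: Phi v x + Phi v y) ->
  0 < K -> (forall v x, nr (Phi v x) <= K * nr x) -> (forall v x, nr x <= K * nr (Phi v x)) ->
  exists2 B', equiv_form B' & forall (T : E -> E) v0,
    (forall v x y, B (Phi v (T x)) (Phi v (T y)) = B (Phi (v + v0) x) (Phi (v + v0) y)) ->
    forall x y, B' (T x) (T y) = B' x y.
Proof.
move=> [BP [l l0 lP] [u u0 uP]] PhiL K0 PhiK KPhi.
have [m [mL mB mI]] := @invariant_mean R V.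
pose F x y v := B (Phi v x) (Phi v y).
have bF x y v : normc (F x y v) <= u * (K * nr x) * (u * (K * nr y)).
  have fb z : fnorm B (Phi v z) <= u * (K * nr z).
    by apply: le_trans (uP _) _; rewrite ler_pM2l.
  apply: le_trans (form_bound BP _ _) _.
  by apply: ler_pM => //; exact: fnorm_ge0.
have bRe x y : bounded_on (fun v => complex.Re (F x y v)).
  by exists (u * (K * nr x) * (u * (K * nr y))) => v; apply: le_trans (Re_le_normc _) (bF _ _ _).
have bIm x y : bounded_on (fun v => complex.Im (F x y v)).
  by exists (u * (K * nr x) * (u * (K * nr y))) => v; apply: le_trans (Im_le_normc _) (bF _ _ _).
have bL (a : R) (f g : V -> R) : bounded_on f -> bounded_on g -> bounded_on (fun v : V => a * f v + g v).
  move=> [k1 h1] [k2 h2]; exists (`|a| * k1 + k2) => v; apply: le_trans (ler_normD _ _) _.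
  by rewrite normrM; apply: lerD => //; rewrite ler_wpM2l.
pose B' x y := Complex (m (fun v => complex.Re (F x y v))) (m (fun v => complex.Im (F x y v))).
have FL a x y z v : F (a *: x + y) z v = a * F x z v + F y z v.
  by rewrite /F PhiL; case: BP => L _ _; exact: L.
have m0 : m (fun=> 0) = 0.
  by have /andP[h1 h2] := mB (fun=> 0) 0 0 (fun=> introT andP (conj (lexx _) (lexx _))); apply/eqP; rewrite eq_le h2.
have b0 : bounded_on (fun _ : V => 0 : R) by exists 0 => v; rewrite normr0.
have mN f : bounded_on f -> m (fun v => - f v) = - m f.
  move=> bf; have := mL (-1) f (fun=> 0) bf b0; rewrite m0 addr0 mulN1r => <-.
  by congr m; apply/funext => v; rewrite addr0 mulN1r.
have B'P : pos_form B'.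
  split=> [a x y z|x y|x].
  - apply: ceq => /=.
      rewrite [X in m X](_ : _ = (fun v => complex.Re a * complex.Re (F x z v) +
        (- complex.Im a * complex.Im (F x z v) + complex.Re (F y z v)))); last first.
        by apply/funext => v; rewrite FL; case: (a) (F x z v) (F y z v) => ? ? [? ?] [? ?] /=; ring.
      rewrite (mL _ _ _ (bRe _ _) (bL _ _ _ (bIm _ _) (bRe _ _))) (mL _ _ _ (bIm _ _) (bRe _ _)).
      by case: (a) => ? ? /=; ring.
    rewrite [X in m X](_ : _ = (fun v => complex.Re a * complex.Im (F x z v) +
      (complex.Im a * complex.Re (F x z v) + complex.Im (F y z v)))); last first.
      by apply/funext => v; rewrite FL; case: (a) (F x z v) (F y z v) => ? ? [? ?] [? ?] /=; ring.
    rewrite (mL _ _ _ (bIm _ _) (bL _ _ _ (bRe _ _) (bIm _ _))) (mL _ _ _ (bRe _ _) (bIm _ _)).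
    by case: (a) => ? ? /=; ring.
  - have FC v : F y x v = (F x y v)^* by exact: (formC BP).
    rewrite conjcE; apply: ceq => /=.
      by congr m; apply/funext => v; rewrite FC; case: (F x y v) => ? ?; rewrite conjcE.
    rewrite -mN//; congr m; apply/funext => v; rewrite FC.
    by case: (F x y v) => ? ?; rewrite conjcE.
  - have /andP[] // : 0 <= m (fun v => complex.Re (F x x v)) <= u * (K * nr x) * (u * (K * nr x)).
    apply: mB => v; apply/andP; split; first by rewrite /F -(fnorm_sqr BP) sqr_ge0.
    by apply: le_trans (ler_norm _) (le_trans (Re_le_normc _) (bF _ _ _)).
(* The mean respects pointwise bounds; the lower one, which keeps the averaged norm equivalent,
   rests on [KPhi]. *)
have nB' x : (nr x / (l * K)) ^+ 2 <= complex.Re (B' x x) <= (u * (K * nr x)) ^+ 2.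
  have lK : 0 < l * K by exact: mulr_gt0.
  apply: mB => v; rewrite /F -(fnorm_sqr BP); apply/andP; split.
    rewrite ler_pXn2r ?nnegrE ?fnorm_ge0 ?divr_ge0 ?(ltW lK)//.
    rewrite ler_pdivrMr// mulrC [l * K]mulrC -mulrA; apply: le_trans (KPhi v x) _.
    by rewrite ler_pM2l.
  rewrite ler_pXn2r ?nnegrE ?fnorm_ge0 ?mulr_ge0 ?(ltW u0) ?(ltW K0)//.
  by apply: le_trans (uP _) _; rewrite ler_pM2l.
exists B'.
  split=> //.
    exists (l * K) => [|x]; first exact: mulr_gt0.
    have lK : 0 < l * K by exact: mulr_gt0.
    rewrite mulrC -ler_pdivrMr// -(@ler_pXn2r _ 2)// ?nnegrE ?fnorm_ge0 ?divr_ge0 ?(ltW lK)//.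
    by rewrite (fnorm_sqr B'P); case/andP: (nB' x).
  exists (u * K) => [|x]; first exact: mulr_gt0.
  rewrite -mulrA -(@ler_pXn2r _ 2)// ?nnegrE ?fnorm_ge0 ?mulr_ge0 ?(ltW u0) ?(ltW K0)//.
  by rewrite (fnorm_sqr B'P); case/andP: (nB' x).
move=> T v0 TP x y; have FT v : F (T x) (T y) v = F x y (v + v0) by exact: TP.
apply: ceq => /=.
  rewrite -(mI _ v0 (bRe x y)); congr m; apply/funext => v; by rewrite FT.
by rewrite -(mI _ v0 (bIm x y)); congr m; apply/funext => v; rewrite FT.
Qed.

End AverageForm.

(** * Isometric representations *)

Section GTGroup.
Context {R : realType} {n : nat}.
Local Notation C := R[i].
Local Notation D := (siegel R n).

Lemma gt_eq r r' (r0 : 0 < r) (r0' : 0 < r') (u u' : 'rV[C]_n) t t' :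
  r = r' -> u = u' -> t = t' -> gt r0 u t = gt r0' u' t'.
Proof. by move=> E; subst r' => -> ->; apply: biholoP. Qed.

Lemma gtM r1 r2 (r10 : 0 < r1) (r20 : 0 < r2) (u1 u2 : 'rV[C]_n) t1 t2 :
  (gt r10 u1 t1 * gt r20 u2 t2)%g = gt (mulr_gt0 r10 r20) (r1%:C *: u2 + u1)
    (r1 ^+ 2 * t2 + t1 - 2 * r1 * complex.Im (herm u2 u1)).
Proof.
apply: biholoP => w; apply: val_inj.
rewrite -[X in \val X = _]/(gfun r1 u1 t1 (gfun r2 u2 t2 w)) -[X in _ = \val X]/(gfun _ _ _ w).
by rewrite !val_gfun ?mulr_gt0// gmap_comp.
Qed.

Lemma gt1 : gt ltr01 0 0 = 1%g :> biholo R n.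
Proof.
apply: biholoP => w; apply: val_inj.
by rewrite -[gt _ _ _ w]/(gfun 1 0 0 w) val_gfun// gmap_id.
Qed.

Lemma gtV r (r0 : 0 < r) (u : 'rV[C]_n) t : exists (r0' : 0 < r^-1) u' t', ((gt r0 u t)^-1)%g = gt r0' u' t'.
Proof.
have r0' : 0 < r^-1 by rewrite invr_gt0.
by exists r0', (- r^-1%:C *: u), (- (r^-1 ^+ 2 * t)); apply: biholoP.
Qed.

Lemma GTM (f g : biholo R n) : GT R n f -> GT R n g -> GT R n (f * g)%g.
Proof.
move=> /GT_gt[r1 [u1 [t1 [r10 ->]]]] /GT_gt[r2 [u2 [t2 [r20 ->]]]].
by rewrite gtM; exact: gt_GT.
Qed.

Lemma GTV (f : biholo R n) : GT R n f -> GT R n (f^-1)%g.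
Proof.
move=> /GT_gt[r [u [t [r0 ->]]]]; have [r0' [u' [t' ->]]] := gtV r0 u t.
exact: gt_GT.
Qed.

Lemma cjac_gtV r (r0 : 0 < r) (u : 'rV[C]_n) t w : cjac ((gt r0 u t)^-1)%g w = (r^-1)%:C ^+ n.+2.
Proof. by have [r0' [u' [t' ->]]] := gtV r0 u t; exact: cjac_gfun. Qed.

(** The Jacobian on the affine group is constant, so its value at the base point gives a
    multiplicative weight. *)
Lemma U_gt s r (r0 : 0 < r) (u : 'rV[C]_n) t (h : D -> C) w :
  U s (gt r0 u t) h w = h (((gt r0 u t)^-1)%g w) * (r^-1 `^ s)%:C.
Proof.
rewrite /U cjac_gtV normcX normc_real gtr0_norm ?invr_gt0//.
have rV : 0 <= r^-1 by rewrite invr_ge0 ltW.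
by rewrite -powR_mulrn// -powRrM mulrCA divff ?mulr1// pnatr_eq0.
Qed.

Lemma U_mul s (f g : biholo R n) (h : D -> C) : GT R n f -> GT R n g ->
  U s f (U s g h) = U s (f * g)%g h.
Proof.
move=> /GT_gt[r1 [u1 [t1 [r10 ->]]]] /GT_gt[r2 [u2 [t2 [r20 ->]]]].
apply/funext => w.
have := U_gt s (mulr_gt0 r10 r20) (r1%:C *: u2 + u1)
    (r1 ^+ 2 * t2 + t1 - 2 * r1 * complex.Im (herm u2 u1)) h w.
rewrite -gtM => ->; rewrite !U_gt.
have -> : ((gt r10 u1 t1 * gt r20 u2 t2)^-1)%g w = ((gt r20 u2 t2)^-1)%g (((gt r10 u1 t1)^-1)%g w) by [].
rewrite invfM powRM ?invr_ge0 ?(ltW r10) ?(ltW r20)// rcM.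
by rewrite -mulrA [X in _ * X]mulrC.
Qed.

Lemma U_linear s f (a : C) (h1 h2 : D -> C) : U s f (a *: h1 + h2) = a *: U s f h1 + U s f h2.
Proof. by apply/funext => w; rewrite /U !fctE mulrDl scalerAl. Qed.

Lemma U_gt1 s (h : D -> C) : U s 1%g h = h.
Proof.
apply/funext => w; rewrite -gt1 U_gt invr1 powR1 (rc_nat 1) mulr1; congr h.
by rewrite gt1 invg1.
Qed.

Lemma height_gt r (r0 : 0 < r) (u : 'rV[C]_n) t w : height (\val (gt r0 u t w)) = r ^+ 2 * height (\val w).
Proof.
apply: complexI; rewrite -kap_diag -[gt r0 u t w]/(gfun r u t w) val_gfun// kap_gmap kap_diag.
by rewrite rcM rcX.
Qed.

Lemma height_base : height (\val (base R n)) = 1.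
Proof.
rewrite /height [\val _]/= zeta_pt zcoord_pt /=.
by rewrite /sqnorm big1 ?subr0// => i _; rewrite mxE normc0 expr0n.
Qed.

Lemma kernelA_diag s (w : D) : kernelA s w w = (height (\val w) `^ (- s))%:C.
Proof.
rewrite /kernelA -/(kap _ _) kap_diag cpow_real//.
by apply/siegelP; exact: valD.
Qed.

End GTGroup.

Section Representation.
Context {R : realType} {n : nat} (s : R) (H : hol_hilbert R n) (T : biholo R n -> H -> H).
Local Notation C := R[i].
Local Notation D := (siegel R n).
Hypothesis TP : forall f, GT R n f -> forall h, hol_fun (T f h) = U s f (hol_fun h).

Lemma rep_linear f (a : C) x y : GT R n f -> T f (a *: x + y) = a *: T f x + T f y.
Proof. by move=> gf; apply: (@hol_fun_inj R n H); rewrite TP// !linearP /= !TP// U_linear. Qed.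

Lemma rep_mul f g x : GT R n f -> GT R n g -> T f (T g x) = T (f * g)%g x.
Proof. by move=> gf gg; apply: (@hol_fun_inj R n H); rewrite !TP ?U_mul//; exact: GTM. Qed.

Lemma rep_V f x : GT R n f -> T (f^-1)%g (T f x) = x.
Proof.
move=> gf; have gV := GTV gf; rewrite rep_mul// mulVg.
apply: (@hol_fun_inj R n H); rewrite TP ?U_gt1//.
by rewrite -gt1; exact: gt_GT.
Qed.

Lemma rep_VK f x : GT R n f -> T f (T (f^-1)%g x) = x.
Proof. by move=> gf; have := rep_V x (GTV gf); rewrite invgK. Qed.

End Representation.

Section IsometricCase.
Context {R : realType} {n : nat} (s : R) (H : hol_hilbert R n).
Local Notation C := R[i].
Local Notation D := (siegel R n).
Local Notation dot := (@hol_dot R n H).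
Local Notation nrm := (fnorm dot).
Let BP := hol_dot_form H.
Hypothesis Hinv : invariant_with_norm (GT R n) (U s) H.
Hypothesis eval : forall w, exists K : R, forall h : H, normc (hol_fun h w) <= K * nrm h.
Hypothesis Hnt : nontrivial H.

Lemma isometric_kernel : 0 <= s /\ exists c : R, 0 < c /\ forall w, exists k : H,
  hol_fun k = (fun w' => c%:C * kernelA s w' w) /\ forall h, hol_fun h w = dot h k.
Proof.
have rz w : exists kw : H, forall h, hol_fun h w = dot h kw.
  have [K KP] := eval w.
  apply: (riesz BP (@hol_nrm_eq0 _ _ H) (@hol_complete _ _ H) (K := K)) => // a x y.
  by rewrite linearP.
have [k kP] := choice rz.
have tz f : exists Tf : H -> H, GT R n f -> forall h, hol_fun (Tf h) = U s f (hol_fun h) /\ `|Tf h| = `|h|.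
  have [gf|ngf] := pselect (GT R n f); last by exists id.
  by have [Tf TfP] := choice (Hinv gf); exists Tf.
have [T TP] := choice tz.
have TU f gf h := (TP f gf h).1.
have TN f h : GT R n f -> nrm (T f h) = nrm h.
  by move=> gf; have := (TP f gf h).2; rewrite !hol_norm => /complexI.
(* Polarisation: norms of sums give the real part, and replacing [h] by [i h] gives the imaginary
   part. *)
have TB f h h' : GT R n f -> dot (T f h) (T f h') = dot h h'.
  move=> gf.
  have re x y : complex.Re (dot (T f x) (T f y)) = complex.Re (dot x y).
    have := TN f (1 *: x + y) gf; rewrite (rep_linear TU)// !scale1r => /(congr1 (fun t => t ^+ 2)).
    by rewrite !(fnorm_sqrD BP) !TN//; lra.
  apply: ceq; first exact: re.
  have := re ('i%C *: h + 0) h'.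
  rewrite (rep_linear TU)//.
  have T0 : T f 0 = 0.
    by have := rep_linear TU (-1) 0 0 gf; rewrite scaler0 addr0 scaleN1r addNr.
  rewrite T0 !addr0 !(formZl BP).
  by case: (dot _ _) (dot _ _) => a b [a' b'] /=; lra.
pose K w w' := hol_fun (k w') w.
have KE w w' : K w w' = dot (k w') (k w) by rewrite /K kP.
have KC w w' : K w' w = (K w w')^* by rewrite !KE (formC BP).
have Kdiag w : exists2 N : R, 0 <= N & K w w = N%:C.
  by exists (nrm (k w) ^+ 2); rewrite ?sqr_ge0// KE (form_diag BP).
(* The isometry attached to [f] sends [k w] to a multiple of [k (f w)]: the difference is orthogonal
   to every vector, since every vector is in the range of that isometry. *)
have Kgt r (r0 : 0 < r) u t w : K (gt r0 u t w) (gt r0 u t w) = ((r^-1 `^ s) ^+ 2)%:C * K w w.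
  set f := gt r0 u t; set rho := r^-1 `^ s.
  have gf : GT R n f by exact: gt_GT.
  have kf : k (f w) = rho%:C *: T f (k w).
    apply/eqP; rewrite -subr_eq0; apply/eqP; apply: hol_nrm_eq0.
    set d := _ - _; suff d0 : dot d d = 0.
      by rewrite /fnorm d0 /= sqrtr0.
    have all x : dot x d = 0.
      rewrite -(rep_VK TU x gf) /d (formBr BP) (formZr BP) conj_real TB// -!kP TU// U_gt -/rho.
      have -> : ((gt r0 u t)^-1)%g (f w) = w by exact: biholo_funK.
      by rewrite mulrC subrr.
    exact: all.
  by rewrite !KE kf (formZl BP) (formZr BP) TB// conj_real mulrA -rcM expr2.
have [c c0 cE] := Kdiag (base R n).
have KA w : K w w = c%:C * kernelA s w w.
  have [r [u [t [r0 <-]]]] := transitive_base w.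
  rewrite Kgt cE kernelA_diag height_gt height_base mulr1 mulrC; congr (_ * _%:C).
  rewrite powRN -[r ^+ 2]powR_mulrn ?ltW// -powRrM mulrC powRrM powR_mulrn ?powR_ge0// -exprVn.
  congr (_ ^+ 2); apply: (mulfI (x := r `^ s)); first by rewrite gt_eqF// powR_gt0.
  by rewrite -powRM ?invr_ge0 ?ltW// divff ?gt_eqF// powR1 divff// gt_eqF// powR_gt0.
have holK (w' : D) : holomorphic (fun w => kernelA s w w').
  apply: (@hol_outer R n (fun w : D => kap (\val w) (\val w')) (fun z => cpow z (- s))).
    exact: hol_kap.
  by move=> w; apply: cdiff_cpow; apply: Re_kap_gt0; exact: valD.
have EK : forall w w', K w w' - c%:C * kernelA s w w' = 0.
  apply: diagonal_determines.
  - move=> w'; apply: holB; first exact: hol_fun_hol.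
    by apply: holM; [exact: hol_cst|exact: holK].
  - by move=> w w'; rewrite conjcB conjcM conj_real -KC -kernelAC.
  - by move=> w; rewrite KA subrr.
  (* Local boundedness of the difference: [kernelA] is continuous, and [K] is bounded by its
     diagonal through Cauchy-Schwarz, where it is already known to equal [c] times [kernelA]. *)
  move=> a b sa.
  have L : continuous (fun s : C => a + s *: b).
    by move=> z; apply: differentiable_continuous; exact: diff_line.
  have sa0 : siegel R n (a + (0 : C) *: b) by rewrite scale0r addr0.
  have [r1 r10 r1P] := @copen_line R n a b 0 sa0.
  have cvl (x : C * C -> C) : x p @[p --> (0, 0)] --> (0 : C) -> \val (toD (a + x p *: b)) @[p --> (0, 0)] --> \val (toD a).
    move=> cx; rewrite toDK//.
    have h : (a + x p *: b) @[p --> ((0 : C), (0 : C))] --> a.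
      by have := cvg_comp _ _ cx (L 0); rewrite scale0r addr0.
    apply: cvg_trans h; apply: near_eq_cvg.
    have N : \forall p \near ((0 : C), (0 : C)), siegel R n (a + x p *: b).
      have N0 : nbhs (0 : C) [set z | siegel R n (a + z *: b)] by apply/cnbhsP; exists r1.
      exact: (cx _ N0).
    by apply: filterS N => p sp; rewrite toDK.
  have cv : kernelA s (toD (a + p.1 *: b)) (toD (a + p.2 *: b)) @[p --> ((0 : C), (0 : C))] -->
      kernelA s (toD a) (toD a).
    by apply: cvg_kernelA; [exact: (cvl fst cvg_fst) | exact: (cvl snd cvg_snd)].
  pose M := normc (kernelA s (toD a) (toD a)) + 1.
  have [r r0 rP] : exists2 r : R, 0 < r & forall z z', normc z < r -> normc z' < r ->
      normc (kernelA s (toD (a + z *: b)) (toD (a + z' *: b))) <= M.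
    have /cvgrPdist_lt/(_ 1 ltr01) := cv.
    case=> -[A1 A2] [/= /cnbhsP[d1 d10 A1P] /cnbhsP[d2 d20 A2P]] sub.
    exists (Num.min d1 d2) => [|z z']; first by rewrite lt_min d10.
    rewrite !lt_min => /andP[z1 _] /andP[_ z2].
    have A12 : (A1 `*` A2) (z, z') by split; [apply: A1P | apply: A2P]; rewrite subr0.
    have h : normc (kernelA s (toD a) (toD a) - kernelA s (toD (a + z *: b)) (toD (a + z' *: b))) < 1.
      by rewrite -ltcR (rc_nat 1); exact: (sub _ A12).
    have := ler_normcB (kernelA s (toD a) (toD a))
      (kernelA s (toD a) (toD a) - kernelA s (toD (a + z *: b)) (toD (a + z' *: b))).
    rewrite subKr /M => h'; apply: le_trans h' _; rewrite lerD2l; exact: ltW.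
  exists (c * M + c * M), r; split=> // z z' zr z'r sz sz'.
  have M0 : 0 <= M by rewrite addr_ge0// normc_ge0.
  have cA w w' : normc (c%:C * kernelA s w w') = c * normc (kernelA s w w').
    by rewrite normcM normc_real ger0_norm.
  apply: le_trans (ler_normcB _ _) _; apply: lerD; last by rewrite cA ler_wpM2l// rP.
  have nk z1 : normc z1 < r -> nrm (k (toD (a + z1 *: b))) ^+ 2 <= c * M.
    move=> z1r; have := congr1 (@normc R) (KA (toD (a + z1 *: b))).
    rewrite KE (form_diag BP) normc_real ger0_norm ?sqr_ge0// cA => ->.
    by rewrite ler_wpM2l// rP.
  rewrite KE; apply: le_trans (form_bound BP _ _) _.
  rewrite -[leRHS]sqr_sqrtr ?mulr_ge0// expr2.
  by apply: ler_pM; rewrite ?fnorm_ge0// -[leLHS]ger0_norm ?fnorm_ge0// -sqrtr_sqr ler_wsqrtr// nk.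
have KEA w w' : K w w' = c%:C * kernelA s w w' by apply/eqP; rewrite -subr_eq0 EK.
have c_gt0 : 0 < c.
  rewrite lt_def c0 andbT; apply/eqP => c00; have [h h0] := Hnt.
  have k0 w : k w = 0.
    apply: hol_nrm_eq0; apply/eqP; rewrite -sqrf_eq0; apply/eqP; apply: complexI.
    by rewrite -(form_diag BP) -KE KEA c00 mul0r.
  case/eqP: h0; apply: (@hol_fun_inj R n H); apply/funext => w.
  by rewrite kP k0 (form0r BP) linear0.
split; last first.
  exists c; split => // w; exists (k w); split; last exact: kP.
  by apply/funext => w'; exact: KEA.
rewrite leNgt; apply/negP => s0.
(* Two points on the imaginary axis at heights 1 and 3: [kap] between them is the arithmetic mean 2,
   and its square 4 exceeds the product 3. Cauchy-Schwarz would read [4]^ (- s) <= 3 [^ (- s)],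
   which fails for negative [s]. *)
pose x1 : 'rV[C]_n.+1 := pt 0 (Complex 0 3).
have h1 : height x1 = 3.
  by rewrite /height zeta_pt zcoord_pt /= /sqnorm big1 ?subr0// => i _; rewrite mxE normc0 expr0n.
have sx1 : siegel R n x1 by apply/siegelP; rewrite h1.
have kp : kap (\val (base R n)) (\val (toD x1)) = 2%:C.
  rewrite toDK// /kap [\val _]/= !zeta_pt !zcoord_pt herm0l subr0 inv_2i conjcE.
  by apply: ceq => /=; field.
have A01 : kernelA s (base R n) (toD x1) = (2 `^ (- s))%:C.
  by rewrite /kernelA -/(kap _ _) kp cpow_real.
have := form_bound BP (k (toD x1)) (k (base R n)); rewrite -KE KEA A01 -rcM normc_real.
have n0 : nrm (k (base R n)) ^+ 2 = c.
  by apply: complexI; rewrite -(form_diag BP) -KE cE.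
have n1 : nrm (k (toD x1)) ^+ 2 = c * 3 `^ (- s).
  by apply: complexI; rewrite -(form_diag BP) -KE KEA kernelA_diag toDK// h1 rcM.
rewrite ger0_norm ?mulr_ge0 ?powR_ge0//.
rewrite -(@ler_pXn2r _ 2)// ?nnegrE ?mulr_ge0 ?powR_ge0 ?fnorm_ge0// !exprMn n0 n1.
rewrite [leRHS]mulrAC -expr2 ler_pM2l ?exprn_gt0//.
rewrite -powR_mulrn ?powR_ge0// -powRrM mulrC powRrM powR_mulrn// leNgt => /negP; apply.
have -> : (2 : R) ^+ 2 = 4 by rewrite -natrX.
by apply: gt0_ltr_powR; rewrite ?oppr_gt0 ?nnegrE// ltr_nat.
Qed.

End IsometricCase.

(** * Bounded representations *)

Section Final.
Context {R : realType} {n : nat}.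
Local Notation C := R[i].
Local Notation D := (siegel R n).
Local Notation nrm H := (fnorm (@hol_dot R n H)).

(** Continuity at 0 for uniform convergence on the singleton of [w] bounds the evaluation on a ball
    of radius [d]; rescaling [h] to norm [d / 2] makes the bound linear. *)
Lemma eval_bounded (H : hol_hilbert R n) : continuously_embedded H ->
  forall w, exists K : R, forall h : H, normc (hol_fun h w) <= K * nrm H h.
Proof.
move=> emb w.
have := emb 0; rewrite /continuous_at => /fam_cvgP/(_ [set w] (compact_set1 (x := w))) cw.
have E1 : entourage [set xy : C * C | ball xy.1 1 xy.2] by rewrite -entourage_ballE; exists 1 => //=.
have N : nbhs (@hol_fun R n H 0 : {uniform` [set w] -> C}) [set f : D -> C | ball (hol_fun (0 : H) w) 1 (f w)].
  by apply/uniform_nbhs; exists [set xy : C * C | ball xy.1 1 xy.2]; split => // f fw; exact: fw.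
have /nbhs_ballP[e /= e0 eP] := cw _ N.
have [d d0 dE] : exists2 d : R, 0 < d & e = d%:C.
  by move: e0; case: (e) => a b; rewrite ltcE /= => /andP[/eqP -> a0]; exists a.
have BP := hol_dot_form H.
exists (2 / d) => h.
have [h0|h0] := eqVneq (nrm H h) 0.
  by rewrite h0 (hol_nrm_eq0 h0) linear0 normc0 mulr0.
have hp : 0 < nrm H h by rewrite lt_def h0 fnorm_ge0.
pose t : R := d / (2 * nrm H h).
have t0 : 0 < t by rewrite divr_gt0// mulr_gt0.
have tn : normc (t%:C : C) = t by rewrite normc_real gtr0_norm.
have := eP (t%:C *: h); rewrite -ball_normE /= sub0r normrN hol_norm dE ltcR (fnormZ BP) tn.
have -> : t * nrm H h = d / 2 by rewrite /t; field.
have -> : d / 2 < d by rewrite ltr_pdivrMr// ltr_pMr// ltr1n.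
move=> /(_ isT); rewrite -ball_normE /= linear0 sub0r normrN linearZ => h1.
have th : normc (t%:C * hol_fun h w) < 1 by rewrite -ltcR (rc_nat 1); exact: h1.
rewrite normcM tn in th.
have -> : 2 / d * nrm H h = t^-1 by rewrite /t; field; rewrite h0 gt_eqF.
by rewrite -[t^-1]mulr1 ler_pdivlMl// ltW.
Qed.

Section Scaled.
Variables (H : hol_hilbert R n) (c : R).
Hypothesis c0 : 0 < c.
Let BP := hol_dot_form H.
Let sc (x y : H) : C := c%:C * hol_dot x y.

Let sc_pos : pos_form sc.
Proof.
split=> [a x y z|x y|x].
- by case: BP => L _ _; rewrite /sc L; ring.
- by rewrite /sc (formC BP) conjcM conj_real.
- by rewrite /sc (form_diag BP) -rcM /= mulr_ge0 ?sqr_ge0// ltW.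
Qed.

Lemma scaled_fnorm (x : H) : fnorm sc x = Num.sqrt c * nrm H x.
Proof.
rewrite {1}/fnorm /sc (form_diag BP) -rcM /= sqrtrM ?ltW// sqrtr_sqr ger0_norm//.
exact: fnorm_ge0.
Qed.

Let sc0 : 0 < Num.sqrt c. Proof. by rewrite sqrtr_gt0. Qed.
Let scV0 : 0 < (Num.sqrt c)^-1. Proof. by rewrite invr_gt0. Qed.

Let sc_low (x : H) : `|x| <= ((Num.sqrt c)^-1)%:C * (fnorm sc x)%:C.
Proof. by rewrite scaled_fnorm hol_norm -rcM mulrA mulVf ?gt_eqF// mul1r. Qed.

Let sc_up (x : H) : (fnorm sc x)%:C <= (Num.sqrt c)%:C * `|x|.
Proof. by rewrite scaled_fnorm hol_norm rcM. Qed.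

Definition scaled_form : eqv_form H := EqvForm sc_pos scV0 sc_low sc0 sc_up.

End Scaled.

(** Multiplying the scalar product by [c] divides the reproducing kernel by [c], which normalises it
    to [kernelA s]. *)
Lemma isometric_As (s : R) (H : hol_hilbert R n) :
  invariant_with_norm (GT R n) (U s) H ->
  (forall w, exists K : R, forall h : H, normc (hol_fun h w) <= K * nrm H h) ->
  nontrivial H -> 0 <= s /\ exists c, exists c0 : 0 < c, is_As s (renorm_hilbert (scaled_form H c0)).
Proof.
move=> inv ev nt; have [s0 [c [c0 kP]]] := isometric_kernel inv ev nt.
split => //; exists c, c0 => w; have [k [kE kh]] := kP w.
have cn0 : c%:C != 0 :> C by rewrite -normc_eq0 normc_real normr_eq0 gt_eqF.
have fk : hol_fun ((c%:C)^-1 *: k : H) = (kernelA s) ^~ w.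
  by rewrite linearZ /= kE; apply/funext => v; rewrite fctE /GRing.scale /= mulKf.
exists ((c%:C)^-1 *: k : H); split; first exact: fk.
move=> a; rewrite -[RHS]/(c%:C * @hol_dot R n H a ((c%:C)^-1 *: k)).
rewrite (formZr (hol_dot_form H)) conjcV conj_real mulrA divff// mul1r.
exact: kh.
Qed.

Lemma isometric_case (s : R) (H : hol_hilbert R n) : nontrivial H -> continuously_embedded H ->
  invariant_with_norm (GT R n) (U s) H ->
  0 <= s /\ exists A : hol_hilbert R n, [/\ is_As s A, same_space H A & proportional_norms H A].
Proof.
move=> nt emb inv; have [s0 [c [c0 As]]] := isometric_As inv (eval_bounded emb) nt.
split => //; exists (renorm_hilbert (scaled_form H c0)); split => //.
have q0 : 0 < Num.sqrt c by rewrite sqrtr_gt0.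
exists (Num.sqrt c)^-1; rewrite invr_gt0; split => // h a /(@hol_fun_inj R n H) ->.
have e : (nrm H a)%:C = ((Num.sqrt c)^-1)%:C * (fnorm (scaled_form H c0) a)%:C :> C.
  by rewrite (scaled_fnorm c0) -rcM mulrA mulVf ?gt_eqF// mul1r.
exact: (etrans (@hol_norm R n H a) e).
Qed.

Section BoundedCase.
Variables (s : R) (H : hol_hilbert R n) (T : biholo R n -> H -> H) (M : R).
Hypothesis TP : forall f, GT R n f -> forall h, hol_fun (T f h) = U s f (hol_fun h).
Hypothesis M0 : 0 < M.
Hypothesis TM : forall f, GT R n f -> forall h, nrm H (T f h) <= M * nrm H h.
Let nr := nrm H.
Let nr0 x : 0 <= nr x. Proof. exact: fnorm_ge0. Qed.

Let MT f h : GT R n f -> nr h <= M * nr (T f h).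
Proof. by move=> gf; rewrite -{1}(rep_V TP h gf); apply: TM; exact: GTV. Qed.

Definition heis_center (t : R) : biholo R n := gt ltr01 0 t.
Definition heis (u : 'rV[C]_n) : biholo R n := gt ltr01 u 0.
Definition dilation (a : R) : biholo R n := gt (expR_gt0 a) 0 0.

Lemma heis_centerM t t' : (heis_center t * heis_center t')%g = heis_center (t + t').
Proof.
rewrite /heis_center gtM; apply: gt_eq; rewrite ?mulr1 ?scaler0 ?addr0// herm0l /=.
by ring.
Qed.

Lemma heis_centerC u t : (heis u * heis_center t)%g = (heis_center t * heis u)%g.
Proof.
rewrite /heis_center /heis !gtM; apply: gt_eq => //.
  by rewrite scaler0 add0r addr0 (rc_nat 1) scale1r.
by rewrite herm0l herm0r /=; ring.
Qed.

(** [heis] is additive only up to the centre, which does no harm once the form is invariant under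
    the centre. *)
Lemma heisM u u' : exists t, (heis u * heis u')%g = (heis_center t * heis (u + u'))%g.
Proof.
exists (- 2 * complex.Im (herm u' u)); rewrite /heis_center /heis !gtM; apply: gt_eq => //.
  by rewrite (rc_nat 1) !scale1r addr0 addrC.
by rewrite herm0r /=; ring.
Qed.

Lemma dilationM a a' : (dilation a * dilation a')%g = dilation (a + a').
Proof.
rewrite /dilation gtM; apply: gt_eq; rewrite ?expRD ?scaler0 ?addr0//.
by rewrite herm0l /=; ring.
Qed.

(** Dilations normalise the centre and, by the next lemma, the family [heis], so averaging over
    dilations keeps the invariances under both. *)
Lemma dilation_center a t : (dilation a * heis_center t)%g = (heis_center (expR a ^+ 2 * t) * dilation a)%g.
Proof.
rewrite /dilation /heis_center !gtM; apply: gt_eq; rewrite ?mulr1 ?mul1r ?scaler0 ?addr0//.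
by rewrite herm0l /=; ring.
Qed.

Lemma dilation_heis a u : (dilation a * heis u)%g = (heis ((expR a)%:C *: u) * dilation a)%g.
Proof.
rewrite /dilation /heis !gtM; apply: gt_eq; rewrite ?mulr1 ?mul1r//.
  by rewrite scaler0 addr0 add0r.
by rewrite herm0l herm0r /=; ring.
Qed.

Lemma gt_factor r (r0 : 0 < r) u t : gt r0 u t = (heis_center t * (heis u * dilation (ln r)))%g.
Proof.
rewrite /heis_center /heis /dilation !gtM; apply: gt_eq.
- by rewrite !mul1r lnK// posrE.
- by rewrite (rc_nat 1) !scale1r add0r addr0.
- by rewrite herm0l herm0r /=; ring.
Qed.

Let gzG t : GT R n (heis_center t). Proof. exact: gt_GT. Qed.
Let ghG u : GT R n (heis u). Proof. exact: gt_GT. Qed.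
Let gdG a : GT R n (dilation a). Proof. exact: gt_GT. Qed.

(* [GT] is solvable: average successively over the centre of the Heisenberg
   group, over its abelian quotient, and over the dilations. *)
Lemma invariant_form : exists2 B, equiv_form nr B &
  forall f, GT R n f -> forall x y, B (T f x) (T f y) = B x y.
Proof.
have B0P : equiv_form nr (@hol_dot R n H).
  split; first exact: hol_dot_form.
    by exists 1 => // x; rewrite mul1r.
  by exists 1 => // x; rewrite mul1r.
have av (V : zmodType) (g : V -> biholo R n) B : (forall v, GT R n (g v)) -> equiv_form nr B ->
    exists2 B', equiv_form nr B' & forall (S : H -> H) v0,
    (forall v x y, B (T (g v) (S x)) (T (g v) (S y)) = B (T (g (v + v0)) x) (T (g (v + v0)) y)) ->
    forall x y, B' (S x) (S y) = B' x y.
  move=> gG BE; apply: (@average_form R V H nr nr0 B (fun v => T (g v)) M) => //.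
  - by move=> v a x y; exact: (rep_linear TP a x y (gG v)).
  - by move=> v x; exact: TM.
  - by move=> v x; exact: MT.
have mul f g x : GT R n f -> GT R n g -> T f (T g x) = T (f * g)%g x by exact: (rep_mul TP).
have [B1 B1E B1P] := av _ heis_center _ gzG B0P.
have [B2 B2E B2P] := av _ heis _ ghG B1E.
have [B3 B3E B3P] := av _ dilation _ gdG B2E.
have I1z t x y : B1 (T (heis_center t) x) (T (heis_center t) y) = B1 x y.
  by apply: (B1P _ t) => v x' y'; rewrite !mul// heis_centerM.
(* An invariance obtained earlier survives the next average: the element is moved past the new
   family, where the older form absorbs it, and the parameter is shifted by 0. *)
have I2z t x y : B2 (T (heis_center t) x) (T (heis_center t) y) = B2 x y.
  by apply: (B2P _ 0) => v x' y'; rewrite addr0 !mul// heis_centerC -!mul// I1z.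
have I2h u x y : B2 (T (heis u) x) (T (heis u) y) = B2 x y.
  apply: (B2P _ u) => v x' y'; rewrite !mul//; have [t ->] := heisM v u.
  by rewrite -!mul// I1z.
have I3z t x y : B3 (T (heis_center t) x) (T (heis_center t) y) = B3 x y.
  by apply: (B3P _ 0) => v x' y'; rewrite addr0 !mul// dilation_center -!mul// I2z.
have I3h u x y : B3 (T (heis u) x) (T (heis u) y) = B3 x y.
  by apply: (B3P _ 0) => v x' y'; rewrite addr0 !mul// dilation_heis -!mul// I2h.
have I3d a x y : B3 (T (dilation a) x) (T (dilation a) y) = B3 x y.
  by apply: (B3P _ a) => v x' y'; rewrite !mul// dilationM.
exists B3 => // f /GT_gt[r [u [t [r0 ->]]]] x y.
have E z : T (gt r0 u t) z = T (heis_center t) (T (heis u) (T (dilation (ln r)) z)).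
  have G2 : GT R n (heis u * dilation (ln r))%g by exact: GTM.
  by rewrite gt_factor -(mul _ _ z (gzG t) G2) -(mul _ _ z (ghG u) (gdG _)).
by rewrite !E I3z I3h I3d.
Qed.

Lemma renorm_isometric : exists B : eqv_form H,
  invariant_with_norm (GT R n) (U s) (renorm_hilbert B).
Proof.
have [B [BP [l l0 lP] [u u0 uP]] BI] := invariant_form.
have lP' (x : H) : `|x| <= l%:C * (fnorm B x)%:C by rewrite hol_norm -rcM lecR; exact: lP.
have uP' (x : H) : (fnorm B x)%:C <= u%:C * `|x| by rewrite hol_norm -rcM lecR; exact: uP.
exists (EqvForm BP l0 lP' u0 uP') => f gf h; exists (T f h : H); split; first exact: (TP gf h).
by rewrite -[LHS]/((fnorm B (T f h))%:C) -[RHS]/((fnorm B h)%:C) /fnorm BI.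
Qed.

End BoundedCase.

Lemma bounded_case (s : R) (H : hol_hilbert R n) : nontrivial H -> continuously_embedded H ->
  bounded_representation (GT R n) (U s) H ->
  0 <= s /\ exists A : hol_hilbert R n, [/\ is_As s A, same_space H A & equivalent_norms H A].
Proof.
move=> nt emb [M MP].
have tz f : exists Tf : H -> H, GT R n f -> forall h, hol_fun (Tf h) = U s f (hol_fun h) /\ `|Tf h| <= M%:C * `|h|.
  have [gf|ngf] := pselect (GT R n f); last by exists id.
  by have [Tf TfP] := choice (MP f gf); exists Tf.
have [T TP] := choice tz.
have TU f gf h := (TP f gf h).1.
(* The bound in the hypothesis has no sign, while averaging asks for a positive constant. *)
have M10 : 0 < `|M| + 1 by rewrite ltr_wpDl.
have TM f : GT R n f -> forall h, nrm H (T f h) <= (`|M| + 1) * nrm H h.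
  move=> gf h; have := (TP f gf h).2; rewrite !hol_norm -rcM lecR => h1; apply: le_trans h1 _.
  by rewrite ler_wpM2r ?fnorm_ge0// (le_trans (ler_norm M))// lerDl.
have [B inv] := renorm_isometric TU M10 TM.
pose H' := renorm_hilbert B.
have ev w : exists K : R, forall h : H', normc (hol_fun h w) <= K * nrm H' h.
  have [K KP] := eval_bounded emb w.
  exists (`|K| * elow B) => h.
  apply: (@le_trans _ _ (`|K| * nrm H (h : H))).
    apply: (le_trans (KP (h : H))); rewrite ler_wpM2r ?fnorm_ge0//; exact: ler_norm.
  rewrite -mulrA ler_wpM2l//.
  by have := elow_le B (h : H); rewrite hol_norm -rcM lecR.
have nt' : nontrivial H' by case: nt => h h0; exists (h : H').
have [s0 [c [c0 As]]] := isometric_As inv ev nt'.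
split => //; exists (renorm_hilbert (scaled_form H' c0)); split => //.
have q0 : 0 < Num.sqrt c by rewrite sqrtr_gt0.
(* The norm of the scaled space is [Num.sqrt c] times that of [B]; the constants are
   [1 / (Num.sqrt c * eup B)], unsimplified, and [elow B / Num.sqrt c]. *)
exists (elow B / (Num.sqrt c * eup B * elow B)), (elow B / Num.sqrt c).
have l0 := elow_gt0 B; have u0 := eup_gt0 B.
split; rewrite ?divr_gt0 ?mulr_gt0// => h a /(@hol_fun_inj R n H) ->.
have nA : `|a| = (Num.sqrt c * fnorm B a)%:C :> C by exact: (congr1 (real_complex R) (scaled_fnorm c0 (a : H'))).
rewrite nA -!rcM.
have nH : `|a : H| = (nrm H a)%:C by exact: hol_norm.
have h1 := elow_le B (a : H); have h2 := eup_le B (a : H).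
rewrite nH -rcM lecR in h1; rewrite nH -rcM lecR in h2.
rewrite -[X in _ <= X <= _]/(`|a : H|) nH !lecR.
have -> : elow B / Num.sqrt c * (Num.sqrt c * fnorm B a) = elow B * fnorm B a.
  by field; rewrite gt_eqF.
rewrite h1 andbT.
have -> : elow B / (Num.sqrt c * eup B * elow B) * (Num.sqrt c * fnorm B a) = (eup B)^-1 * fnorm B a.
  by field; rewrite !gt_eqF.
by rewrite ler_pdivrMl.
Qed.

End Final.

Theorem theorem3p3 (R : realType) (n : nat) (s : R) :
  (0 <= s ->
     forall A : hol_hilbert R n, is_As s A ->
     forall (G : topologicalGroupType) (p : {multiplicative G -> biholo R n}),
       universal_covering p ->
     forall b : G * siegel R n -> R[i], jacobian_power s p b ->
     invariant_with_norm [set: G] (Utilde p b) A) /\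
  (forall H : hol_hilbert R n, nontrivial H -> continuously_embedded H ->
     (bounded_representation (GT R n) (U s) H ->
        0 <= s /\ exists A : hol_hilbert R n,
          [/\ is_As s A, same_space H A & equivalent_norms H A]) /\
     (invariant_with_norm (GT R n) (U s) H ->
        0 <= s /\ exists A : hol_hilbert R n,
          [/\ is_As s A, same_space H A & proportional_norms H A])).
Proof.
split=> [_ A As G p pcov b bP|H nt emb]; first exact: (invariant_As As pcov bP).
by split; [exact: bounded_case | exact: isometric_case].
Qed.
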